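(* The spectral density $f_{MA}$ of the moving average $(\theta(B)Z_n)_{n\in\mathbb{Z}}$ in the ARMA representation $\phi(B)Y^\Delta_n=\theta(B)Z_n$, $n\in\mathbb{Z}$, of the sampled process $Y^\Delta$ has the asymptotic form, as $\Delta\downarrow 0$, $$f_{MA}(\omega)\sim\frac{\sigma^2}{2\pi}(-1)^{p-q-1}\Delta^{2(p-q)-1}c_{p-q-1}(\omega)\,2^{p-1}(1-\cos\omega)^p,\qquad -\pi\le\omega\le\pi,$$ where $c_k(\omega)$ is the coefficient of $x^{2k+1}$ in the power series expansion $$\frac{\sinh x}{\cosh x-\cos\omega}=\sum_{k=0}^\infty c_k(\omega)x^{2k+1}.$$ In particular, $$c_0(\omega)=\frac{1}{1-\cos\omega},\quad c_1(\omega)=-\frac{2+\cos\omega}{6(1-\cos\omega)^2},\quad c_2(\omega)=\frac{33+26\cos\omega+\cos(2\omega)}{240(1-\cos\omega)^3},\ \ldots$$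
   Context: Let $L=(L_t)_{t\in\mathbb{R}}$ be a (two-sided, real-valued) second-order Lévy process with $E L_1=0$ and $E L_1^2=\sigma^2$. Let $p,q$ be integers with $0\le q<p$, and let $a(z)=z^p+a_1z^{p-1}+\cdots+a_p$ and $b(z)=b_0+b_1z+\cdots+b_{p-1}z^{p-1}$ be real polynomials with $b_q=1$ and $b_j=0$ for $q<j<p$. Assume $a$ and $b$ have no common zeroes and all zeroes of $a$ have strictly negative real part. Denote the zeroes of $a$, repeated according to multiplicity, by $\lambda_1,\dots,\lambda_p$. The CARMA$(p,q)$ process $Y=(Y_t)_{t\in\mathbb{R}}$ is the strictly stationary process $$Y_t=\int_{-\infty}^\infty g(t-u)\,dL_u,\qquad g(t)=\sum_{\lambda}\mathrm{Res}_{z=\lambda}\Big(e^{zt}\frac{b(z)}{a(z)}\Big)\ (t>0),\quad g(t)=0\ (t\le 0),$$ the sum being over the distinct zeroes $\lambda$ of $a$. Equivalently, $Y$ is the unique strictly stationary solution of $Y_t=\mathbf b^\top \mathbf X_t$, $d\mathbf X_t=A\mathbf X_t\,dt+\mathbf e_p\,dL_t$, where $A$ is the companion matrix of $a$ (ones on the superdiagonal, last row $(-a_p,\dots,-a_1)$), $\mathbf b=(b_0,\dots,b_{p-1})^\top$, $\mathbf e_p=(0,\dots,0,1)^\top$. For $\Delta>0$ the sampled process is $Y^\Delta=(Y_{n\Delta})_{n\in\mathbb{Z}}$, $Y^\Delta_n=Y_{n\Delta}$; $B$ is the backward shift ($BY^\Delta_n=Y^\Delta_{n-1}$), and $\phi(B)=\prod_{j=1}^p(1-e^{\lambda_j\Delta}B)$.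 The process $(\phi(B)Y_n^\Delta)_{n\in\mathbb{Z}}$ is strictly stationary with autocovariances vanishing at lags larger than $p-1$, hence it is a moving average of order at most $p-1$, written $\phi(B)Y^\Delta_n=\theta(B)Z_n$, where $\theta$ is a polynomial and $(Z_n)_{n\in\mathbb{Z}}$ is an uncorrelated sequence of zero-mean random variables with constant variance. With $\gamma_{MA}(n)$ denoting its autocovariance at lag $n$ (it depends on $\Delta$), its spectral density is $f_{MA}(\omega)=\frac1{2\pi}\sum_{h\in\mathbb{Z}}\gamma_{MA}(h)e^{-ih\omega}$, $-\pi\le\omega\le\pi$. The notation $u(\Delta)\sim v(\Delta)$ means $\lim_{\Delta\downarrow0}u(\Delta)/v(\Delta)=1$.
   Formalization: At ω=0 the expansion has a pole, so c_k(0) is undefined: the formulas are stated for ω≠0; at ω=0 the asymptotics are given only for q=0, with the right-hand side read as its limit (for q>0 that limit is 0 and ~ is meaningless); σ>0 is assumed. *)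

(* Defs.v *)
From HB Require Import structures.
From mathcomp Require Import all_boot all_order all_algebra.
From mathcomp Require Import complex.
From mathcomp Require Import all_classical all_reals all_analysis.

Set Implicit Arguments.
Unset Strict Implicit.
Unset Printing Implicit Defensive.

Import Order.TTheory GRing.Theory Num.Theory.
Import numFieldNormedType.Exports.

Local Open Scope classical_set_scope.
Local Open Scope complex_scope.
Local Open Scope ring_scope.

(* The complex numbers are R[i]; the topology of the library is attached to
   the copy (R[i])^o of R[i]. *)

Section Analysis.
Context {R : realType}.

Definition cexp (z : R[i]) : R[i] :=
  (expR (complex.Re z) * cos (complex.Im z)) +i*
  (expR (complex.Re z) * sin (complex.Im z)).

Definition sinh (x : R) : R := (expR x - expR (- x)) / 2.
Definition cosh (x : R) : R := (expR x + expR (- x)) / 2.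

(* f has at z0 a pole of order at most m.+1, with Laurent expansion
   \sum_k u_k (z - z0)^(k - m.+1); the coefficient of (z - z0)^-1 is u_m. *)
Definition is_residue (f : R[i] -> R[i]) (z0 c : R[i]) : Prop :=
  exists (m : nat) (u : nat -> R[i]),
    (\forall z \near ((z0 : (R[i])^o)^'),
       \sum_(0 <= k < n) (u k * (z - z0) ^+ k : (R[i])^o) @[n --> \oo]
         --> ((z - z0) ^+ m.+1 * f z : (R[i])^o)) /\
    c = u m.

Definition residue (f : R[i] -> R[i]) (z0 : R[i]) : R[i] :=
  xget 0 [set c | is_residue f z0 c].

Definition is_pseries (f : R -> R) (u : nat -> R) : Prop :=
  \forall x \near (0 : R), \sum_(0 <= k < n) u k * x ^+ k @[n --> \oo] --> f x.

Definition pseries_coef (f : R -> R) : nat -> R :=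
  xget (fun=> 0) [set u | is_pseries f u].

Definition c_coef (k : nat) (omega : R) : R :=
  pseries_coef (fun x => sinh x / (cosh x - cos omega)) (2 * k + 1).

Definition asymp_equiv (u v : R -> R[i]) : Prop :=
  (u D / v D : (R[i])^o) @[D --> (0 : R)^'+] --> (1 : (R[i])^o).

Definition spectral_density (gamma : int -> R) (omega : R) : R[i] :=
  ((2 * pi)^-1)%:C *
  lim (\sum_(0 <= k < N.*2.+1)
         ((gamma (k%:Z - N%:Z))%:C *
          cexp (0 +i* - ((k%:Z - N%:Z)%:~R * omega)) : (R[i])^o)
       @[N --> \oo]).

End Analysis.

Section Processes.
Context {d : measure_display} {T : measurableType d} {R : realType}.
Variable P : probability T R.

(* Taking some of the B i to be setT gives the product rule for subfamilies. *)
Definition mutually_independent (n : nat) (X : 'I_n -> T -> R) : Prop :=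
  forall B : 'I_n -> set R, (forall i, measurable (B i)) ->
    P (\bigcap_i (X i @^-1` B i)) = (\prod_(i < n) P (X i @^-1` B i))%E.

Record levy_process (L : R -> {RV P >-> R}) : Prop := LevyProcess {
  levy_start : {ae P, forall w, L 0 w = 0};
  levy_indep : forall (n : nat) (t : nat -> R),
    {homo t : i j / (i <= j)%N >-> i <= j} ->
    mutually_independent (fun (i : 'I_n) w => L (t i.+1) w - L (t i) w);
  levy_stationary : forall (s t h : R) (B : set R),
    s <= t -> measurable B ->
    P [set w | B (L (t + h) w - L (s + h) w)] = P [set w | B (L t w - L s w)];
  levy_stoch_cont : forall (t e : R), 0 < e ->
    P [set w | e < `|L s w - L t w|] @[s --> t] --> 0%E;
  levy_cadlag : {ae P, forall w, forall t : R,
    L s w @[s --> t^'+] --> L t w /\ cvg (L s w @[s --> t^'-])}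
}.

(* An element (c, (s, t)), with s <= t, stands for c times the indicator
   function of ]s, t]. *)
Definition step_fun (S : seq (R * (R * R))) (u : R) : R :=
  \sum_(x <- S) x.1 * \1_(`]x.2.1, x.2.2]%classic) u.

Definition step_integral (L : R -> T -> R) (S : seq (R * (R * R))) (w : T) : R :=
  \sum_(x <- S) x.1 * (L x.2.2 w - L x.2.1 w).

(* X is (a version of) the integral over R of the deterministic function f with
   respect to L: the L^2(P)-limit of the integrals of step functions which
   converge to f in L^2(dx). *)
Definition is_levy_integral (L : R -> T -> R) (f : R -> R) (X : T -> R) : Prop :=
  measurable_fun setT f /\
  exists S : nat -> seq (R * (R * R)),
    [/\ forall n, all (fun x => x.2.1 <= x.2.2) (S n),
        (\int[lebesgue_measure]_u ((step_fun (S n) u - f u) ^+ 2)%:E)%E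
          @[n --> \oo] --> 0%E
      & ('E_P[fun w => ((step_integral L (S n) w - X w) ^+ 2)%R])%E
          @[n --> \oo] --> 0%E].

(* lam lists the zeroes of a.  The sum of residues is a real number since a
   and b have real coefficients. *)
Definition carma_kernel (a b : {poly R}) (lam : seq R[i]) (t : R) : R :=
  if 0 < t then
    complex.Re (\sum_(l <- undup lam)
      residue (fun z => cexp (z * t%:C) *
        ((map_poly (real_complex R) b).[z] / (map_poly (real_complex R) a).[z])) l)
  else 0.

Definition carma_process (L : R -> T -> R) (a b : {poly R}) (lam : seq R[i])
    (Y : R -> T -> R) : Prop :=
  forall t, is_levy_integral L (fun u => carma_kernel a b lam (t - u)) (Y t).

Definition sampled (Y : R -> T -> R) (D : R) (n : int) : T -> R := Y (n%:~R * D).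

Definition backshift (K : nzRingType) (r : {poly K}) (W : int -> T -> K)
    (n : int) (w : T) : K :=
  \sum_(k < size r) r`_k * W (n - k%:Z) w.

Definition ar_poly (lam : seq R[i]) (D : R) : {poly R[i]} :=
  \prod_(l <- lam) (1 - (cexp (l * D%:C))%:P * 'X).

Record white_noise (Z : int -> {RV P >-> R}) : Prop := WhiteNoise {
  noise_L2 : forall n, (Z n : T -> R) \in Lfun P 2%:E;
  noise_mean : forall n, ('E_P[Z n] = 0)%E;
  noise_var : exists tau : R, forall n, ('V_P[Z n] = tau%:E)%E;
  noise_uncorrelated : forall m n, m <> n -> covariance P (Z m) (Z n) = 0%E
}.

(* phi(B) Y^D = theta(B) Z almost surely; phi has complex factors, so the
   equality is stated in R[i]. *)
Definition arma_representation (Y : R -> T -> R) (lam : seq R[i]) (D : R)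
    (theta : {poly R}) (Z : int -> {RV P >-> R}) : Prop :=
  white_noise Z /\
  forall n : int, {ae P, forall w,
    backshift (ar_poly lam D) (fun m w' => (sampled Y D m w')%:C) n w =
    (backshift theta (fun m => Z m : T -> R) n w)%:C}.

Definition autocov (W : int -> T -> R) (h : int) : R :=
  fine (covariance P (W h) (W 0)).

Definition f_MA (theta : {poly R}) (Z : int -> {RV P >-> R}) (omega : R) : R[i] :=
  spectral_density (autocov (backshift theta (fun m => Z m : T -> R))) omega.

End Processes.

(* Main.v *)
Require Import Defs.
From HB Require Import structures.
From mathcomp Require Import all_boot all_order all_algebra.
From mathcomp Require Import complex.
From mathcomp Require Import all_classical all_reals all_analysis.
From mathcomp Require polyrcf.
From mathcomp Require Import measurable_realfun.
From mathcomp Require Import ring lra zify.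

Set Implicit Arguments.
Unset Strict Implicit.
Unset Printing Implicit Defensive.

Import Order.TTheory GRing.Theory Num.Theory.
Import numFieldNormedType.Exports.

Local Open Scope classical_set_scope.
Local Open Scope complex_scope.
Local Open Scope ring_scope.

(** Put [r = p - q - 1].  The kernel of the process coincides for [t > 0] with an entire
function [G], and [phi(B) Y] is a stochastic integral with kernel
[H_D(t) = \sum_k phi_k g(t - k D)] ([arma_kernel]), so that the isometry of the
stochastic integral ([levy_isometry]) expresses its autocovariances as
[sigma^2 \int H_D(j D - u) H_D(- u) du].

The filter [phi] annihilates [G] ([ar_poly_kernel]); hence [H_D] vanishes outside
[]0, p D]].  The sum of the residues which defines [G] only depends, up to
[O(t^(r + 1))], on the behaviour of [b / a] at infinity, whence
[G(t) = t^r / r! + O(t^(r + 1))] ([entire_kernel_small]); and [phi(z)] tends to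
[(1 - z)^p].  Consequently [D^- r H_D(D s)] tends, uniformly in [s], to the spline
[S(s) = \sum_k (-1)^k 'C(p, k) (s - k)_+^r / r!], and the spectral density divided
by [D^(2 r + 1)] tends to [sigma^2 / (2 pi)] times
[\int_0^1 |Z_r(s)|^2 ds], where [Z_r(s) = \sum_h e^(- i h omega) S(s + h)]
([cvg_f_MA], [spline_spectrum], [zak]).

It remains to evaluate this integral ([spline_spectrumE]).  With
[v = e^(- i omega)] and [w = 1 / v], the [Z_r] satisfy [Z_r' = Z_(r - 1)] and
[v Z_r(1) = Z_r(0)], and [Z_0] is constant.  The coefficients of [x^r] in
[e^(x s) / (e^x - w)] obey the same recursion, so they are proportional to [Z_r]
([zak_apoly]).  Integrating by parts [r] times leaves the coefficient of
[x^(2 r + 1)] in [1 / (e^x - w)] ([pint_apoly]), which is [c_r] up to a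
factor, since [sinh x / (cosh x - cos omega)] is [w] times the difference of
[1 / (e^x - w)] and its value at [- x] ([sinh_coshB_expB]).

The integral of [|Z_r|^2] vanishes only if [Z_r = 0], which is excluded for
[v <> 1], and for [v = 1] and [q = 0], where [\int_0^1 Z_r = 1]
([spline_spectrum_neq0]).  So the limit is an asymptotic equivalence.  The limit at
[omega = 0] is obtained from the continuity of the integral in [omega]. *)

(** * Limits of complex-valued functions *)

Section ComplexLimits.
Variable R : realType.
Local Notation C := R[i].
Implicit Types (z w : C) (x y : R).

(** The norm of [R[i]] has values in [R[i]]; estimates need its real value. *)
Definition cnorm z : R := complex.Re `|z|.

Lemma cnormE z : `|z| = (cnorm z)%:C.
Proof. by rewrite /cnorm normc_def. Qed.

Lemma cnorm_ge0 z : 0 <= cnorm z.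
Proof. by rewrite -ler0c -cnormE normr_ge0. Qed.

Lemma cnorm0 : cnorm 0 = 0.
Proof. by rewrite /cnorm normr0. Qed.

Lemma cnorm1 : cnorm 1 = 1.
Proof. by rewrite /cnorm normr1. Qed.

Lemma cnormD z w : cnorm (z + w) <= cnorm z + cnorm w.
Proof. by rewrite -lecR rmorphD/= -!cnormE ler_normD. Qed.

Lemma cnormN z : cnorm (- z) = cnorm z.
Proof. by rewrite /cnorm normrN. Qed.

Lemma cnormBC z w : cnorm (z - w) = cnorm (w - z).
Proof. by rewrite /cnorm distrC. Qed.

Lemma cnormM z w : cnorm (z * w) = cnorm z * cnorm w.
Proof. by apply: complexI; rewrite rmorphM/= -!cnormE normrM. Qed.

Lemma cnormV z : cnorm z^-1 = (cnorm z)^-1.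
Proof. by apply: complexI; rewrite fmorphV/= -!cnormE normfV. Qed.

Lemma cnormX z n : cnorm (z ^+ n) = cnorm z ^+ n.
Proof. by apply: complexI; rewrite rmorphXn/= -!cnormE normrX. Qed.

Lemma cnorm_real x : cnorm x%:C = `|x|.
Proof. by rewrite /cnorm normc_def /= expr0n addr0 sqrtr_sqr. Qed.

Lemma cnorm_eq0 z : (cnorm z == 0) = (z == 0).
Proof.
by rewrite -(inj_eq (@complexI R)) -cnormE normr_eq0.
Qed.

Lemma cnorm_gt0 z : (0 < cnorm z) = (z != 0).
Proof. by rewrite lt_def cnorm_ge0 andbT cnorm_eq0. Qed.

Lemma cnorm_sum (I : Type) (s : seq I) (P : pred I) (F : I -> C) :
  cnorm (\sum_(i <- s | P i) F i) <= \sum_(i <- s | P i) cnorm (F i).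
Proof.
elim/big_rec2: _ => [|i y z _ le]; first by rewrite cnorm0.
by rewrite (le_trans (cnormD _ _))// lerD2l.
Qed.

Lemma Re_le_cnorm z : `|complex.Re z| <= cnorm z.
Proof. by rewrite -lecR -cnormE normc_ge_Re. Qed.

Lemma real_complexB x y : (x - y)%:C = x%:C - y%:C :> C.
Proof. exact: rmorphB. Qed.

(** Gives access to the topology of [R[i]] through real limits only. *)
Lemma cvg_cnorm (I : Type) (F : set_system I) (FF : Filter F) (u : I -> C) (l : C) :
  ((u i : C^o) @[i --> F] --> (l : C^o)) <->
  (cnorm (u i - l) @[i --> F] --> (0 : R)).
Proof.
split=> [/cvgrPdist_lt h|/cvgrPdist_lt h].
  apply/cvgrPdist_lt => e e0.
  have /h : 0 < e%:C :> C by rewrite ltcR.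
  apply: filterS => i; rewrite [`|_|]cnormE ltcR sub0r normrN.
  by rewrite ger0_norm ?cnorm_ge0// cnormBC.
apply/cvgrPdist_lt => e e0.
have er : e = (complex.Re e)%:C by rewrite RRe_real// realE ltW.
have /h : 0 < complex.Re e by rewrite -ltcR -er.
apply: filterS => i; rewrite sub0r normrN ger0_norm ?cnorm_ge0// => le.
by rewrite [`|_|]cnormE er ltcR cnormBC.
Qed.

Lemma near_dnbhsC (l : C) (Q : C -> Prop) :
  (\forall z \near ((l : C^o)^'), Q z) <->
  exists2 e : R, 0 < e & forall z, z != l -> cnorm (z - l) < e -> Q z.
Proof.
rewrite /dnbhs /within; split.
  move=> /nbhs_ballP[e/= e0 h].
  have er : e = (complex.Re e)%:C by rewrite RRe_real// realE ltW.
  exists (complex.Re e); first by rewrite -ltcR -er.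
  move=> z zl le; apply: h => //.
  by rewrite /ball/= [`|_|]cnormE er ltcR cnormBC.
move=> [e e0 h]; apply/nbhs_ballP; exists (e%:C); first by rewrite /= ltcR.
move=> z/= ; rewrite /ball/= [`|_|]cnormE ltcR cnormBC => le zl.
exact: h.
Qed.

(** Stated with a real limit so that squeezing applies. *)
Definition cvgC (I : Type) (F : set_system I) (u : I -> C) (l : C) : Prop :=
  cnorm (u i - l) @[i --> F] --> (0 : R).

Section ComplexLimitOps.
Context {I : Type} {F : set_system I} {FF : Filter F}.
Implicit Types u v : I -> C.

Lemma cvgC_le u (l : C) (e : I -> R) : (\forall i \near F, cnorm (u i - l) <= e i) ->
  e i @[i --> F] --> (0 : R) -> cvgC F u l.
Proof.
move=> le e0; apply: (@squeeze_cvgr _ _ _ _ (fun=> 0) e) => //; last exact: cvg_cst.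
by apply: filterS le => i ->; rewrite cnorm_ge0.
Qed.

Lemma cvgC_cst (a : C) : cvgC F (fun=> a) a.
Proof. by rewrite /cvgC subrr cnorm0; exact: cvg_cst. Qed.

Lemma cvgC_D u v (a b : C) : cvgC F u a -> cvgC F v b ->
  cvgC F (fun i => u i + v i) (a + b).
Proof.
move=> ua vb; apply: (@cvgC_le _ _ (fun i => cnorm (u i - a) + cnorm (v i - b))).
  apply: nearW => i.
  by rewrite (_ : _ - _ = (u i - a) + (v i - b)) ?cnormD//; ring.
by rewrite -[X in _ --> X](addr0 (0 : R)); apply: cvgD.
Qed.

Lemma cvgC_M u v (a b : C) : cvgC F u a -> cvgC F v b ->
  cvgC F (fun i => u i * v i) (a * b).
Proof.
move=> ua vb; apply: (@cvgC_le _ _ (fun i => cnorm (u i - a) * cnorm (v i - b) +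
    (cnorm a * cnorm (v i - b) + cnorm b * cnorm (u i - a)))).
  apply: nearW => i; rewrite -!cnormM.
  rewrite (_ : u i * v i - a * b = (u i - a) * (v i - b) + (a * (v i - b) + b * (u i - a))); last by ring.
  by rewrite (le_trans (cnormD _ _))// lerD2l cnormD.
rewrite [X in _ --> X](_ : 0 = 0 * 0 + (cnorm a * 0 + cnorm b * 0)); last by ring.
by apply: cvgD; [exact: cvgM|apply: cvgD; apply: cvgM => //; exact: cvg_cst].
Qed.

Lemma cvgC_N u (a : C) : cvgC F u a -> cvgC F (fun i => - u i) (- a).
Proof.
by move=> ua; apply: (cvgC_le _ ua); apply: nearW => i; rewrite -opprD cnormN.
Qed.

Lemma cvgC_B u v (a b : C) : cvgC F u a -> cvgC F v b ->
  cvgC F (fun i => u i - v i) (a - b).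
Proof. by move=> ua vb; apply: cvgC_D => //; exact: cvgC_N. Qed.

(** Near the limit, [u i] stays away from [0], so inversion is Lipschitz there. *)
Lemma cvgC_V u (a : C) : a != 0 -> cvgC F u a -> cvgC F (fun i => (u i)^-1) a^-1.
Proof.
move=> a0 ua; have na0 : 0 < cnorm a by rewrite cnorm_gt0.
apply: (@cvgC_le _ _ (fun i => 2 * (cnorm a)^-1 ^+ 2 * cnorm (u i - a))); last first.
  rewrite -[X in _ --> X](mulr0 (2 * (cnorm a)^-1 ^+ 2)); apply: cvgM => //; exact: cvg_cst.
have h0 : 0 < cnorm a / 2 by rewrite divr_gt0.
move/cvgr0Pnorm_lt : (ua) => /(_ _ h0); apply: filterS => i.
rewrite ger0_norm ?cnorm_ge0// => lt.
have lu : cnorm a / 2 < cnorm (u i).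
  have : cnorm a <= cnorm (u i) + cnorm (u i - a).
    by rewrite -(cnormN (u i - a)) (le_trans _ (cnormD _ _))// opprB addrC subrK.
  by move: lt; lra.
have u0 : u i != 0 by rewrite -cnorm_gt0 (lt_trans h0).
rewrite (_ : (u i)^-1 - a^-1 = (a - u i) * a^-1 * (u i)^-1); last by field; rewrite u0.
rewrite !cnormM !cnormV cnormBC.
rewrite (_ : 2 * _ * _ = cnorm (u i - a) * (cnorm a)^-1 * (cnorm a / 2)^-1); last first.
  by field; rewrite gt_eqF.
rewrite ler_wpM2l ?mulr_ge0 ?invr_ge0 ?cnorm_ge0//.
by rewrite lef_pV2 ?posrE ?ltW// (lt_trans h0).
Qed.

Lemma cvgC_sum (J : Type) (s : seq J) (P : pred J) (u : J -> I -> C) (a : J -> C) :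
  (forall j, P j -> cvgC F (u j) (a j)) ->
  cvgC F (fun i => \sum_(j <- s | P j) u j i) (\sum_(j <- s | P j) a j).
Proof.
move=> h; elim: s => [|j s IH].
  rewrite big_nil (_ : (fun _ => _) = fun=> 0); first exact: cvgC_cst.
  by apply/funext => i; rewrite big_nil.
rewrite big_cons (_ : (fun _ => _) = fun i => if P j then
  u j i + \sum_(j <- s | P j) u j i else \sum_(j <- s | P j) u j i); last first.
  by apply/funext => i; rewrite big_cons.
by case: ifP => // Pj; apply: cvgC_D => //; exact: h.
Qed.

Lemma cvgC_Re u (a : C) : cvgC F u a -> complex.Re (u i) @[i --> F] --> complex.Re a.
Proof.
move=> /cvgr0Pnorm_lt h; apply/cvgrPdist_lt => e e0.
move: (h _ e0); apply: filterS => i; apply: le_lt_trans.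
rewrite [leRHS]ger0_norm ?cnorm_ge0// cnormBC.
have -> : complex.Re a - complex.Re (u i) = complex.Re (a - u i).
  by clear h; case: a (u i) => [? ?] [? ?].
exact: Re_le_cnorm.
Qed.

Lemma cvgC_real (u : I -> R) (l : R) :
  cvgC F (fun i => (u i)%:C) l%:C <-> (u i @[i --> F] --> l).
Proof.
split=> [/cvgr0Pnorm_lt h|/cvgrPdist_lt h].
  apply/cvgrPdist_lt => e e0; move: (h _ e0); apply: filterS => i.
  by rewrite -real_complexB cnorm_real normr_id distrC.
apply/cvgr0Pnorm_lt => e e0; move: (h _ e0); apply: filterS => i.
by rewrite -real_complexB cnorm_real normr_id distrC.
Qed.

Lemma near_cvgC u v (a : C) : (\forall i \near F, u i = v i) -> cvgC F u a -> cvgC F v a.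
Proof.
move=> uv ua; apply: (cvgC_le _ ua).
by apply: filterS uv => i ->.
Qed.

End ComplexLimitOps.

Lemma cvg_cnorm_le (u : nat -> C) (l c : C) (B : R) :
  cvgC \oo u l ->
  (\forall n \near \oo, cnorm (u n - c) <= B) -> cnorm (l - c) <= B.
Proof.
move=> ul le; apply/ler_addgt0Pr => e e0.
move/cvgr0Pnorm_lt : ul => /(_ _ e0) ul.
have [n [h1 h2]] := filter_ex (filterI le ul).
have -> : l - c = (u n - c) - (u n - l) by ring.
rewrite (le_trans (cnormD _ _))// cnormN lerD// ltW//.
by rewrite ger0_norm ?cnorm_ge0 in h2.
Qed.

(** [n * t ^ n] is bounded by the geometric series, for [t] a fourth root of [x]; its
square leaves a factor [(t ^ 2) ^ n] to spare. *)
Lemma n2_geom_cvg0 (x : R) : 0 <= x -> x < 1 ->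
  n%:R ^+ 2 * x ^+ n @[n --> \oo] --> (0 : R).
Proof.
move=> x0 x1.
have sq y : 0 <= y -> y < 1 -> 0 <= Num.sqrt y < 1.
  by move=> y0 y1; rewrite sqrtr_ge0 -[X in _ < X]sqrtr1 ltr_sqrt.
have /andP[s0 s1] := sq _ x0 x1.
have /andP[t0 t1] := sq _ s0 s1.
set t := Num.sqrt (Num.sqrt x) in t0 t1.
have xt : x = t ^+ 2 ^+ 2 by rewrite /t !sqr_sqrtr// sqrtr_ge0.
have nt n : n%:R * t ^+ n <= (1 - t)^-1.
  rewrite -[X in _ <= X]mul1r ler_pdivlMr ?subr_gt0//.
  apply: (@le_trans _ _ ((\sum_(i < n) t ^+ i) * (1 - t))).
    rewrite ler_wpM2r ?subr_ge0 ?(ltW t1)//.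
    have : \sum_(i < n) t ^+ n <= \sum_(i < n) t ^+ i.
      by apply: ler_sum => i _; rewrite ler_wiXn2l ?(ltW t1)// ltnW.
    by rewrite sumr_const card_ord mulr_natl.
  have -> : (\sum_(i < n) t ^+ i) * (1 - t) = 1 - t ^+ n.
    by rewrite -[RHS]opprB subrX1; ring.
  by rewrite gerBl exprn_ge0.
apply: (@squeeze_cvgr _ _ _ _ (fun=> 0) (fun n => (1 - t)^-1 ^+ 2 * (t ^+ 2) ^+ n)).
- apply: nearW => n; rewrite mulr_ge0 ?exprn_ge0//=.
  have -> : n%:R ^+ 2 * x ^+ n = (n%:R * t ^+ n) ^+ 2 * (t ^+ 2) ^+ n.
    rewrite [X in _ * X ^+ n = _]xt; move: (t) => y.
    have -> : (y ^+ 2) ^+ 2 = y ^+ 2 * y ^+ 2 by ring.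
    by rewrite [in LHS]exprMn -![y ^+ 2 ^+ n]exprAC exprMn; ring.
  rewrite ler_wpM2r ?exprn_ge0// lerXn2r// ?nnegrE ?mulr_ge0 ?exprn_ge0//.
  by rewrite invr_ge0 subr_ge0 ltW.
- exact: cvg_cst.
- rewrite -[X in _ --> X](mulr0 ((1 - t)^-1 ^+ 2)); apply: cvgM; first exact: cvg_cst.
  apply: cvg_expr; rewrite ger0_norm ?exprn_ge0//.
  by rewrite expr_lt1.
Qed.

End ComplexLimits.

(** * Convergent power series *)

Section PowerSeries.
Variable R : realType.
Local Notation C := R[i].
Implicit Types (u v : nat -> C) (z : C) (f g : C -> C).

(** A power series is the sequence of its coefficients; [conv] is the Cauchy product. *)
Definition psum u z (n : nat) : C := \sum_(0 <= k < n) u k * z ^+ k.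

Definition conv u v (n : nat) : C := \sum_(i < n.+1) u i * v (n - i)%N.

(** The geometric bound implies absolute convergence for [r * |z| < 1], and is easier to
propagate than a radius of convergence. *)
Definition gbound u (M r : R) := forall k, cnorm (u k) <= M * r ^+ k.

Lemma conv_poly u v n k : (k < n)%N ->
  conv u v k = ((\poly_(i < n) u i) * (\poly_(i < n) v i))`_k.
Proof.
move=> kn; rewrite coefM; apply: eq_bigr => i _.
by rewrite !coef_poly (leq_ltn_trans _ kn) ?leq_ord// (leq_ltn_trans _ kn)// leq_subr.
Qed.

Lemma convC u v : conv u v =1 conv v u.
Proof. by move=> k; rewrite !(@conv_poly _ _ k.+1)// mulrC. Qed.

Lemma gbound_ge0 u (M r : R) : gbound u M r -> 0 <= M.
Proof. by move=> /(_ 0%N); rewrite expr0 mulr1; apply: le_trans (cnorm_ge0 _). Qed.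

Lemma conv_bound u v (M N r : R) : gbound u M r -> gbound v N r ->
  forall k, cnorm (conv u v k) <= M * N * (k.+1%:R * r ^+ k).
Proof.
move=> bu bv k; rewrite (le_trans (cnorm_sum _ _ _))//.
have -> : M * N * (k.+1%:R * r ^+ k) = \sum_(i < k.+1) M * N * r ^+ k.
  by rewrite sumr_const card_ord -mulr_natl; ring.
apply: ler_sum => i _; rewrite cnormM.
have -> : M * N * r ^+ k = (M * r ^+ i) * (N * r ^+ (k - i)).
  by rewrite -[in LHS](subnKC (leq_ord i)) exprD; ring.
by apply: ler_pM; rewrite ?cnorm_ge0.
Qed.

Lemma gbound_conv u v (M N r : R) : 0 < r -> gbound u M r -> gbound v N r ->
  gbound (conv u v) (M * N) (2 * r).
Proof.
move=> r0 bu bv k; rewrite (le_trans (conv_bound bu bv k))//.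
rewrite ler_wpM2l ?mulr_ge0 ?(gbound_ge0 bu) ?(gbound_ge0 bv)//.
rewrite exprMn ler_wpM2r ?exprn_ge0 ?(ltW r0)//.
by rewrite -natrX ler_nat ltn_expl.
Qed.

Lemma gbound_le u (M N r s : R) : 0 <= r -> M <= N -> r <= s -> gbound u M r -> gbound u N s.
Proof.
move=> r0 MN rs b k; rewrite (le_trans (b k))//.
apply: ler_pM => //; rewrite ?exprn_ge0 ?(gbound_ge0 b)//.
by rewrite lerXn2r ?nnegrE// (le_trans r0).
Qed.

(** The product of the partial sums and the partial sum of the Cauchy product agree in
degrees less than [n]; at most [n] terms of degree at least [n] remain. *)
Lemma psum_mul_diff u v z (M N r : R) n : 0 <= r -> r * cnorm z <= 1 ->
  gbound u M r -> gbound v N r ->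
  cnorm (psum u z n * psum v z n - psum (conv u v) z n) <=
    2 * (M * N) * (n%:R ^+ 2 * (r * cnorm z) ^+ n).
Proof.
move=> r0 rz1 bu bv.
have M0 := gbound_ge0 bu; have N0 := gbound_ge0 bv.
pose U := \poly_(i < n) u i; pose V := \poly_(i < n) v i.
have psumE w : psum w z n = (\poly_(i < n) w i).[z].
  rewrite /psum big_mkord (horner_coef_wide _ (size_poly _ _)).
  by apply: eq_bigr => i _; rewrite coef_poly ltn_ord.
rewrite (psumE u) (psumE v) -hornerM -/U -/V.
have sUV : (size (U * V)%R <= n + n)%N.
  have := size_polyMleq U V; have := size_poly n u; have := size_poly n v.
  by rewrite -/U -/V; lia.
rewrite (horner_coef_wide _ sUV) big_split_ord/= /psum big_mkord.
have -> : \sum_(i < n) (U * V)`_i * z ^+ i = \sum_(i < n) conv u v i * z ^+ i.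
  by apply: eq_bigr => i _; rewrite (conv_poly _ _ (ltn_ord i)).
rewrite addrAC subrr add0r (le_trans (cnorm_sum _ _ _))//.
have -> : 2 * (M * N) * (n%:R ^+ 2 * (r * cnorm z) ^+ n) =
    \sum_(i < n) (2 * n)%N%:R * (M * N) * (r * cnorm z) ^+ n.
  by rewrite sumr_const card_ord -mulr_natl natrM; ring.
have bU : gbound (fun i => U`_i) M r.
  by move=> k; rewrite coef_poly; case: ifP => // _; rewrite cnorm0 mulr_ge0// exprn_ge0.
have bV : gbound (fun i => V`_i) N r.
  by move=> k; rewrite coef_poly; case: ifP => // _; rewrite cnorm0 mulr_ge0// exprn_ge0.
apply: ler_sum => i _; rewrite cnormM cnormX coefM.
rewrite (@le_trans _ _ (M * N * ((n + i).+1%:R * r ^+ (n + i)) * cnorm z ^+ (n + i)))//.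
  by rewrite ler_wpM2r ?exprn_ge0 ?cnorm_ge0// (conv_bound bU bV).
rewrite -!mulrA -exprMn !mulrA.
rewrite mulrC [leRHS]mulrC; apply: ler_pM; rewrite ?exprn_ge0 ?mulr_ge0 ?cnorm_ge0//.
  by rewrite ler_wiXn2l ?leq_addr// mulr_ge0 ?cnorm_ge0.
rewrite -[leRHS]mulrA.
rewrite mulrC ler_wpM2r ?mulr_ge0// ler_nat; have := ltn_ord i; lia.
Qed.

Lemma cvg_psum_mul u v z (M N r : R) : 0 <= r -> r * cnorm z < 1 ->
  gbound u M r -> gbound v N r ->
  cvgC \oo (fun n => psum u z n * psum v z n - psum (conv u v) z n) 0.
Proof.
move=> r0 rz1 bu bv.
apply: (@squeeze_cvgr _ _ _ _ (fun=> 0)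
  (fun n => 2 * (M * N) * (n%:R ^+ 2 * (r * cnorm z) ^+ n))).
- apply: nearW => n; rewrite cnorm_ge0 subr0 /=.
  by apply: psum_mul_diff => //; exact: ltW.
- exact: cvg_cst.
- rewrite -[X in _ --> X](mulr0 (2 * (M * N))); apply: cvgM; first exact: cvg_cst.
  by apply: n2_geom_cvg0 => //; rewrite mulr_ge0 ?cnorm_ge0.
Qed.

(** The expansion of [f] at [0], with the geometric bound that makes the set of such
functions closed under products and inverses. *)
Definition fps_at u f := exists M r : R,
  [/\ 0 < r, gbound u M r & forall z, r * cnorm z < 1 ->
     cvgC \oo (psum u z) (f z)].

Lemma fps_mul u v f g : fps_at u f -> fps_at v g ->
  fps_at (conv u v) (fun z => f z * g z).
Proof.
move=> [M [r [r0 bu cu]]] [N [s [s0 bv cv]]].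
pose t := Num.max r s.
have t0 : 0 < t by rewrite lt_max r0.
have bu' : gbound u M t by apply: gbound_le bu; rewrite ?le_max ?lexx// ltW.
have bv' : gbound v N t by apply: gbound_le bv; rewrite ?le_max ?lexx ?orbT// ltW.
exists (M * N), (2 * t); split; [by rewrite mulr_gt0|exact: gbound_conv|].
move=> z z1.
have tz : t * cnorm z < 1.
  rewrite (le_lt_trans _ z1)// ler_wpM2r ?cnorm_ge0//; lra.
have rz : r * cnorm z < 1.
  by rewrite (le_lt_trans _ tz)// ler_wpM2r ?cnorm_ge0// le_max lexx.
have sz : s * cnorm z < 1.
  by rewrite (le_lt_trans _ tz)// ler_wpM2r ?cnorm_ge0// le_max lexx orbT.
have h := cvg_psum_mul (ltW t0) tz bu' bv'.
pose proof (cvgC_M (cu z rz) (cv z sz)) as h2.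
pose proof (cvgC_B h2 h) as h3; move: h3; rewrite subr0.
by apply: near_cvgC; apply: nearW => n; ring.
Qed.

Lemma tail_bound u z (M r : R) m n : 0 <= r -> r * cnorm z <= 2^-1 -> gbound u M r ->
  cnorm (\sum_(m <= j < n) u j * z ^+ j) <= 2 * M * (r * cnorm z) ^+ m.
Proof.
move=> r0 x2 bu; set x := r * cnorm z in x2 *.
have x0 : 0 <= x by rewrite mulr_ge0 ?cnorm_ge0.
have M0 := gbound_ge0 bu.
rewrite (le_trans (cnorm_sum _ _ _))//.
apply: (@le_trans _ _ (\sum_(m <= j < n) M * x ^+ j)).
  apply: ler_sum => j _; rewrite cnormM cnormX exprMn mulrA.
  by rewrite ler_wpM2r ?exprn_ge0 ?cnorm_ge0.
rewrite -mulr_sumr (_ : 2 * M * x ^+ m = M * (x ^+ m * 2)); last by ring.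
rewrite ler_wpM2l//.
have [nm|mn] := leqP n m; first by rewrite big_geq// mulr_ge0// exprn_ge0.
elim: n mn => // n IH; rewrite ltnS leq_eqVlt => /orP[/eqP <-|mn].
  by rewrite big_nat1 ler_peMr ?exprn_ge0//; lra.
suff h : \sum_(m <= j < n.+1) x ^+ j <= x ^+ m * 2 - x ^+ n by rewrite (le_trans h)// gerBl exprn_ge0.
elim: {IH}n mn => // n IH; rewrite ltnS leq_eqVlt => /orP[/eqP <-|mn].
  rewrite 2?big_nat_recr ?leqnSn//= ?big_geq// ?add0r exprS.
  have := exprn_ge0 m x0; nra.
rewrite big_nat_recr/=; last by rewrite ltnW// ltnW.
have := IH mn; have : x ^+ n.+1 <= 2^-1 * x ^+ n by rewrite exprS ler_wpM2r ?exprn_ge0.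
lra.
Qed.

(** Dividing by [z ^ k], where [k] is the first index with [u k != 0], the series is
[u k] up to [O(z)] and so cannot vanish for arbitrarily small [z != 0]. *)
Lemma fps_zero u (M r : R) : 0 < r -> gbound u M r ->
  (forall e : R, 0 < e -> exists z, [/\ z != 0, cnorm z < e & cvgC \oo (psum u z) 0]) ->
  forall k, u k = 0.
Proof.
move=> r0 bu h; have M0 := gbound_ge0 bu.
elim/ltn_ind => k IH; apply/eqP; apply/negP => /negP; rewrite -cnorm_gt0 => uk0.
(* For [|z| < e] the tail of the series is smaller than its [k]-th term. *)
pose e := Num.min (2 * r)^-1 (cnorm (u k) / (2 * M * r ^+ k.+1 + 1)).
have D0 : 0 < 2 * M * r ^+ k.+1 + 1.
  by rewrite ltr_wpDl// mulr_ge0 ?mulr_ge0// exprn_ge0// ltW.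
have e0 : 0 < e by rewrite lt_min invr_gt0 mulr_gt0//= divr_gt0.
have [z [z0 ze cz]] := h _ e0.
move: ze; rewrite lt_min => /andP[ze1 ze2].
have x2 : r * cnorm z <= 2^-1.
  move: ze1; rewrite invfM ltr_pdivlMr// mulrC => /ltW.
  by [].
have zk0 : z ^+ k != 0 by rewrite expf_neq0.
pose proof (cvgC_M cz (cvgC_cst (F := \oo) (z ^+ k)^-1)) as cz'.
rewrite mul0r in cz'.
have : cnorm (0 - u k) <= 2 * M * r ^+ k.+1 * cnorm z.
  apply: (cvg_cnorm_le cz'); near=> n.
  have kn : (k < n)%N by near: n; exact: nbhs_infty_gt.
  have -> : psum u z n = u k * z ^+ k + \sum_(k.+1 <= j < n) u j * z ^+ j.
    rewrite /psum (@big_cat_nat _ _ _ k)//=; last exact: ltnW.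
    rewrite big_nat big1 ?add0r; last by move=> j jk; rewrite IH ?mul0r.
    by rewrite big_ltn.
  rewrite mulrDl mulfK// addrAC subrr add0r cnormM cnormV cnormX.
  rewrite ler_pdivrMr ?exprn_gt0 ?cnorm_gt0//.
  rewrite (le_trans (tail_bound _ _ (ltW r0) x2 bu))// exprMn [X in _ * (_ * X)]exprS.
  by rewrite !mulrA.
rewrite sub0r cnormN leNgt => /negP; apply.
move: ze2; rewrite ltr_pdivlMr// mulrC mulrDl mul1r; apply: le_lt_trans.
by rewrite lerDl cnorm_ge0.
Unshelve. all: by end_near.
Qed.

(** The terms of a convergent series are bounded. *)
Lemma cvg_psum_bound u z (l : C) : z != 0 -> cvgC \oo (psum u z) l ->
  exists M : R, gbound u M (cnorm z)^-1.
Proof.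
move=> z0 cu.
have /cvgr0Pnorm_lt/(_ _ ltr01) [N _ hN] : cvgC \oo (fun n => u n * z ^+ n) 0.
  have cu1 : cvgC \oo (fun n => psum u z n.+1) l by move: cu; rewrite /cvgC -(cvg_shiftS (fun n => cnorm (psum u z n - l))).
  rewrite -(subrr l); apply: near_cvgC (cvgC_B cu1 cu); apply: nearW => n.
  by rewrite /psum big_nat_recr//= addrAC subrr add0r.
exists (1 + \sum_(k < N) cnorm (u k * z ^+ k)) => k.
rewrite exprVn ler_pdivlMr ?exprn_gt0 ?cnorm_gt0// -cnormX -cnormM.
have [kN|kN] := ltnP k N.
  rewrite (bigD1 (Ordinal kN))//= addrCA lerDl addr_ge0// sumr_ge0// => i _.
  exact: cnorm_ge0.
have := hN k kN; rewrite /= subr0 ger0_norm ?cnorm_ge0// => /ltW le.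
by rewrite (le_trans le)// lerDl sumr_ge0// => i _; exact: cnorm_ge0.
Qed.

(** The coefficients of the inverse satisfy a course-of-values recursion; all the
preceding ones are kept in a list. *)
Fixpoint inv_seq u n : seq C :=
  if n is n'.+1 then
    rcons (inv_seq u n')
      (((n' == 0%N)%:R - \sum_(i < n') u (n' - i)%N * (inv_seq u n')`_i) / u 0%N)
  else [::].

Definition fps_inv u n : C := (inv_seq u n.+1)`_n.

Lemma size_inv_seq u n : size (inv_seq u n) = n.
Proof. by elim: n => //= n IH; rewrite size_rcons IH. Qed.

Lemma nth_inv_seq u n i : (i < n)%N -> (inv_seq u n)`_i = fps_inv u i.
Proof.
elim: n => // n IH; rewrite ltnS leq_eqVlt => /orP[/eqP ->//|i_n].
by rewrite /= nth_rcons size_inv_seq i_n IH.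
Qed.

Lemma fps_invE u n : fps_inv u n =
  ((n == 0%N)%:R - \sum_(i < n) u (n - i)%N * fps_inv u i) / u 0%N.
Proof.
rewrite /fps_inv /= nth_rcons size_inv_seq ltnn eqxx; congr ((_ - _) / _).
by apply: eq_bigr => i _; rewrite nth_inv_seq.
Qed.

Lemma conv_inv u n : u 0%N != 0 -> conv u (fps_inv u) n = (n == 0%N)%:R.
Proof.
move=> u0; rewrite convC /conv big_ord_recr/= subnn [fps_inv u n]fps_invE.
rewrite divfK// addrC; under [X in _ + X]eq_bigr do rewrite mulrC.
by rewrite subrK.
Qed.

(** The ratio [r * (1 + m)], for [m = M / |u 0|], is the one for which the recursion closes:
[m * \sum_(i < n) (1 + m) ^+ i] is less than [(1 + m) ^+ n]. *)
Lemma gbound_inv u (M r : R) : 0 < r -> u 0%N != 0 -> gbound u M r ->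
  gbound (fps_inv u) (cnorm (u 0%N))^-1 (r * (1 + M / cnorm (u 0%N))).
Proof.
move=> r0 u0 bu; have M0 := gbound_ge0 bu.
set A := (cnorm (u 0%N))^-1; pose m := M * A.
have A0 : 0 < A by rewrite invr_gt0 cnorm_gt0.
elim/ltn_ind => n IH; rewrite fps_invE cnormM cnormV mulrC ler_pM2l//.
case: n IH => [_|n IH]; first by rewrite big_ord0 subr0 expr0 cnorm1.
rewrite sub0r cnormN (le_trans (cnorm_sum _ _ _))//.
apply: (@le_trans _ _ (\sum_(i < n.+1) r ^+ n.+1 * (m * (1 + m) ^+ i))).
  apply: ler_sum => i _; rewrite cnormM.
  rewrite (_ : r ^+ n.+1 * _ = (M * r ^+ (n.+1 - i)) * (A * (r * (1 + m)) ^+ i)); last first.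
    have -> : r ^+ n.+1 = r ^+ (n.+1 - i) * r ^+ i by rewrite -exprD subnK// ltnW.
    by rewrite exprMn /m; ring.
  by apply: ler_pM; rewrite ?cnorm_ge0// IH.
rewrite -mulr_sumr exprMn ler_wpM2l ?exprn_ge0 ?(ltW r0)// -mulr_sumr.
have -> : m * \sum_(i < n.+1) (1 + m) ^+ i = (1 + m) ^+ n.+1 - 1.
  by rewrite subrX1 addrAC subrr add0r.
by rewrite gerBl.
Qed.

(** The partial sums of [u] and of its formal inverse have a product tending to [1].  The
radius is also taken small enough for [f] to stay away from [0]. *)
Lemma fps_inv_at u f : fps_at u f -> u 0%N != 0 -> fps_at (fps_inv u) (fun z => (f z)^-1).
Proof.
move=> [M [r [r0 bu cu]]] u0; have M0 := gbound_ge0 bu.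
set A := (cnorm (u 0%N))^-1.
have A0 : 0 < A by rewrite invr_gt0 cnorm_gt0.
have bi := gbound_inv r0 u0 bu; rewrite -/A in bi.
pose t := r * (1 + M * A); pose t' := t + 2 * r + 4 * M * r * A.
have MA : 0 <= M * A by rewrite mulr_ge0// ltW.
have t0 : 0 < t by rewrite mulr_gt0// ltr_wpDr.
have rt : r <= t by rewrite ler_peMr ?lerDl// ltW.
have MrA : 0 <= 4 * M * r * A by rewrite !mulr_ge0// ltW.
have tt' : t <= t' by rewrite /t' -addrA lerDl addr_ge0// mulr_ge0// ltW.
exists A, t'; split; first exact: lt_le_trans tt'.
  by apply: gbound_le bi => //; rewrite ltW.
move=> z z1.
have c0 := cnorm_ge0 z.
have tz : t * cnorm z < 1 by rewrite (le_lt_trans _ z1)// ler_wpM2r.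
have rz : r * cnorm z < 1 by rewrite (le_lt_trans _ tz)// ler_wpM2r.
have r2z : r * cnorm z <= 2^-1.
  have : 2 * r * cnorm z <= t' * cnorm z by rewrite ler_wpM2r// /t' -addrA addrCA lerDl addr_ge0// ltW.
  by move: z1; lra.
have fz : f z != 0.
  have h : cnorm (f z - u 0%N) <= 2 * M * (r * cnorm z) ^+ 1.
    apply: (cvg_cnorm_le (cu z rz)); near=> n.
    have n0 : (0 < n)%N by near: n; exact: nbhs_infty_gt.
    rewrite /psum big_ltn// expr0 mulr1 addrAC subrr add0r.
    by apply: tail_bound => //; rewrite ltW.
  apply/eqP => fz0; move: h; rewrite fz0 sub0r cnormN expr1 leNgt => /negP; apply.
  have h4 : 4 * M * r * A * cnorm z <= t' * cnorm z.
    rewrite ler_wpM2r// /t' lerDr addr_ge0//; first exact: ltW.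
    by rewrite mulr_ge0// ltW.
  have : 4 * M * r * A * cnorm z < 1 by exact: le_lt_trans z1.
  have -> : 4 * M * r * A * cnorm z = 4 * M * (r * cnorm z) / cnorm (u 0%N) by rewrite /A; ring.
  rewrite ltr_pdivrMr ?cnorm_gt0// mul1r; apply: le_lt_trans.
  by rewrite ler_wpM2r ?mulr_ge0 ?(ltW r0)// ler_wpM2r//; lra.
pose N := Num.max M A.
have bu' : gbound u N t by apply: gbound_le bu; rewrite ?le_max ?lexx// ltW.
have bi' : gbound (fps_inv u) N t.
  by apply: gbound_le bi; rewrite ?le_max ?lexx ?orbT// ltW.
have h := cvg_psum_mul (ltW t0) tz bu' bi'.
have h1 : cvgC \oo (psum (conv u (fps_inv u)) z) 1.
  apply: near_cvgC (cvgC_cst 1); near=> n.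
  have n0 : (0 < n)%N by near: n; exact: nbhs_infty_gt.
  rewrite /psum big_ltn// expr0 mulr1 conv_inv// big_nat big1 ?addr0// => i /andP[i0 _].
  by rewrite conv_inv// gtn_eqF// mul0r.
pose proof (cvgC_M (cvgC_D h h1) (cvgC_V fz (cu z rz))) as h2.
rewrite add0r mul1r in h2; apply: near_cvgC h2.
have /cvgr0Pnorm_lt/(_ _ (_ : 0 < cnorm (f z))) := cu z rz.
rewrite cnorm_gt0 => /(_ fz); apply: filterS => n; rewrite ger0_norm ?cnorm_ge0// => ln.
have pz : psum u z n != 0.
  by apply: contraTneq ln => ->; rewrite sub0r cnormN ltxx.
by rewrite subrK mulrAC mulfV// mul1r.
Unshelve. all: by end_near.
Qed.

Lemma fps_poly (p : {poly C}) : fps_at (fun k => p`_k) (fun z => p.[z]).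
Proof.
exists (\sum_(i < size p) cnorm p`_i), 1; split => //.
  move=> k; rewrite expr1n mulr1; have [kp|kp] := ltnP k (size p).
    by rewrite (bigD1 (Ordinal kp))//= lerDl sumr_ge0// => i _; exact: cnorm_ge0.
  by rewrite nth_default// cnorm0 sumr_ge0// => i _; exact: cnorm_ge0.
move=> z _; apply: near_cvgC (cvgC_cst _); near=> n.
rewrite (horner_coef_wide _ (_ : (size p <= n)%N)) /psum ?big_mkord//.
by near: n; exact: nbhs_infty_ge.
Unshelve. all: by end_near.
Qed.

Lemma fps_scale u f (c : C) : fps_at u f -> fps_at (fun k => u k * c ^+ k) (fun z => f (c * z)).
Proof.
move=> [M [r [r0 bu cu]]]; have M0 := gbound_ge0 bu.
have c0 := cnorm_ge0 c.
exists M, (r * (cnorm c + 1)); split.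
- by rewrite mulr_gt0// ltr_wpDl.
- move=> k; rewrite cnormM cnormX exprMn mulrA.
  apply: ler_pM; rewrite ?cnorm_ge0 ?exprn_ge0//.
  by rewrite lerXn2r ?nnegrE ?addr_ge0// lerDl.
- move=> z z1; have : cvgC \oo (psum u (c * z)) (f (c * z)).
    apply: cu; apply: le_lt_trans z1; rewrite cnormM mulrA ler_wpM2r ?cnorm_ge0//.
    by rewrite ler_wpM2l ?(ltW r0)// lerDl.
  apply: near_cvgC; apply: nearW => n; rewrite /psum; apply: eq_bigr => k _.
  by rewrite exprMn mulrA.
Qed.

Lemma fps_add u v f g : fps_at u f -> fps_at v g ->
  fps_at (fun k => u k + v k) (fun z => f z + g z).
Proof.
move=> [M [r [r0 bu cu]]] [N [s [s0 bv cv]]].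
pose t := Num.max r s.
have t0 : 0 < t by rewrite lt_max r0.
have bu' : gbound u M t by apply: gbound_le bu; rewrite ?le_max ?lexx// ltW.
have bv' : gbound v N t by apply: gbound_le bv; rewrite ?le_max ?lexx ?orbT// ltW.
exists (M + N), t; split => //.
  by move=> k; rewrite (le_trans (cnormD _ _))// mulrDl lerD.
move=> z z1.
have rz : r * cnorm z < 1.
  by rewrite (le_lt_trans _ z1)// ler_wpM2r ?cnorm_ge0// le_max lexx.
have sz : s * cnorm z < 1.
  by rewrite (le_lt_trans _ z1)// ler_wpM2r ?cnorm_ge0// le_max lexx orbT.
apply: near_cvgC (cvgC_D (cu z rz) (cv z sz)); apply: nearW => n.
by rewrite /psum -big_split/=; apply: eq_bigr => k _; rewrite mulrDl.
Qed.

Lemma fps_cst (c : C) : fps_at (fun k => (k == 0%N)%:R * c) (fun=> c).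
Proof.
have := fps_poly c%:P; rewrite (_ : horner c%:P = fun=> c); last first.
  by apply/funext => z; rewrite hornerC.
congr (fps_at _ _); apply/funext => k; rewrite coefC.
by case: k => [|k] /=; rewrite ?mul1r ?mul0r.
Qed.

End PowerSeries.

(** * The complex exponential as a power series *)

Section ComplexExponential.
Variable R : realType.
Local Notation C := R[i].
Implicit Types (z w : C) (x y : R).

Definition exp_fps (k : nat) : C := (k`!%:R)^-1.

Lemma cexpD z w : cexp (z + w) = cexp z * cexp w.
Proof.
case: z w => [x y] [x' y']; rewrite /cexp /= expRD cosD sinD.
by apply/eqP; rewrite eq_complex /=; apply/andP; split; apply/eqP; ring.
Qed.

Lemma cexp0 : cexp (0 : C) = 1.
Proof. by rewrite /cexp /= expR0 cos0 sin0 mulr1 mulr0. Qed.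

Lemma cexpMn z n : cexp (z *+ n) = cexp z ^+ n.
Proof. by elim: n => [|n IH]; rewrite ?mulr0n ?cexp0// mulrS cexpD IH exprS. Qed.

Lemma cexp_neq0 z : cexp z != 0.
Proof.
apply/eqP => h; have := cexpD z (- z); rewrite subrr cexp0 h mul0r.
by move/eqP; rewrite oner_eq0.
Qed.

Lemma cexpN z : cexp (- z) = (cexp z)^-1.
Proof.
apply: (mulfI (cexp_neq0 z)); rewrite mulfV ?cexp_neq0//.
by rewrite -cexpD subrr cexp0.
Qed.

Lemma cexp_real x : cexp x%:C = (expR x)%:C.
Proof. by rewrite /cexp /= cos0 sin0 mulr1 mulr0. Qed.

Lemma gbound_exp z : exists M : R, gbound (fun k => exp_fps k * z ^+ k) M 2^-1.
Proof.
have h := @cvg_exp_coeff R (2 * cnorm z).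
have /cvg_seq_bounded[M [Mr hM]] : cvgn (exp_coeff (2 * cnorm z)) by apply/cvg_ex; exists 0.
exists (M + 1) => k; have := hM (M + 1); rewrite ltrDl ltr01 => /(_ isT k I) /=.
rewrite /exp_coeff /= => le.
rewrite cnormM cnormX /exp_fps cnormV exprVn ler_pdivlMr ?exprn_gt0//.
have -> : cnorm (k`!%:R : C) = k`!%:R.
  by rewrite -(rmorph_nat (real_complex R)) cnorm_real ger0_norm.
move: le; rewrite ger0_norm; last by rewrite divr_ge0// exprn_ge0// mulr_ge0// cnorm_ge0.
by rewrite exprMn; apply: le_trans; rewrite le_eqVlt; apply/orP; left; apply/eqP; ring.
Qed.

Lemma conv_exp z w k :
  conv (fun k => exp_fps k * z ^+ k) (fun k => exp_fps k * w ^+ k) k =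
  exp_fps k * (z + w) ^+ k.
Proof.
rewrite exprDn mulr_sumr /conv; rewrite [RHS](reindex_inj rev_ord_inj)/=.
apply: eq_bigr => i _; rewrite subSS /exp_fps -mulr_natr subKn ?leq_ord//.
rewrite bin_sub ?leq_ord//.
have f0 n : (n`!%:R : C) != 0 by rewrite pnatr_eq0 -lt0n fact_gt0.
have : ('C(k, i)%:R * (i`!%:R * (k - i)`!%:R) : C) = k`!%:R.
  by rewrite -!natrM bin_fact ?leq_ord.
move=> <-; field; rewrite !f0 /= pnatr_eq0 -lt0n bin_gt0 leq_ord.
by [].
Qed.

Lemma cvgC_pair (u v : nat -> R) (a b : R) : u n @[n --> \oo] --> a ->
  v n @[n --> \oo] --> b -> cvgC \oo (fun n => u n +i* v n) (a +i* b).
Proof.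
move=> ua vb.
have e (x y : R) : x +i* y = x%:C + 'i * y%:C by rewrite [LHS]complexE.
rewrite e; apply: (@near_cvgC _ _ _ _ (fun n => (u n)%:C + 'i * (v n)%:C)).
  by apply: nearW => n; rewrite -e.
apply: cvgC_D; first exact/cvgC_real.
by apply: cvgC_M; [exact: cvgC_cst|exact/cvgC_real].
Qed.

Lemma exp_series_real x : cvgC \oo (psum exp_fps x%:C) (cexp x%:C).
Proof.
rewrite cexp_real; apply: (@near_cvgC _ _ _ _ (fun n => (series (exp_coeff x) n)%:C)).
  apply: nearW => n; rewrite /series /= /psum rmorph_sum/=; apply: eq_bigr => k _.
  by rewrite /exp_coeff /= rmorphM/= rmorphXn/= fmorphV/= rmorph_nat mulrC.
apply/cvgC_real; rewrite /expR; exact: is_cvg_series_exp_coeff.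
Qed.

Lemma exp_series_im y : cvgC \oo (psum exp_fps (0 +i* y)) (cexp (0 +i* y)).
Proof.
rewrite /cexp /= expR0 !mul1r cos.unlock sin.unlock.
apply: (@near_cvgC _ _ _ _ (fun n => series (cos_coeff y) n +i* series (sin_coeff y) n)); last first.
  by apply: cvgC_pair; [exact: is_cvg_series_cos_coeff|exact: is_cvg_series_sin_coeff].
apply: nearW => n; rewrite /psum /series /=.
elim: n => [|n IH]; first by rewrite !big_geq.
rewrite !big_nat_recr//= -IH.
have -> : exp_fps n * (0 +i* y) ^+ n = cos_coeff y n +i* sin_coeff y n; last by [].
have -> : 0 +i* y = 'i * y%:C by rewrite [LHS]complexE /= add0r.
rewrite exprMn -[n in 'i ^+ n]odd_double_half exprD -muln2 mulnC exprM sqr_i.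
rewrite /exp_fps /cos_coeff /sin_coeff /=.
have -> : (n`!%:R : C)^-1 = (n`!%:R^-1)%:C by rewrite fmorphV/= rmorph_nat.
have -> : (-1) ^+ n./2 = ((-1) ^+ n./2)%:C :> C by rewrite rmorphXn/= rmorphN rmorph1.
rewrite -rmorphXn/= -!exprnP.
case: (boolP (odd n)) => no /=.
  have -> : n.-1./2 = n./2 by move: no; rewrite -[n in odd n]odd_double_half; lia.
  apply/eqP; rewrite eq_complex /=; apply/andP; split; apply/eqP; ring.
apply/eqP; rewrite eq_complex /=; apply/andP; split; apply/eqP; ring.
Qed.

(** The real and the imaginary axis are the exponential, cosine and sine series; the
general case is the Cauchy product of both, by [cexpD]. *)
Lemma exp_series z : cvgC \oo (psum exp_fps z) (cexp z).
Proof.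
case: z => x y; have -> : x +i* y = x%:C + (0 +i* y).
  by apply/eqP; rewrite eq_complex /= addr0 add0r !eqxx.
set w := 0 +i* y; rewrite cexpD.
have [M bM] := gbound_exp x%:C; have [N bN] := gbound_exp w.
have M0 := gbound_ge0 bM; have N0 := gbound_ge0 bN.
have h1 : 2^-1 * cnorm (1 : C) < 1 by rewrite cnorm1; lra.
have h0 : 0 <= 2^-1 :> R by [].
have ps z n : psum (fun k => exp_fps k * z ^+ k) 1 n = psum exp_fps z n.
  by apply: eq_bigr => k _; rewrite expr1n mulr1.
pose proof (cvg_psum_mul h0 h1 bM bN) as h.
pose proof (cvgC_B (cvgC_M (exp_series_real x) (exp_series_im y)) h) as h3.
rewrite -[X in cvgC _ _ X]subr0; apply: near_cvgC h3; apply: nearW => n.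
rewrite !ps opprB addrC subrK /psum; apply: eq_bigr => k _.
by rewrite conv_exp expr1n mulr1.
Qed.

Lemma gbound_exp_fps : gbound exp_fps 1 1.
Proof.
move=> k; rewrite expr1n mulr1 /exp_fps cnormV.
rewrite -(rmorph_nat (real_complex R)) cnorm_real ger0_norm// invf_le1 ?ltr0n ?fact_gt0//.
by rewrite ler1n fact_gt0.
Qed.

Lemma fps_exp : fps_at exp_fps cexp.
Proof. by exists 1, 1; split => //; [exact: gbound_exp_fps|move=> z _; exact: exp_series]. Qed.

End ComplexExponential.

(** * Residues *)

Section Residues.
Variable R : realType.
Local Notation C := R[i].
Implicit Types (z w l c : C) (f : C -> C) (u v : nat -> C) (p q : {poly C}).

Lemma is_residueP f z0 c : is_residue f z0 c <->
  exists m u (e : R), [/\ 0 < e,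
    forall w, w != 0 -> cnorm w < e -> cvgC \oo (psum u w) (w ^+ m.+1 * f (z0 + w))
    & c = u m].
Proof.
split.
  move=> [m [u [/near_dnbhsC[e e0 h] cu]]]; exists m, u, e; split => // w w0 we.
  have := h (z0 + w); rewrite -subr_eq0 addrAC subrr add0r => /(_ w0 we).
  by move/cvg_cnorm.
move=> [m [u [e [e0 h cu]]]]; exists m, u; split => //.
apply/near_dnbhsC; exists e => // z; rewrite -subr_eq0 => z0' ze.
have := h _ z0' ze; rewrite addrCA subrr addr0 => h'.
exact/cvg_cnorm.
Qed.

Lemma psum_shift u w s n :
  psum (fun k => if (k < s)%N then 0 else u (k - s)%N) w (s + n) = w ^+ s * psum u w n.
Proof.
rewrite /psum (@big_cat_nat _ _ _ s) ?leq_addr//= big_nat big1 ?add0r; last first.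
  by move=> i /andP[_ ->]; rewrite mul0r.
rewrite -{1}(add0n s) big_addn addKn mulr_sumr; apply: eq_bigr => i _.
by rewrite ltnNge leq_addl/= addnK exprD; ring.
Qed.

(** Two expansions with poles of orders [m.+1] and [m'.+1] become comparable after
multiplication by a power of [z - z0]; then their difference vanishes near [z0]. *)
Lemma is_residue_uniq f z0 c c' : is_residue f z0 c -> is_residue f z0 c' -> c = c'.
Proof.
move=> /is_residueP[m [u [e [e0 h ->]]]] /is_residueP[m' [u' [e' [e'0 h' ->]]]].
wlog mm' : m m' u u' e e' e0 h e'0 h' / (m <= m')%N.
  move=> W; case: (leqP m m') => [|/ltnW] mm'; first exact: (W m m' u u' e e').
  by apply/esym; exact: (W m' m u' u e' e).
pose s := (m' - m)%N.
pose d k := (if (k < s)%N then 0 else u (k - s)%N) - u' k.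
pose e2 := Num.min e e'.
have e20 : 0 < e2 by rewrite lt_min e0.
have hd w : w != 0 -> cnorm w < e2 -> cvgC \oo (psum d w) 0.
  rewrite lt_min => w0 /andP[we we'].
  have h1 : cvgC \oo (psum (fun k => if (k < s)%N then 0 else u (k - s)%N) w)
      (w ^+ m'.+1 * f (z0 + w)).
    have : cvgC \oo (fun n => w ^+ s * psum u w n) (w ^+ s * (w ^+ m.+1 * f (z0 + w))).
      by apply: cvgC_M; [exact: cvgC_cst|exact: h].
    rewrite mulrA -exprD addnS subnK// /cvgC.
    under eq_fun do rewrite -psum_shift addnC.
    by rewrite (cvg_shiftn s (fun n => cnorm (psum _ w n - _))).
  pose proof (cvgC_B h1 (h' w w0 we')) as h2; rewrite subrr in h2.
  apply: near_cvgC h2; apply: nearW => n.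
  by rewrite /psum -sumrB; apply: eq_bigr => k _; rewrite /d mulrBl.
have small (t : R) : 0 < t -> exists w, [/\ w != 0, cnorm w < t & cnorm w < e2].
  move=> t0; exists (Num.min (t / 2) (e2 / 2))%:C.
  have mt : 0 < Num.min (t / 2) (e2 / 2) by rewrite lt_min !divr_gt0.
  have ht : t / 2 < t by lra.
  have he : e2 / 2 < e2 by lra.
  rewrite cnorm_real gtr0_norm// !gt_min ht he orbT; split => //.
  by rewrite eq_complex /= negb_and gt_eqF.
have [w1 [w10 w1e _]] := small _ e20.
have [M bM] := cvg_psum_bound w10 (hd _ w10 w1e).
have d0 : forall k, d k = 0.
  apply: (fps_zero _ bM); first by rewrite invr_gt0 cnorm_gt0.
  by move=> t /small[w [w0 wt we]]; exists w; split => //; exact: hd.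
have := d0 m'; rewrite /d ltnNge leq_subr/= subKn// => /eqP.
by rewrite subr_eq0 => /eqP.
Qed.

Lemma residueE f z0 c : is_residue f z0 c -> residue f z0 = c.
Proof.
by move=> h; apply: xget_unique => // c' h'; exact: is_residue_uniq h' h.
Qed.

Lemma conv_eql u u' v n : (forall k, (k <= n)%N -> u k = u' k) -> conv u v n = conv u' v n.
Proof.
by move=> h; apply: eq_bigr => i _; rewrite h// -ltnS.
Qed.

Lemma conv_eqr u v v' n : (forall k, (k <= n)%N -> v k = v' k) -> conv u v n = conv u v' n.
Proof. by move=> h; rewrite convC (conv_eql _ h) convC. Qed.

Lemma convA u v (w' : nat -> C) n : conv u (conv v w') n = conv (conv u v) w' n.
Proof.
have e s t : conv s t n = (\poly_(i < n.+1) s i * \poly_(i < n.+1) t i)`_n.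
  exact: conv_poly.
rewrite !e.
have h s t r : (r * \poly_(i < n.+1) conv s t i)`_n =
    (r * (\poly_(i < n.+1) s i * \poly_(i < n.+1) t i))`_n.
  rewrite !coefM; apply: eq_bigr => i _; congr (_ * _).
  by rewrite coef_poly ltnS leq_subr; apply: conv_poly; rewrite ltnS leq_subr.
by rewrite h (mulrC (\poly_(i < n.+1) conv u v i)) h mulrA mulrC.
Qed.

Lemma conv_coef p q n : conv (fun k => p`_k) (fun k => q`_k) n = (p * q)`_n.
Proof. by rewrite coefM. Qed.

(** Taylor coefficients of [p / q] at [l]. *)
Definition quot_fps p q l : nat -> C :=
  conv (fun k => (p \Po ('X + l%:P))`_k) (fps_inv (fun k => (q \Po ('X + l%:P))`_k)).

Lemma shift0 q l : (q \Po ('X + l%:P))`_0 = q.[l].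
Proof. by rewrite -horner_coef0 horner_comp !hornerE. Qed.

Lemma quot_fpsK p q l n : q.[l] != 0 ->
  conv (fun k => (q \Po ('X + l%:P))`_k) (quot_fps p q l) n = (p \Po ('X + l%:P))`_n.
Proof.
move=> ql; rewrite /quot_fps (conv_eqr _ (fun k _ => convC _ _ k)) convA convC.
rewrite (conv_eqr _ (fun k _ => conv_inv k _)) ?shift0//.
rewrite /conv big_ord_recr/= subnn mulr1 big1 ?add0r// => i _.
by rewrite subn_eq0 leqNgt ltn_ord mulr0.
Qed.

(** Writing [e^(z t) = e^(l t) e^((z - l) t)], the Laurent expansion at [l] is the product
of an exponential series and of the Taylor series of [p / q]. *)
Lemma is_residue_exp_quot p q l (m : nat) (t : R) : q.[l] != 0 ->
  is_residue (fun z => cexp (z * t%:C) * (p.[z] / (('X - l%:P) ^+ m.+1 * q).[z])) l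
    (cexp (l * t%:C) * conv (fun k => exp_fps R k * t%:C ^+ k) (quot_fps p q l) m).
Proof.
move=> ql; apply/is_residueP.
pose sh r : {poly C} := r \Po ('X + l%:P).
have hq0 : (sh q)`_0 != 0 by rewrite shift0.
have [M [r [r0 bu cu]]] := fps_mul (fps_scale t%:C (fps_exp R))
  (fps_mul (fps_poly (sh p)) (fps_inv_at (fps_poly (sh q)) hq0)).
exists m, (fun k => cexp (l * t%:C) * conv (fun k => exp_fps R k * t%:C ^+ k) (quot_fps p q l) k), r^-1.
split; rewrite ?invr_gt0// => w w0 wr.
have rw : r * cnorm w < 1 by rewrite -(@mulfV _ r) ?gt_eqF// ltr_pM2l.
have h := cu _ rw.
have -> : w ^+ m.+1 * (cexp ((l + w) * t%:C) *
    (p.[l + w] / (('X - l%:P) ^+ m.+1 * q).[l + w])) =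
    cexp (l * t%:C) * (cexp (t%:C * w) * ((sh p).[w] * ((sh q).[w])^-1)).
  rewrite mulrDl cexpD hornerM horner_exp hornerXsubC addrAC subrr add0r.
  rewrite /sh !horner_comp !hornerD !hornerX !hornerC [w + l]addrC [t%:C * w]mulrC.
  rewrite invfM; move: (q.[_]^-1) => y; field.
  by rewrite expf_neq0.
pose proof (cvgC_M (cvgC_cst (cexp (l * t%:C))) h) as h'.
apply: near_cvgC h'; apply: nearW => n.
by rewrite /psum mulr_sumr; apply: eq_bigr => k _; rewrite mulrA.
Qed.

End Residues.

(** * Partial fractions *)

Section SumOfResidues.
Variable F : fieldType.
Implicit Types p q : {poly F}.

Lemma coefM_top p q m n : (size p <= m.+1)%N -> (size q <= n.+1)%N ->
  (p * q)`_(m + n) = p`_m * q`_n.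
Proof.
move=> sp sq; have mn : (m < (m + n).+1)%N by rewrite ltnS leq_addr.
rewrite coefM (bigD1 (Ordinal mn))//= addKn big1 ?addr0// => i im.
have [lt|gt] := ltnP i m.
  have h : (n.+1 <= m + n - i)%N by lia.
  by rewrite [q`_ _]nth_default ?mulr0// (leq_trans sq).
rewrite [p`_ _]nth_default ?mul0r// (leq_trans sp)// ltn_neqAle gt andbT.
by move: im; apply: contra => /eqP h; apply/eqP/val_inj.
Qed.

Lemma dvdp_prod_exp (s : seq F) (e : F -> nat) p : uniq s ->
  (forall l, l \in s -> ('X - l%:P) ^+ e l %| p) ->
  \prod_(l <- s) ('X - l%:P) ^+ e l %| p.
Proof.
elim: s => [|l s IH]; first by rewrite big_nil dvd1p.
move=> /= /andP[ls us] h; rewrite big_cons Gauss_dvdp; last first.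
  rewrite coprimep_sym coprimep_expr// coprimep_XsubC.
  rewrite rootE horner_prod prodf_seq_neq0; apply/allP => x xs /=.
  rewrite horner_exp !hornerE expf_neq0// subr_eq0.
  by apply: contraNneq ls => ->.
rewrite h ?mem_head//= IH// => x xs; apply: h.
by rewrite in_cons xs orbT.
Qed.

Lemma prod_undup (s : seq F) :
  \prod_(l <- s) ('X - l%:P) = \prod_(l <- undup s) ('X - l%:P) ^+ count_mem l s.
Proof.
by rewrite -big_undup_iterop_count/=; apply: eq_bigr.
Qed.

End SumOfResidues.

Section SumOfResiduesC.
Variable R : realType.
Local Notation C := R[i].
Implicit Types (p q : {poly C}) (l : C) (lam : seq C).

(** What remains of [\prod_(x <- lam) ('X - x%:P)] without its factors at [l]. *)
Definition rootless lam l : {poly C} := \prod_(x <- lam | x != l) ('X - x%:P).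

Lemma rootlessP lam l :
  \prod_(x <- lam) ('X - x%:P) = ('X - l%:P) ^+ count_mem l lam * rootless lam l.
Proof.
rewrite (bigID (pred1 l))/=; congr (_ * _).
rewrite -big_filter (eq_big_seq (fun=> 'X - l%:P)); last first.
  by move=> x; rewrite mem_filter => /andP[/eqP ->].
rewrite big_const_seq count_predT size_filter.
by elim: (count _ _) => //= n ->; rewrite exprS.
Qed.

Lemma rootless_neq0 lam l : (rootless lam l).[l] != 0.
Proof.
rewrite horner_prod prodf_seq_neq0; apply/allP => x _; apply/implyP => xl.
by rewrite !hornerE subr_eq0 eq_sym.
Qed.

Lemma dvdp_rootless lam l x : x != l -> ('X - x%:P) ^+ count_mem x lam %| rootless lam l.
Proof.
move=> xl.
have : ('X - x%:P) ^+ count_mem x lam %| \prod_(x <- lam) ('X - x%:P).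
  by rewrite (rootlessP lam x) dvdp_mulr.
rewrite (rootlessP lam l) Gauss_dvdpr// coprimep_expl// coprimep_expr//.
by rewrite coprimep_XsubC2// subr_eq0 eq_sym.
Qed.

Lemma size_rootless lam l : size (rootless lam l) = (size lam - count_mem l lam).+1.
Proof.
rewrite /rootless -big_filter size_prod_XsubC size_filter.
by rewrite -(count_predC (pred1 l) lam) addKn.
Qed.

Lemma dvdp_shift p l n : (forall k, (k < n)%N -> (p \Po ('X + l%:P))`_k = 0) ->
  ('X - l%:P) ^+ n %| p.
Proof.
move=> h; set s := p \Po ('X + l%:P) in h.
have ps : p = s \Po ('X - l%:P).
  by rewrite /s -comp_polyA comp_polyD comp_polyX comp_polyC addrNK comp_polyXr.
have [q sq] : exists q, s = q * 'X^n.
  exists (drop_poly n s); rewrite -[LHS](poly_take_drop n).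
  rewrite (_ : take_poly n s = 0) ?add0r//; apply/polyP => k.
  by rewrite coef_take_poly coef0; case: ifP => // /h.
by rewrite ps sq comp_polyM comp_Xn_poly dvdp_mull.
Qed.

(** The coefficient of [(z - l)^-1] of the rational function
[p / \prod_(x <- lam) (z - x)] at a root [l]. *)
Definition res_quot p lam l : C := quot_fps p (rootless lam l) l (count_mem l lam).-1.

(** Partial fractions: if [T l] is the numerator at [l], cut at the multiplicity, then
[p - \sum_l T l * rootless lam l] vanishes to the right order at every root, hence is
[0] for degree reasons.  The claim is the comparison of the leading coefficients. *)
Lemma sum_res_quot p lam : (size p <= size lam)%N -> lam != [::] ->
  \sum_(l <- undup lam) res_quot p lam l = p`_(size lam).-1.
Proof.
move=> sp lam0.
have slam : (0 < size lam)%N by rewrite lt0n size_eq0.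
have cm l : l \in lam -> (0 < count_mem l lam <= size lam)%N.
  by move=> ll; rewrite count_size -has_count has_pred1 ll.
pose T l := (\poly_(i < count_mem l lam) quot_fps p (rootless lam l) l i) \Po ('X - l%:P).
have sT l : (size (T l) <= count_mem l lam)%N.
  by rewrite size_comp_poly2 ?size_XsubC// size_poly.
have sTA l : l \in lam -> (size (T l * rootless lam l)%R <= size lam)%N.
  move=> ll; rewrite (leq_trans (size_polyMleq _ _))// size_rootless.
  by have := sT l; have := cm l ll; lia.
pose D := p - \sum_(l <- undup lam) T l * rootless lam l.
have sD : (size D <= size lam)%N.
  rewrite (leq_trans (size_polyD _ _))// geq_max sp size_polyN.
  rewrite (leq_trans (size_sum _ _ _))//; apply/bigmax_leqP_seq => l.
  by rewrite mem_undup => ll _; exact: sTA.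
have D0 : D = 0.
  apply/eqP; rewrite -size_poly_leq0 leqNgt; apply/negP => sD0.
  have D0 : D != 0 by rewrite -size_poly_gt0.
  suff : \prod_(l <- lam) ('X - l%:P) %| D.
    by move=> /(dvdp_leq D0); rewrite size_prod_XsubC leqNgt ltnS sD.
  rewrite prod_undup; apply: dvdp_prod_exp; first exact: undup_uniq.
  move=> l; rewrite mem_undup => ll.
  rewrite /D (bigD1_seq l) ?mem_undup ?undup_uniq//= opprD addrA dvdp_sub//.
    apply: dvdp_shift => k km; rewrite comp_polyB comp_polyM coefB.
    rewrite /T -comp_polyA comp_polyB comp_polyX comp_polyC addrK comp_polyXr.
    rewrite -(quot_fpsK _ _ (rootless_neq0 lam l)) -conv_coef convC [X in _ - X]convC.
    rewrite [X in _ - X](@conv_eqr _ _ _ (quot_fps p (rootless lam l) l)).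
      by rewrite convC subrr.
    by move=> i ik; rewrite coef_poly (leq_ltn_trans ik km).
  rewrite big_seq_cond; elim/big_rec: _ => [|x y /andP[_ xl] IH]; first exact: dvdp0.
  by rewrite dvdp_add// dvdp_mull// dvdp_rootless// eq_sym.
have : p`_(size lam).-1 = (\sum_(l <- undup lam) T l * rootless lam l)`_(size lam).-1.
  by apply/eqP; rewrite -subr_eq0 -coefB -/D D0 coef0.
rewrite coef_sum => ->; apply: eq_big_seq => l; rewrite mem_undup => ll.
have /andP[c0 cl] := cm l ll.
have -> : (size lam).-1 = ((count_mem l lam).-1 + (size lam - count_mem l lam))%N by lia.
rewrite coefM_top ?size_rootless ?prednK//.
have -> : (rootless lam l)`_(size lam - count_mem l lam) = 1.
  have /monicP := monic_prod_XsubC lam (fun x => x != l) id.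
  by rewrite lead_coefE -/(rootless lam l) size_rootless.
rewrite mulr1 /res_quot /T comp_polyE.
set m := count_mem l lam in c0 cl *.
have [sz|sz] := ltnP (size (\poly_(i < m) quot_fps p (rootless lam l) l i)) m.
  have z0 : quot_fps p (rootless lam l) l m.-1 = 0.
    have := @nth_default _ 0 _ _ (_ : (size (\poly_(i < m) quot_fps p (rootless lam l) l i) <= m.-1)%N).
    by rewrite coef_poly prednK// leqnn; apply; rewrite -ltnS prednK.
  rewrite z0 coef_sum big1// => i _; rewrite coefZ [X in _ * X]nth_default ?mulr0//.
  by rewrite size_exp_XsubC (leq_trans (ltn_ord i))// -ltnS prednK.
have -> : size (\poly_(i < m) quot_fps p (rootless lam l) l i) = m.
  by apply/eqP; rewrite eqn_leq sz size_poly.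
rewrite coef_sum; case: m c0 {cl sz} => // m _; rewrite big_ord_recr/= big1 ?add0r.
  rewrite coefZ coef_poly ltnSn.
  have /monicP := monic_exp m (monicXsubC l).
  by rewrite lead_coefE size_exp_XsubC /= => ->; rewrite mulr1.
move=> i _; rewrite coefZ [X in _ * X]nth_default ?mulr0//.
by rewrite size_exp_XsubC.
Qed.

End SumOfResiduesC.

(** * Finite differences of polynomials *)

Section FiniteDifferences.
Variable K : idomainType.
Implicit Types P Q : {poly K}.

Lemma coef_XaddC_exp (l : K) j i : (('X + l%:P) ^+ j)`_i = l ^+ (j - i) *+ 'C(j, i).
Proof.
rewrite addrC exprDn coef_sum; have [ij|ji] := leqP i j.
  rewrite (bigD1 (Ordinal (_ : i < j.+1)%N))//= big1 ?addr0.
    by rewrite -polyC_exp coefMn coefCM coefXn eqxx mulr1.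
  move=> k ki; rewrite -polyC_exp coefMn coefCM coefXn.
  have /negPf -> : i != k by apply: contra ki => /eqP h; apply/eqP/val_inj.
  by rewrite mulr0 mul0rn.
rewrite bin_small// mulr0n big1// => k _; rewrite -polyC_exp coefMn coefCM coefXn.
by rewrite gtn_eqF ?mulr0 ?mul0rn// (leq_trans (ltn_ord k)).
Qed.

Lemma sum_mul_1BX Q n (f : nat -> K) : (size Q <= n)%N ->
  \sum_(k < n.+1) (Q * (1 - 'X))`_k * f k = \sum_(k < n) Q`_k * (f k - f k.+1).
Proof.
move=> sQ; under eq_bigr do rewrite mulrBr mulr1 coefB mulrBl coefMX.
rewrite sumrB big_ord_recr/= [Q`_n]nth_default// mul0r addr0.
rewrite big_ord_recl/= mul0r add0r -sumrB.
by apply: eq_bigr => k _; rewrite mulrBr.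
Qed.

(** Each factor [1 - 'X] acts on the sequence of the values [P.[k]] as a difference, which
lowers the degree of [P]. *)
Lemma sum_mul_1BXn m Q n P : (size Q <= n)%N -> (size P <= m.+1)%N ->
  \sum_(k < n + m) (Q * (1 - 'X) ^+ m)`_k * P.[k%:R] =
  Q.[1] * (-1) ^+ m * m`!%:R * P`_m.
Proof.
elim: m n P => [|m IH] n P sQ sP.
  rewrite addn0 !mulr1 (horner_coef_wide _ sQ) mulr_suml.
  by apply: eq_bigr => k _; rewrite {1}(size1_polyC sP) hornerC expr1n mulr1.
have c1 : (1 - 'X : {poly K}) = - ('X - 1%:P) by rewrite opprB.
have s1 j : (size ((1 - 'X : {poly K}) ^+ j) <= j.+1)%N.
  by rewrite c1 exprNn -signr_odd mulr_sign; case: ifP => _; rewrite ?size_polyN size_exp_XsubC.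
have sQm : (size (Q * (1 - 'X) ^+ m)%R <= n + m)%N.
  rewrite (leq_trans (size_polyMleq _ _))//; have := leq_add sQ (s1 m).
  by case: (size Q + _)%N => //= k; rewrite addnS ltnS.
rewrite addnS exprSr mulrA (sum_mul_1BX (fun k => P.[k%:R]) sQm).
pose P' := P - (P \Po ('X + 1%:P)).
have cP' j : P'`_j = P`_j - \sum_(i < size P) P`_i *+ 'C(i, j).
  rewrite coefB coef_comp_poly; congr (_ - _); apply: eq_bigr => i _.
  by rewrite coef_XaddC_exp expr1n mulr_natr.
have cP'w j : P'`_j = P`_j - \sum_(i < m.+2) P`_i *+ 'C(i, j).
  rewrite cP'; congr (_ - _); rewrite (big_ord_widen _ (fun i => P`_i *+ 'C(i, j)) sP).
  rewrite [RHS](bigID (fun i : 'I__ => (i < size P)%N))/= [X in _ = _ + X]big1 ?addr0// => i.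
  by rewrite -leqNgt => h; rewrite nth_default// mul0rn.
have sP' : (size P' <= m.+1)%N.
  apply/leq_sizeP => j mj; rewrite cP'w.
  have [<-|jm] := eqVneq m.+1 j.
    rewrite big_ord_recr/= binn mulr1n big1 ?add0r ?subrr// => i _.
    by rewrite bin_small.
  have mj' : (m.+1 < j)%N by rewrite ltn_neqAle jm.
  rewrite nth_default ?(leq_trans sP)// big1 ?subrr// => i _.
  by rewrite bin_small// (leq_trans (ltn_ord i)).
have h k : P.[k%:R] - P.[k.+1%:R] = P'.[k%:R].
  by rewrite /P' hornerD hornerN horner_comp !hornerE natr1.
under eq_bigr do rewrite h.
rewrite IH// cP'w !big_ord_recr/= binn mulr1n binSn.
rewrite big1 => [|i _]; last by rewrite bin_small.
rewrite add0r opprD addrA subrr add0r -mulr_natr factS natrM exprS; ring.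
Qed.

End FiniteDifferences.

(** * The kernel of a CARMA process *)

Section Kernel.
Variable R : realType.
Local Notation C := R[i].
Implicit Types (l : C) (lam : seq C) (b : {poly C}) (t D : R).

(** The entire function which coincides with the kernel on the positive
half-line. *)
Definition entire_kernel b lam t : C := \sum_(l <- undup lam) cexp (l * t%:C) *
  conv (fun k => exp_fps R k * t%:C ^+ k) (quot_fps b (rootless lam l) l)
    (count_mem l lam).-1.

Lemma carma_kernelE (a b : {poly R}) lam t :
  map_poly (real_complex R) a = \prod_(l <- lam) ('X - l%:P) ->
  carma_kernel a b lam t =
  if 0 < t then complex.Re (entire_kernel (map_poly (real_complex R) b) lam t) else 0.
Proof.
move=> ea; rewrite /carma_kernel; case: ifP => // t0; congr complex.Re.
apply: eq_big_seq => l; rewrite mem_undup => ll; apply: residueE.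
have c0 : (0 < count_mem l lam)%N by rewrite -has_count has_pred1.
rewrite ea (rootlessP lam l) -{1}(prednK c0).
exact/is_residue_exp_quot/rootless_neq0.
Qed.

(** Only the germ at [0] matters; the unit interval makes powers of [t] comparable. *)
Definition bigO (n : nat) (f : R -> C) :=
  exists K : R, forall t, `|t| <= 1 -> cnorm (f t) <= K * `|t| ^+ n.

Lemma bigO_sum (I : eqType) (s : seq I) n (f : I -> R -> C) :
  (forall i, i \in s -> bigO n (f i)) -> bigO n (fun t => \sum_(i <- s) f i t).
Proof.
elim: s => [|i s IH] h.
  by exists 0 => t _; rewrite big_nil cnorm0 mul0r.
have [K hK] := h i (mem_head _ _).
have [|L hL] := IH; first by move=> j js; apply: h; rewrite in_cons js orbT.
exists (K + L) => t t1; rewrite big_cons (le_trans (cnormD _ _))// mulrDl.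
by rewrite lerD ?hK ?hL.
Qed.

Lemma bigO_mulr n (f : R -> C) (c : C) : bigO n f -> bigO n (fun t => f t * c).
Proof.
move=> [K h]; exists (cnorm c * K) => t t1; rewrite cnormM mulrC -mulrA.
by rewrite ler_wpM2l ?cnorm_ge0// h.
Qed.

Lemma bigO_exp_taylor l n : bigO n (fun t => cexp (l * t%:C) - psum (exp_fps R) (l * t%:C) n).
Proof.
have [M bM] := gbound_exp l; have M0 := gbound_ge0 bM.
exists (2 * M) => t t1.
apply: (cvg_cnorm_le (exp_series (l * t%:C))); near=> N.
have nN : (n <= N)%N by near: N; exact: nbhs_infty_ge.
rewrite /psum (@big_cat_nat _ _ _ n)//= addrAC subrr add0r.
have h2 : 2^-1 * cnorm (t%:C : C) <= 2^-1 by rewrite cnorm_real; lra.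
have := tail_bound n N _ h2 bM; rewrite invr_ge0 ler0n => /(_ isT).
rewrite (eq_bigr (fun j => exp_fps R j * (l * t%:C) ^+ j)); last by move=> j _; rewrite exprMn mulrA.
move=> /le_trans; apply; rewrite cnorm_real exprMn.
rewrite ler_wpM2l ?mulr_ge0// ler_piMl ?exprn_ge0//.
by rewrite exprn_ile1//; lra.
Unshelve. all: by end_near.
Qed.

Lemma bigO_mulX n i (f : R -> C) (c : C) : bigO (n - i) f ->
  bigO n (fun t => f t * (c * t%:C ^+ i)).
Proof.
move=> [K h]; have K0 : 0 <= K.
  have := h 1; rewrite normr1 expr1n mulr1 => /(_ (lexx _)).
  exact: le_trans (cnorm_ge0 _).
exists (cnorm c * K) => t t1; rewrite !cnormM cnormX cnorm_real.
rewrite mulrCA -[leRHS]mulrA ler_wpM2l ?cnorm_ge0//.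
rewrite (@le_trans _ _ (K * `|t| ^+ (n - i) * `|t| ^+ i))//.
  by rewrite ler_wpM2r ?exprn_ge0// h.
rewrite -mulrA -exprD ler_wpM2l//.
by rewrite ler_wiXn2l//; lia.
Qed.

(** If the exponential is replaced by its Taylor polynomial [E] of degree [r], the sum of
the residues is the coefficient of [z ^ (p - 1)] in [E * b], that is [t ^ r / r!].  The
remainder of the exponential enters the residue at [l] through derivatives of order
[i] at [l], which have size [t ^ (r + 1 - i) * t ^ i]. *)
Lemma entire_kernel_small b lam (q r : nat) : size lam = (r + q).+1 ->
  (size b <= q.+1)%N -> b`_q = 1 ->
  bigO r.+1 (fun t => entire_kernel b lam t - exp_fps R r * t%:C ^+ r).
Proof.
move=> sl sb bq.
(* The Taylor polynomial, in [z], of [e^(z t)]. *)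
pose Ex t : {poly C} := \poly_(j < r.+1) (exp_fps R j * t%:C ^+ j).
have main t : exp_fps R r * t%:C ^+ r = \sum_(l <- undup lam)
    conv (fun k => (Ex t \Po ('X + l%:P))`_k) (quot_fps b (rootless lam l) l)
      (count_mem l lam).-1.
  have sE : (size (Ex t) <= r.+1)%N by exact: size_poly.
  have <- : (Ex t * b)`_(size lam).-1 = exp_fps R r * t%:C ^+ r.
    by rewrite sl /= coefM_top// bq mulr1 coef_poly ltnSn.
  rewrite -sum_res_quot; last by rewrite -size_eq0 sl.
    apply: eq_bigr => l _; rewrite /res_quot /quot_fps convA; apply: conv_eql => k _.
    by rewrite conv_coef comp_polyM.
  by rewrite (leq_trans (size_polyMleq _ _))// sl; lia.
have -> : (fun t => entire_kernel b lam t - exp_fps R r * t%:C ^+ r) =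
   fun t => \sum_(l <- undup lam) \sum_(i < (count_mem l lam).-1.+1)
     ((cexp (l * t%:C) - psum (exp_fps R) (l * t%:C) (r.+1 - i)) *
       (exp_fps R i * t%:C ^+ i)) *
     quot_fps b (rootless lam l) l ((count_mem l lam).-1 - i)%N.
  apply/funext => t; rewrite main -sumrB; apply: eq_bigr => l _.
  rewrite mulr_sumr -sumrB; apply: eq_bigr => i _.
  rewrite [cexp _ * _]mulrA -mulrBl [in RHS]mulrBl; congr (_ * _); congr (_ - _).
  have sE : (size (Ex t) <= r.+1)%N by exact: size_poly.
  rewrite coef_comp_poly.
  have -> : \sum_(j < size (Ex t)) (Ex t)`_j * (('X + l%:P) ^+ j)`_i =
      \sum_(j < r.+1) (exp_fps R j * t%:C ^+ j) * (l ^+ (j - i) *+ 'C(j, i)).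
    rewrite (big_ord_widen _ (fun j => (Ex t)`_j * (('X + l%:P) ^+ j)`_i) sE).
    rewrite [RHS](bigID (fun j : 'I__ => (j < size (Ex t))%N))/= [X in _ = _ + X]big1 ?addr0.
      by apply: eq_bigr => j _; rewrite coef_XaddC_exp coef_poly ltn_ord.
    move=> j; rewrite -leqNgt => h.
    have := nth_default 0 h; rewrite coef_poly ltn_ord => ->.
    by rewrite mul0r.
  have e0 j : (j`!%:R : C) != 0 by rewrite pnatr_eq0 -lt0n fact_gt0.
  have [ir|ri] := leqP i r; last first.
    have -> : (r.+1 - i = 0)%N by apply/eqP; rewrite subn_eq0.
    rewrite /psum big_geq// mul0r big1// => j _.
    by rewrite bin_small ?mulr0n ?mulr0// (leq_trans (ltn_ord j)).
  rewrite -(big_mkord xpredT (fun j => (exp_fps R j * t%:C ^+ j) * (l ^+ (j - i) *+ 'C(j, i)))).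
  rewrite (@big_cat_nat _ _ _ i)//=; last exact: leqW.
  rewrite big_nat big1 ?add0r; last by move=> j /andP[_ ji]; rewrite bin_small ?mulr0n ?mulr0.
  rewrite -{1}(add0n (nat_of_ord i)) big_addn /psum mulr_suml; apply: eq_bigr => k _.
  rewrite addnK /exp_fps -mulr_natr.
  have := bin_fact (leq_addl k i); rewrite addnK => /(congr1 (fun n => n%:R : C)).
  rewrite !natrM => <-; rewrite exprMn exprD; field.
  by rewrite !e0 pnatr_eq0 -lt0n bin_gt0 leq_addl.
apply: bigO_sum => l _; apply: bigO_sum => i _.
by apply: bigO_mulr; apply: bigO_mulX; exact: bigO_exp_taylor.
Qed.

Lemma coef_ar_scale (P : {poly C}) (w : C) k : (P \Po (w *: 'X))`_k = P`_k * w ^+ k.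
Proof.
rewrite coef_comp_poly; have [kP|Pk] := ltnP k (size P).
  rewrite (bigD1 (Ordinal kP))//= exprZn coefZ coefXn eqxx mulr1 big1 ?addr0// => i ik.
  rewrite exprZn coefZ coefXn; have /negPf -> : k != i.
    by apply: contra ik => /eqP h; apply/eqP/val_inj.
  by rewrite !mulr0.
rewrite [P`_k]nth_default// mul0r big1// => i _; rewrite exprZn coefZ coefXn gtn_eqF ?mulr0//.
exact: leq_trans (ltn_ord i) Pk.
Qed.

(** Each term of the kernel is an exponential times a polynomial of degree less
than the multiplicity of the corresponding factor of [ar_poly], which acts on it as a
finite difference of that order. *)
Lemma ar_poly_kernel b lam D t :
  \sum_(k < size (ar_poly lam D)) (ar_poly lam D)`_k * entire_kernel b lam (t - k%:R * D) = 0.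
Proof.
rewrite /entire_kernel; under eq_bigr do rewrite mulr_sumr.
rewrite exchange_big/= big_seq big1// => l; rewrite mem_undup => ll.
have c0 : (0 < count_mem l lam)%N by rewrite -has_count has_pred1.
set m := count_mem l lam in c0 *.
set phi := ar_poly lam D.
(* Replacing ['X] by [w *: 'X] absorbs the factor [e^(- l k D)] of the [k]-th term, and turns
   the factors of [phi] at [l] into [1 - 'X]. *)
pose w := cexp (- (l * D%:C)).
pose P0 : {poly C} := \poly_(i < m) (exp_fps R i * quot_fps b (rootless lam l) l (m.-1 - i)%N).
pose P := P0 \Po (t%:C%:P - D%:C *: 'X).
have sP : (size P <= m)%N.
  rewrite (leq_trans (size_comp_poly_leq _ _))//.
  have s2 : (size (t%:C%:P - D%:C *: 'X : {poly C})%R <= 2)%N.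
    rewrite (leq_trans (size_polyD _ _))// geq_max size_polyN.
    rewrite (leq_trans (size_polyC_leq1 _))//= (leq_trans (size_scale_leq _ _))//.
    by rewrite size_polyX.
  have := size_poly m (fun i => exp_fps R i * quot_fps b (rootless lam l) l (m.-1 - i)%N).
  rewrite -/P0 => s0.
  have /leq_ltn_trans -> // : ((size P0).-1 * (size (t%:C%:P - D%:C *: 'X : {poly C})%R).-1 <= m.-1 * 1)%N.
    by move: s0 s2; move: (size P0) (size _) => x y xm y2; apply: leq_mul; lia.
  by rewrite muln1 prednK.
pose Q : {poly C} := \prod_(x <- lam | x != l) (1 - (cexp (x * D%:C) * w)%:P * 'X).
have psiE : phi \Po (w *: 'X) = Q * (1 - 'X) ^+ m.
  rewrite /phi /ar_poly rmorph_prod/= (bigID (pred1 l))/= mulrC; congr (_ * _).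
    apply: eq_bigr => x _; rewrite comp_polyB comp_polyC comp_polyM comp_polyC comp_polyX.
    by rewrite polyCM -mul_polyC mulrA.
  rewrite -big_filter (eq_big_seq (fun=> 1 - 'X)); last first.
    move=> x; rewrite mem_filter => /andP[/eqP -> _].
    rewrite comp_polyB comp_polyC comp_polyM comp_polyC comp_polyX.
    by rewrite mul_polyC scalerA /w cexpN mulfV ?cexp_neq0// scale1r.
  rewrite big_const_seq count_predT size_filter -/m.
  by elim: (m) => //= n ->; rewrite exprS.
have term k : phi`_k * (cexp (l * (t - k%:R * D)%:C) *
    conv (fun j => exp_fps R j * (t - k%:R * D)%:C ^+ j) (quot_fps b (rootless lam l) l) m.-1) =
    cexp (l * t%:C) * ((Q * (1 - 'X) ^+ m)`_k * P.[k%:R]).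
  rewrite -psiE coef_ar_scale.
  have -> : cexp (l * (t - k%:R * D)%:C) = cexp (l * t%:C) * w ^+ k.
    rewrite /w -cexpMn -cexpD; congr cexp; rewrite rmorphB rmorphM/= rmorph_nat.
    by rewrite -mulr_natl; ring.
  have -> : P.[k%:R] = conv (fun j => exp_fps R j * (t - k%:R * D)%:C ^+ j)
      (quot_fps b (rootless lam l) l) m.-1.
    rewrite /P horner_comp !hornerE horner_poly /conv prednK//.
    apply: eq_bigr => i _; rewrite rmorphB rmorphM/= rmorph_nat [k%:R * _]mulrC; ring.
  ring.
under eq_bigr do rewrite term.
rewrite -mulr_sumr.
have sphi : (size phi <= size Q + m + size phi)%N by rewrite leq_addl.
pose N := (size Q + size phi)%N.
have hN : (size phi <= N + m)%N by rewrite /N; lia.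
have -> : \sum_(k < size phi) (Q * (1 - 'X) ^+ m)`_k * P.[k%:R] =
          \sum_(k < N + m) (Q * (1 - 'X) ^+ m)`_k * P.[k%:R].
  rewrite (big_ord_widen _ (fun k => (Q * (1 - 'X) ^+ m)`_k * P.[k%:R]) hN).
  rewrite [RHS](bigID (fun j : 'I__ => (j < size phi)%N))/= [X in _ = _ + X]big1 ?addr0//.
  move=> j; rewrite -leqNgt => h; rewrite -psiE coef_ar_scale nth_default//.
  by rewrite !mul0r.
rewrite sum_mul_1BXn ?leq_addr// 1?leqW//.
by rewrite [P`_m]nth_default ?mulr0.
Qed.

(** Since [a] has real coefficients, its zeroes come in conjugate pairs. *)
Lemma ar_poly_real (a : {poly R}) lam D :
  map_poly (real_complex R) a = \prod_(l <- lam) ('X - l%:P) ->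
  forall k, (ar_poly lam D)`_k = (complex.Re (ar_poly lam D)`_k)%:C.
Proof.
move=> ea k.
have cl : perm_eq (map (@conjc R) lam) lam.
  apply: prod_XsubC_eq; rewrite big_map -ea.
  rewrite -(map_prod_XsubC (@conjc R) lam xpredT id) -ea -map_poly_comp.
  by apply/polyP => i; rewrite !coef_map /= oppr0.
have cphi : map_poly (@conjc R) (ar_poly lam D) = ar_poly lam D.
  rewrite /ar_poly rmorph_prod/= -[RHS](perm_big _ cl) big_map/=.
  apply: eq_bigr => l _; rewrite rmorphB rmorph1 rmorphM/= map_polyX map_polyC/=.
  congr (1 - _%:P * _); case: l => x y; rewrite /cexp /=.
  by rewrite !mulNr !mulr0 !oppr0 !addr0 !add0r sinN cosN mulrN.
have : ((ar_poly lam D)`_k)^*%C = (ar_poly lam D)`_k.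
  by rewrite -{2}cphi coef_map.
case: (_`_k) => x y [] /= yy; have -> : y = 0 by lra.
by [].
Qed.

End Kernel.

(** * Integrals of polynomials over the unit interval *)

Section PolyIntegral.
Variable K : fieldType.
Implicit Types P Q : {poly K}.

(** The integral over [[0, 1]] of a polynomial. *)
Definition pint P : K := \sum_(i < size P) P`_i / i.+1%:R.

Lemma pint_wide P n : (size P <= n)%N -> pint P = \sum_(i < n) P`_i / i.+1%:R.
Proof.
move=> sP; rewrite /pint (big_ord_widen _ (fun i => P`_i / i.+1%:R) sP).
rewrite [RHS](bigID (fun j : 'I__ => (j < size P)%N))/= [X in _ = _ + X]big1 ?addr0//.
by move=> j; rewrite -leqNgt => h; rewrite nth_default// mul0r.
Qed.

Lemma pintD P Q : pint (P + Q) = pint P + pint Q.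
Proof.
pose n := maxn (size P) (size Q).
rewrite (@pint_wide P n) ?leq_maxl// (@pint_wide Q n) ?leq_maxr//.
rewrite (@pint_wide _ n) ?size_polyD// -big_split/=.
by apply: eq_bigr => i _; rewrite coefD mulrDl.
Qed.

Lemma pintZ c P : pint (c *: P) = c * pint P.
Proof.
rewrite (@pint_wide _ (size P)) ?size_scale_leq// mulr_sumr.
by apply: eq_bigr => i _; rewrite coefZ mulrA.
Qed.

Lemma pint0 : pint 0 = 0.
Proof. by rewrite /pint size_poly0 big_ord0. Qed.

Lemma pint_sum (I : Type) (s : seq I) (F : I -> {poly K}) :
  pint (\sum_(i <- s) F i) = \sum_(i <- s) pint (F i).
Proof. by apply: (big_morph pint); [exact: pintD|exact: pint0]. Qed.

Hypothesis K0 : forall n : nat, (n.+1%:R : K) != 0.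

Lemma pint_deriv P : pint P^`() = P.[1] - P.[0].
Proof.
rewrite (@pint_wide _ (size P)); last first.
  by rewrite /deriv (leq_trans (size_poly _ _))// leq_pred.
rewrite horner_coef0 (horner_coef_wide _ (leqnSn (size P))) big_ord_recl/= expr1n mulr1.
rewrite addrC addKr; apply: eq_bigr => i _.
by rewrite coef_deriv expr1n mulr1 -[P`_ _ *+ _]mulr_natr mulfK.
Qed.

Lemma deriv_eq0 P : P^`() = 0 -> P = (P`_0)%:P.
Proof.
move=> dP; apply/polyP => -[|i]; rewrite coefC//=.
have := coef_deriv P i; rewrite dP coef0 -mulr_natr => /esym/eqP.
by rewrite mulf_eq0 (negPf (K0 i)) orbF => /eqP.
Qed.

Lemma pint_by_parts P Q : P.[1] * Q.[1] = P.[0] * Q.[0] ->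
  pint (P^`() * Q) = - pint (P * Q^`()).
Proof.
move=> PQ; apply/eqP; rewrite -addr_eq0 -pintD -derivM pint_deriv !hornerM PQ.
by rewrite subrr.
Qed.

End PolyIntegral.

Section RealPolyIntegral.
Variable R : realType.

Let R0 (n : nat) : (n.+1%:R : R) != 0. Proof. by rewrite pnatr_eq0. Qed.

Lemma pint_primitive (P : {poly R}) : exists2 Q, Q^`() = P & pint P = Q.[1] - Q.[0].
Proof.
pose Q := \poly_(i < (size P).+1) (P`_i.-1 / i%:R); suff dQ : Q^`() = P.
  by exists Q => //; rewrite -dQ; exact: pint_deriv.
apply/polyP => i; rewrite coef_deriv coef_poly ltnS /=.
case: ltnP => iP; last by rewrite mul0rn nth_default.
by rewrite -[_ / _ *+ _]mulr_natr divfK.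
Qed.

(** By the mean value theorem a primitive is nondecreasing; if its values at [0] and [1] are
equal it is constant between them, so [P] has infinitely many roots. *)
Lemma pint_gt0 (P : {poly R}) : P != 0 -> (forall x, 0 <= P.[x]) -> 0 < pint P.
Proof.
move=> P0 Pge0; have [Q dQ ->] := pint_primitive P.
have mono x y : x <= y -> Q.[x] <= Q.[y].
  rewrite le_eqVlt => /orP[/eqP ->//|xy].
  have [c _] := polyrcf.poly_mvt Q xy; rewrite dQ => h.
  by rewrite -subr_ge0 h mulr_ge0// subr_ge0 ltW.
rewrite lt_def subr_ge0 mono// andbT subr_eq0; apply/eqP => Q10.
have Qc x : 0 <= x -> x <= 1 -> Q.[x] = Q.[0].
  by move=> x0 x1; apply/eqP; rewrite eq_le -{1}Q10 !mono.
pose S := Q - (Q.[0])%:P.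
have : S = 0.
  apply/eqP; apply: contraT => S0.
  have := max_poly_roots S0 (_ : all (root S) [seq i.+1%:R^-1 | i <- iota 0 (size S)]) _.
  rewrite size_map size_iota ltnn; apply.
    apply/allP => _ /mapP[i _ ->]; rewrite rootE /S !hornerE Qc ?subrr//.
    by rewrite invf_le1// ler1n.
  rewrite map_inj_uniq ?iota_uniq// => i j /invr_inj/eqP.
  by rewrite eqr_nat => /eqP [].
move/eqP; rewrite subr_eq0 => /eqP QC; move: dQ; rewrite QC derivC => /esym/eqP.
by rewrite (negPf P0).
Qed.

Local Notation C := R[i].

Lemma pint_real (P : {poly R}) : pint (map_poly (real_complex R) P) = (pint P)%:C.
Proof.
rewrite /pint size_map_poly rmorph_sum; apply: eq_bigr => i _.
by rewrite coef_map rmorphM/= fmorphV/= rmorph_nat.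
Qed.

(** For [P = A + i B] with real [A] and [B], the integrand is [A ^ 2 + B ^ 2]. *)
Lemma pint_conj_neq0 (P : {poly C}) : P != 0 ->
  pint (P * map_poly (@conjc R) P) != 0.
Proof.
move=> P0; pose A := \poly_(i < size P) (complex.Re P`_i).
pose B := \poly_(i < size P) (complex.Im P`_i).
have cA i : A`_i = complex.Re P`_i.
  by rewrite coef_poly; case: ltnP => // h; rewrite nth_default.
have cB i : B`_i = complex.Im P`_i.
  by rewrite coef_poly; case: ltnP => // h; rewrite nth_default.
have cE (z : C) : (complex.Re z)%:C + 'i * (complex.Im z)%:C = z by rewrite -complexE.
have PE : P = map_poly (real_complex R) A + 'i *: map_poly (real_complex R) B.
  by apply/polyP => i; rewrite coefD coefZ !coef_map/= cE.
have PcE : map_poly (@conjc R) P =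
    map_poly (real_complex R) A - 'i *: map_poly (real_complex R) B.
  apply/polyP => i; rewrite coefB coefZ !coef_map /=.
  by case: (P`_i) => x y; apply/eqP; rewrite eq_complex /= ; apply/andP; split; apply/eqP; ring.
have -> : P * map_poly (@conjc R) P = map_poly (real_complex R) (A ^+ 2 + B ^+ 2).
  have ii : 'i * 'i = -1 :> C by rewrite -expr2 sqr_i.
  rewrite PcE {1}PE rmorphD/= !rmorphXn/= -!mul_polyC.
  have : ('i%:P : {poly C}) ^+ 2 = -1 by rewrite expr2 -polyCM ii polyCN.
  set X := map_poly _ A; set Y := map_poly _ B; set I := 'i%:P => h.
  have -> : (X + I * Y) * (X - I * Y) = X ^+ 2 - I ^+ 2 * Y ^+ 2 by ring.
  by rewrite h; ring.
rewrite pint_real; have : 0 < pint (A ^+ 2 + B ^+ 2).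
  apply: pint_gt0; last by move=> x; rewrite hornerD !horner_exp addr_ge0// sqr_ge0.
  apply/eqP => AB.
  have AB0 x : A.[x] = 0 /\ B.[x] = 0.
    have : (A ^+ 2 + B ^+ 2).[x] = 0 by rewrite AB horner0.
    rewrite hornerD !horner_exp => /eqP.
    rewrite paddr_eq0 ?sqr_ge0// !sqrf_eq0 => /andP[/eqP-> /eqP->].
    by [].
  have pz (Q : {poly R}) : (forall x, Q.[x] = 0) -> Q = 0.
    move=> h; apply/eqP; apply: contraT => Q0.
    have := max_poly_roots Q0 (_ : all (root Q) [seq i%:R | i <- iota 0 (size Q)]) _.
    rewrite size_map size_iota ltnn; apply.
      by apply/allP => x _; rewrite rootE h.
    by rewrite map_inj_uniq ?iota_uniq// => i j /eqP; rewrite eqr_nat => /eqP.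
  move/eqP : P0; apply; rewrite PE.
  have A0 : A = 0 by apply: pz => x; have [] := AB0 x.
  have B0 : B = 0 by apply: pz => x; have [] := AB0 x.
  by rewrite A0 B0 !map_poly0 scaler0 addr0.
by rewrite -ltcR => /gt_eqF/negbT.
Qed.

End RealPolyIntegral.

(** * Splines and their twisted periodizations *)

Section Splines.
Variable F : fieldType.
Hypothesis F0 : forall n : nat, (n.+1%:R : F) != 0.
Variable p : nat.

Let fact_neq0 n : (n`!%:R : F) != 0.
Proof. by have := fact_gt0 n; case: (n`!). Qed.

(** The restriction to [[h, h + 1]], translated to [[0, 1]], of the spline
[\sum_k (-1)^k 'C(p, k) (s - k)_+ ^ r / r!]. *)
Definition spline r h : {poly F} :=
  \sum_(k < h.+1) ((-1) ^+ k * 'C(p, k)%:R / r`!%:R) *: ('X + (h - k)%:R%:P) ^+ r.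

Lemma deriv_spline r h : (spline r.+1 h)^`() = spline r h.
Proof.
rewrite raddf_sum/=; apply: eq_bigr => k _.
rewrite derivZ deriv_exp/= derivD derivX derivC addr0 mul1r.
rewrite -scaler_nat scalerA; congr (_ *: _).
by rewrite factS natrM invfM [r.+1%:R^-1 * _]mulrC mulrA divfK ?F0.
Qed.

Lemma spline_at0 r h :
  (spline r h).[0] = \sum_(k < h.+1) ((-1) ^+ k * 'C(p, k)%:R / r`!%:R) * (h - k)%:R ^+ r.
Proof.
rewrite horner_sum; apply: eq_bigr => k _.
by rewrite hornerZ horner_exp !hornerE.
Qed.

Lemma spline_at1 r h : (0 < r)%N -> (spline r h).[1] = (spline r h.+1).[0].
Proof.
move=> r0; rewrite spline_at0 big_ord_recr/= subnn expr0n gtn_eqF// mulr0 addr0.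
rewrite horner_sum; apply: eq_bigr => k _.
rewrite hornerZ horner_exp !hornerE; congr (_ * _ ^+ r).
by rewrite subSn ?leq_ord// -natr1 addrC.
Qed.

Lemma coef_1BX_exp (n k : nat) : ((1 - 'X : {poly F}) ^+ n)`_k = (-1) ^+ k * 'C(n, k)%:R.
Proof.
have -> : (1 - 'X : {poly F}) ^+ n = ((-1) ^+ n)%:P * ('X + (-1)%:P) ^+ n.
  by rewrite polyC_exp polyCN polyC1 -exprNn opprB.
rewrite coefCM coef_XaddC_exp.
have [kn|nk] := leqP k n; last by rewrite bin_small// mulr0n !mulr0.
rewrite -mulr_natr mulrA -exprD; congr (_ * _).
have -> : (n + (n - k) = k + 2 * (n - k))%N by lia.
by rewrite exprD exprM expr2 mulrNN mulr1 expr1n mulr1.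
Qed.

(** At the right end of the support the sum is complete, hence a [p]-th difference of a
polynomial of degree [r]. *)
Lemma spline_at0p r : (r <= p)%N -> (spline r p).[0] = (r == p)%:R.
Proof.
move=> rp; pose P : {poly F} := (r`!%:R)^-1 *: (p%:R%:P - 'X) ^+ r.
have e : (p%:R%:P - 'X : {poly F}) = - ('X - p%:R%:P) by rewrite opprB.
have sP : (size P <= r.+1)%N.
  rewrite (leq_trans (size_scale_leq _ _))// e exprNn -signr_odd mulr_sign.
  by case: ifP => _; rewrite ?size_polyN size_exp_XsubC.
have := @sum_mul_1BXn _ p 1 1 P _ (leq_trans sP _); rewrite size_poly1 => /(_ isT rp).
rewrite hornerC mul1r spline_at0 => h.
transitivity (1 * (-1) ^+ p * p`!%:R * P`_p).
  rewrite -h; apply: eq_bigr => k _; rewrite coef_1BX_exp /P.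
  rewrite hornerZ horner_exp !hornerE natrB ?leq_ord//.
have [rp'|rp'] := eqVneq r p; last first.
  by rewrite nth_default ?mulr0// (leq_trans sP)// ltn_neqAle rp' rp.
have -> : P = (p`!%:R)^-1 *: (((-1) ^+ p)%:P * ('X + (- p%:R)%:P) ^+ p).
  by rewrite /P rp' polyC_exp [(-1)%:P]polyCN polyC1 -exprNn polyCN opprB.
rewrite coefZ coefCM coef_XaddC_exp.
rewrite subnn expr0 binn mulr1n mulr1 mul1r mulrA mulfK//.
by rewrite -exprMn mulrNN mulr1 expr1n.
Qed.

(** The Zak transform of the spline: its periodization, twisted by [v]. *)
Definition zak r (v : F) : {poly F} := \sum_(h < p) v ^+ h *: spline r h.

Lemma deriv_zak r v : (zak r.+1 v)^`() = zak r v.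
Proof. by rewrite raddf_sum/=; apply: eq_bigr => h _; rewrite derivZ deriv_spline. Qed.

(** The pieces of the spline fit together continuously, and the spline vanishes at both
ends of its support. *)
Lemma zak_quasiperiodic r v : (0 < r)%N -> (r < p)%N -> v * (zak r v).[1] = (zak r v).[0].
Proof.
move=> r0 rp; have S0 : (spline r 0).[0] = 0.
  by rewrite spline_at0 big_ord1 subnn expr0n gtn_eqF// mulr0.
have Sp : (spline r p).[0] = 0 by rewrite spline_at0p ?(ltnW rp)// ltn_eqF.
have p0 : (0 < p)%N by exact: leq_ltn_trans rp.
have e : \sum_(h < p.+1) v ^+ h * (spline r h).[0] = (zak r v).[0].
  rewrite big_ord_recr/= Sp mulr0 addr0 horner_sum.
  by apply: eq_bigr => h _; rewrite hornerZ.
rewrite -e big_ord_recl/= S0 mulr0 add0r horner_sum mulr_sumr.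
by apply: eq_bigr => h _; rewrite hornerZ spline_at1// exprS mulrA.
Qed.

Lemma zak0 v : (0 < p)%N -> zak 0 v = ((1 - v) ^+ p.-1)%:P.
Proof.
move=> p0; have c h : spline 0 h = ((-1) ^+ h * 'C(p.-1, h)%:R)%:P.
  rewrite /spline; under eq_bigr do rewrite expr0 divr1 alg_polyC.
  rewrite -rmorph_sum/=; congr polyC; elim: h => [|h IH].
    by rewrite big_ord1 !bin0.
  rewrite big_ord_recr/= IH -{2}(prednK p0) binS natrD exprS; ring.
rewrite /zak; under eq_bigr do rewrite c -mul_polyC -polyCM.
rewrite -rmorph_sum/=; congr polyC.
rewrite exprBn prednK//; apply: eq_bigr => h _.
by rewrite expr1n mulr1 -mulr_natr; ring.
Qed.

(** The spline of degree [p - 1] is a probability density: it is the derivative of the spline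
of degree [p], which goes from [0] to [1]. *)
Lemma pint_zak1 : (0 < p)%N -> pint (zak p.-1 1) = 1.
Proof.
move=> p0; rewrite -deriv_zak prednK// pint_deriv//.
rewrite !horner_sum -sumrB.
transitivity ((spline p p).[0] - (spline p 0).[0]); last first.
  rewrite spline_at0p// eqxx spline_at0 big_ord1 subnn expr0n gtn_eqF// mulr0.
  by rewrite subr0.
under eq_bigr do rewrite !hornerZ expr1n !mul1r spline_at1//.
by rewrite -(big_mkord xpredT (fun h => (spline p h.+1).[0] - (spline p h).[0])) telescope_sumr.
Qed.

End Splines.

(** * The expansion of the quotient of exponentials *)

Section ExpQuotient.
Variable R : realType.
Local Notation C := R[i].
Implicit Types (v w : C).

Let C0 (n : nat) : (n.+1%:R : C) != 0. Proof. by rewrite pnatr_eq0. Qed.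

(** The power series of [e^x - w]. *)
Definition expB_fps w (k : nat) : C := exp_fps R k - (k == 0%N)%:R * w.

Definition inv_expB w := fps_inv (expB_fps w).

Lemma exp_fps0 : exp_fps R 0 = 1. Proof. by rewrite /exp_fps invr1. Qed.

Lemma expB_fps0 w : expB_fps w 0 = 1 - w.
Proof. by rewrite /expB_fps exp_fps0 mul1r. Qed.

(** [e^x / (e^x - w) = 1 + w / (e^x - w)]. *)
Lemma conv_exp_inv w n : w != 1 ->
  conv (inv_expB w) (exp_fps R) n = (n == 0%N)%:R + w * inv_expB w n.
Proof.
move=> w1; have h0 : expB_fps w 0 != 0 by rewrite expB_fps0 subr_eq0 eq_sym.
rewrite -(conv_inv n h0) convC /conv.
rewrite (eq_bigr (fun i : 'I_n.+1 => expB_fps w i * inv_expB w (n - i)%N +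
    (nat_of_ord i == 0%N)%:R * (w * inv_expB w (n - i)%N))); last first.
  by move=> i _; rewrite /expB_fps; ring.
rewrite big_split/=; congr (_ + _).
rewrite big_ord_recl/= mul1r subn0 big1 ?addr0// => i _.
by rewrite mul0r.
Qed.

(** The coefficients of [e^(x s) / (e^x - w)], polynomials in [s]. *)
Definition apoly w (r : nat) : {poly C} :=
  \sum_(j < r.+1) (inv_expB w (r - j)%N * exp_fps R j) *: 'X^j.

Lemma apoly_at0 w r : (apoly w r).[0] = inv_expB w r.
Proof.
rewrite horner_sum big_ord_recl/= hornerZ hornerXn expr0 mulr1 subn0 exp_fps0 mulr1.
by rewrite big1 ?addr0// => i _; rewrite hornerZ hornerXn expr0n mulr0.
Qed.

Lemma apoly_at1 w r : w != 1 -> (apoly w r).[1] = (r == 0%N)%:R + w * (apoly w r).[0].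
Proof.
move=> w1; rewrite apoly_at0 -conv_exp_inv// convC /conv horner_sum.
by apply: eq_bigr => j _; rewrite hornerZ hornerXn expr1n mulr1 mulrC.
Qed.

Lemma apoly0 w : apoly w 0 = ((1 - w)^-1)%:P.
Proof.
rewrite /apoly big_ord1 expr0 exp_fps0 mulr1 alg_polyC; congr polyC.
by rewrite /inv_expB fps_invE big_ord0 subr0 expB_fps0 mul1r.
Qed.

Lemma deriv_apoly w r : (apoly w r.+1)^`() = apoly w r.
Proof.
rewrite raddf_sum/= big_ord_recl/= derivZ derivC scaler0 add0r.
apply: eq_bigr => j _; rewrite derivZ derivXn -scaler_nat scalerA /= subSS.
congr (_ *: _); rewrite /bump /= add1n /exp_fps factS natrM -mulrA; congr (_ * _).
by rewrite invfM mulrC mulrA mulfV ?mul1r.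
Qed.

(** Both sides obey the recursion of [deriv_zak] and [zak_quasiperiodic]: their difference
is a constant [d] with [v * d = d]. *)
Lemma zak_apoly p v r : (0 < p)%N -> v != 0 -> v != 1 -> (r < p)%N ->
  zak p r v = ((1 - v) ^+ p.-1 * (1 - v^-1)) *: apoly v^-1 r.
Proof.
move=> p0 v0 v1; have w1 : v^-1 != 1 by rewrite invr_eq1.
elim: r => [|r IH] rp.
  rewrite zak0// apoly0 -mul_polyC -polyCM; congr polyC.
  by rewrite mulfK// subr_eq0 eq_sym.
pose D := zak p r.+1 v - ((1 - v) ^+ p.-1 * (1 - v^-1)) *: apoly v^-1 r.+1.
have dD : D^`() = 0.
  by rewrite derivB derivZ deriv_apoly deriv_zak// IH ?subrr// ltnW.
have := deriv_eq0 C0 dD; set d := D`_0 => DE.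
have D1 : v * D.[1] = D.[0].
  rewrite /D !hornerD !hornerN !hornerZ mulrBr zak_quasiperiodic//.
  by rewrite apoly_at1// add0r; field.
move: D1; rewrite DE !hornerC => /eqP; rewrite -subr_eq0 -{2}[d]mul1r -mulrBl mulf_eq0.
rewrite subr_eq0 (negPf v1)/= => /eqP d0; move: DE; rewrite d0 => /eqP.
by rewrite subr_eq0 => /eqP.
Qed.

(** Integration by parts lowers the degree of one factor and raises that of the other, with
no boundary terms since [v * w = 1]; when the second factor is constant, only the
boundary values of a primitive of the first remain. *)
Lemma pint_apoly v w r : v != 1 -> w != 1 -> v * w = 1 ->
  pint (apoly w r * apoly v r) = (-1) ^+ r * ((w - 1) / (1 - v)) * inv_expB w (2 * r + 1).
Proof.
move=> v1 w1 vw.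
have step i j : pint (apoly w i * apoly v j.+1) = - pint (apoly w i.+1 * apoly v j).
  rewrite -(deriv_apoly w i) pint_by_parts ?deriv_apoly// !apoly_at1// !add0r.
  by rewrite mulrACA [w * v]mulrC vw mul1r.
have steps k i j : pint (apoly w i * apoly v (j + k)) = (-1) ^+ k * pint (apoly w (i + k) * apoly v j).
  elim: k i j => [|k IH] i j; first by rewrite !addn0 mul1r.
  by rewrite addnS step IH addSnnS exprS mulN1r mulNr.
rewrite -{2}[r]add0n steps apoly0 [_ * _%:P]mulrC mul_polyC pintZ -deriv_apoly pint_deriv//.
rewrite apoly_at1// add0r apoly_at0 addnn -mul2n addn1; ring.
Qed.

End ExpQuotient.

(** * The algebra of power series *)

Section ConvAlgebra.
Variable R : realType.
Local Notation C := R[i].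
Implicit Types u v w : nat -> C.

Definition fps1 (k : nat) : C := (k == 0%N)%:R.

Lemma conv_comm u v : conv u v = conv v u.
Proof. by apply/funext => k; exact: convC. Qed.

Lemma conv_assoc u v w : conv u (conv v w) = conv (conv u v) w.
Proof. by apply/funext => k; exact: convA. Qed.

Lemma conv1 u : conv u fps1 = u.
Proof.
apply/funext => k; rewrite /conv big_ord_recr/= subnn mulr1 big1 ?add0r// => i _.
by rewrite /fps1 subn_eq0 leqNgt ltn_ord mulr0.
Qed.

Lemma conv_invr u : u 0%N != 0 -> conv u (fps_inv u) = fps1.
Proof. by move=> u0; apply/funext => k; exact: conv_inv. Qed.

Lemma convZr c u v : conv u (fun k => c * v k) = fun k => c * conv u v k.
Proof.
by apply/funext => k; rewrite /conv mulr_sumr; apply: eq_bigr => i _; ring.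
Qed.

Lemma convBr u v w : conv u (fun k => v k - w k) = fun k => conv u v k - conv u w k.
Proof.
by apply/funext => k; rewrite /conv -sumrB; apply: eq_bigr => i _; rewrite mulrBr.
Qed.

Lemma conv_ACA u v w t : conv (conv u v) (conv w t) = conv (conv u w) (conv v t).
Proof.
rewrite -conv_assoc -[RHS]conv_assoc; congr conv.
by rewrite !conv_assoc [conv v w]conv_comm.
Qed.

(** The coefficients of [x |-> f (- x)]. *)
Definition alt u (k : nat) : C := (-1) ^+ k * u k.

Lemma conv_alt u v : conv (alt u) (alt v) = alt (conv u v).
Proof.
apply/funext => k; rewrite /conv /alt mulr_sumr; apply: eq_bigr => i _.
by rewrite mulrACA -exprD subnKC// -ltnS.
Qed.

Lemma fps_uniq u v (f : C -> C) : fps_at u f -> fps_at v f -> u = v.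
Proof.
move=> [M [r [r0 bu cu]]] [N [s [s0 bv cv]]].
pose t := Num.max r s.
have t0 : 0 < t by rewrite lt_max r0.
have bd : gbound (fun k => u k - v k) (M + N) t.
  move=> k; rewrite (le_trans (cnormD _ _))// cnormN mulrDl lerD//.
    by apply: (gbound_le _ (lexx _) _ bu); rewrite ?le_max ?lexx// ltW.
  by apply: (gbound_le _ (lexx _) _ bv); rewrite ?le_max ?lexx ?orbT// ltW.
apply/funext => k; apply/eqP; rewrite -subr_eq0; apply/eqP.
apply: (fps_zero t0 bd) => e e0.
pose x := Num.min (e / 2) (t^-1 / 2).
have x0 : 0 < x by rewrite lt_min !divr_gt0 ?invr_gt0.
have xe : x < e by rewrite gt_min; apply/orP; left; lra.
have xt : t * x < 1.
  rewrite -(@mulfV _ t) ?gt_eqF// ltr_pM2l// gt_min; apply/orP; right.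
  by rewrite ltr_pdivrMr// ltr_pMr ?invr_gt0//; lra.
have nx : cnorm (x%:C : C) = x by rewrite cnorm_real gtr0_norm.
exists x%:C; rewrite nx; split => //; first by rewrite eq_complex /= negb_and gt_eqF.
have rx : r * cnorm (x%:C : C) < 1.
  by rewrite nx (le_lt_trans _ xt)// ler_wpM2r ?(ltW x0)// le_max lexx.
have sx : s * cnorm (x%:C : C) < 1.
  by rewrite nx (le_lt_trans _ xt)// ler_wpM2r ?(ltW x0)// le_max lexx orbT.
pose proof (cvgC_B (cu _ rx) (cv _ sx)) as h; rewrite subrr in h.
apply: near_cvgC h; apply: nearW => n.
by rewrite /psum -sumrB; apply: eq_bigr => j _; rewrite mulrBl.
Qed.

Lemma fps_scal (c : C) u f : fps_at u f -> fps_at (fun k => c * u k) (fun z => c * f z).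
Proof.
move=> [M [r [r0 bu cu]]]; exists (cnorm c * M), r; split => //.
  by move=> k; rewrite cnormM -mulrA ler_wpM2l ?cnorm_ge0.
move=> z z1; apply: near_cvgC (cvgC_M (cvgC_cst c) (cu z z1)); apply: nearW => n.
by rewrite /psum mulr_sumr; apply: eq_bigr => j _; rewrite mulrA.
Qed.

Lemma fps_alt u f : fps_at u f -> fps_at (alt u) (fun z => f (- z)).
Proof.
move=> /(fps_scale (-1)); congr fps_at; first by apply/funext => k; rewrite mulrC.
by apply/funext => z; rewrite mulN1r.
Qed.

End ConvAlgebra.

(** * The expansion of the hyperbolic quotient *)

Section HyperbolicQuotient.
Variable R : realType.
Local Notation C := R[i].
Variable omega : R.
Hypothesis cos1 : cos omega != 1.

Let c : C := (cos omega)%:C.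
Let w : C := cos omega +i* sin omega.
Let v : C := cos omega +i* - sin omega.

Definition sinh_fps (k : nat) : C := 2^-1 * (exp_fps R k - alt (exp_fps R) k).

Definition coshB_fps (k : nat) : C :=
  2^-1 * (exp_fps R k + alt (exp_fps R) k) - fps1 R k * c.

Definition sinh_coshB_fps := conv sinh_fps (fps_inv coshB_fps).

Let wv : w * v = 1.
Proof.
apply/eqP; rewrite eq_complex /=; apply/andP; split; apply/eqP; last by ring.
by rewrite -[RHS](cos2Dsin2 omega); ring.
Qed.

Let w_add_v : w + v = 2 * c.
Proof.
by rewrite mulr2n mulrDl mul1r; apply/eqP; rewrite eq_complex /= subrr addr0 !eqxx.
Qed.

Let c1 : 1 - c != 0.
Proof. by rewrite subr_eq0 eq_sym eq_complex /= negb_and cos1. Qed.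

Let w1 : w != 1. Proof. by rewrite eq_complex /= negb_and cos1. Qed.

Lemma coshB_fps0 : coshB_fps 0 = 1 - c.
Proof. by rewrite /coshB_fps /alt /fps1 exp_fps0 expr0 !mul1r -mulr2n mulVf. Qed.

Lemma fps_sinh : fps_at sinh_fps (fun z => 2^-1 * (cexp z - cexp (- z))).
Proof.
have h := fps_scal (2^-1) (fps_add (fps_exp R) (fps_scal (-1) (fps_alt (fps_exp R)))).
move: h; congr fps_at; apply/funext => k; rewrite /sinh_fps; congr (_ * (_ + _)).
  by rewrite mulN1r.
by rewrite mulN1r.
Qed.

Lemma fps_coshB : fps_at coshB_fps (fun z => 2^-1 * (cexp z + cexp (- z)) - c).
Proof.
have h := fps_add (fps_scal (2^-1) (fps_add (fps_exp R) (fps_alt (fps_exp R)))) (fps_cst (- c)).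
move: h; congr fps_at; apply/funext => k; rewrite /coshB_fps; congr (_ + _).
by rewrite /fps1 mulrN.
Qed.

(** As [w + w^-1 = 2 cos omega], one has
[(e^x - w) (e^(- x) - w) = - 2 w (cosh x - cos omega)], and the difference of the two
factors is [2 sinh x]. *)
Lemma sinh_coshB_expB k : sinh_coshB_fps k = w * (inv_expB w k - alt (inv_expB w) k).
Proof.
pose E := expB_fps w; pose b := inv_expB w.
have E0 : E 0%N != 0 by rewrite /E expB_fps0 subr_eq0 eq_sym.
have G0 : coshB_fps 0 != 0 by rewrite coshB_fps0.
have bE : conv b E = fps1 R by rewrite conv_comm conv_invr.
have bE' : conv (alt b) (alt E) = fps1 R.
  by rewrite conv_alt bE; apply/funext => -[|j]; rewrite /alt /fps1 ?mul1r ?mulr0.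
have fE : fps_at E (fun z => cexp z - w).
  have := fps_add (fps_exp R) (fps_cst (- w)); congr fps_at; apply/funext => j.
  by rewrite /E /expB_fps mulrN.
have EE' : conv E (alt E) = fun j => (- (2 * w)) * coshB_fps j.
  apply: (@fps_uniq _ _ _ (fun z => (cexp z - w) * (cexp (- z) - w))).
    exact: (fps_mul fE (fps_alt fE)).
  have := fps_scal (- (2 * w)) fps_coshB; congr fps_at; apply/funext => z.
  have e1 : cexp z * cexp (- z) = 1 by rewrite -cexpD subrr cexp0.
  transitivity (1 + w * w - w * (cexp z + cexp (- z))); last by rewrite -e1; ring.
  have -> : 1 + w * w = w * (2 * c) by rewrite -w_add_v mulrDr wv; ring.
  by field.
pose g j := b j - alt b j.
have gE : g = conv (conv b (alt b)) (fun j => - 2 * sinh_fps j).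
  have -> : (fun j => - 2 * sinh_fps j) = fun j => alt E j - E j.
    apply/funext => j; rewrite /sinh_fps /E /expB_fps /alt.
    by case: j => [|j] /=; rewrite ?expr0; field.
  rewrite convBr -conv_assoc bE' conv1.
  by rewrite [conv b _]conv_comm -conv_assoc bE conv1.
have gG : conv (fun j => w * g j) coshB_fps = sinh_fps.
  rewrite conv_comm convZr gE.
  transitivity (conv (conv b (alt b)) (conv sinh_fps (conv E (alt E)))).
    rewrite EE' (convZr (-2)) (convZr (- (2 * w)) sinh_fps) convZr convZr.
    rewrite conv_comm -conv_assoc.
    by apply/funext => j; ring.
  by rewrite [conv sinh_fps _]conv_comm conv_assoc conv_ACA bE bE' conv1 conv_comm conv1.
rewrite /sinh_coshB_fps -gG -conv_assoc conv_invr// conv1.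
by [].
Qed.

Lemma sinh_coshB_odd k : sinh_coshB_fps (2 * k + 1) = 2 * w * inv_expB w (2 * k + 1).
Proof.
rewrite sinh_coshB_expB /alt exprD exprM expr2 mulrNN mulr1 expr1n; ring.
Qed.

Lemma sinh_coshB_even k : sinh_coshB_fps (2 * k) = 0.
Proof. by rewrite sinh_coshB_expB /alt exprM expr2 mulrNN mulr1 expr1n mul1r subrr mulr0. Qed.

Lemma near_sinh_coshB : \forall x \near (0 : R),
  cvgC \oo (psum sinh_coshB_fps x%:C) (sinh x / (cosh x - cos omega))%:C.
Proof.
have G0 : coshB_fps 0 != 0 by rewrite coshB_fps0.
have [M [r [r0 _ cu]]] := fps_mul fps_sinh (fps_inv_at fps_coshB G0).
have r0' : 0 < r^-1 by rewrite invr_gt0.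
apply/nbhs_ballP; exists r^-1 => //= x; rewrite /ball/= sub0r normrN => xr.
have : r * cnorm (x%:C : C) < 1.
  by rewrite cnorm_real -(@mulfV _ r) ?gt_eqF// ltr_pM2l.
move=> /cu; congr (cvgC _ _ _).
rewrite -rmorphN !cexp_real /sinh /cosh rmorphM/= fmorphV/= rmorphM rmorphB/= rmorphB/= rmorphM rmorphD/=.
by rewrite !fmorphV/= !rmorph_nat ![2^-1 * _]mulrC.
Qed.

Lemma cvg_psum_real (u : nat -> C) (x l : R) :
  cvgC \oo (psum u x%:C) l%:C ->
  \sum_(0 <= k < n) complex.Re (u k) * x ^+ k @[n --> \oo] --> l.
Proof.
move=> /cvgC_Re /=; apply: cvg_trans; apply: near_eq_cvg; apply: nearW => n.
rewrite /psum; elim: n => [|n IH]; first by rewrite !big_geq.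
rewrite !big_nat_recr//= -IH -rmorphXn/=.
by case: (u n) => a b; case: (\sum_(_ <= _ < _) _) => a' b' /=; rewrite mulr0 subr0.
Qed.

(** Complexifies the difference, in order to apply [fps_zero]. *)
Lemma is_pseries_uniq (f : R -> R) (s t : nat -> R) : is_pseries f s -> is_pseries f t -> s = t.
Proof.
rewrite /is_pseries => fs ft; pose proof (filterI fs ft) as h0.
move/nbhs_ballP : h0 => [e /= e0 h].
pose d k : C := (s k - t k)%:C.
have hd (x : R) : `|x| < e -> cvgC \oo (psum d x%:C) 0.
  move=> xe; have hb : ball (0 : R) e x by rewrite /ball/= sub0r normrN.
  have [h1 h2] := h x hb.
  have h3 : \sum_(0 <= k < n) s k * x ^+ k - \sum_(0 <= k < n) t k * x ^+ k @[n --> \oo] --> (0 : R).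
    by rewrite -[X in _ --> X](subrr (f x)); apply: cvgB; [exact: h1|exact: h2].
  apply: near_cvgC (iffRL (cvgC_real _ _) h3); apply: nearW => n.
  rewrite -sumrB rmorph_sum; apply: eq_bigr => k _.
  by rewrite /d -mulrBl rmorphM rmorphXn.
have e20 : 0 < e / 2 by rewrite divr_gt0.
have xc (x : R) : 0 < x -> x%:C != 0 :> C by move=> x0; rewrite eq_complex /= negb_and gt_eqF.
have [|M bM] := cvg_psum_bound (xc _ e20) (hd (e / 2) _).
  by rewrite gtr0_norm//; lra.
have d0 : forall k, d k = 0.
  apply: (fps_zero _ bM); first by rewrite invr_gt0 cnorm_gt0 xc.
  move=> r r0; pose x := Num.min (r / 2) (e / 2).
  have x0 : 0 < x by rewrite lt_min e20 divr_gt0.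
  exists x%:C; rewrite xc// cnorm_real gtr0_norm//; split => //.
    by rewrite gt_min; apply/orP; left; lra.
  by apply: hd; rewrite gtr0_norm// gt_min; apply/orP; right; lra.
apply/funext => k; have := d0 k; rewrite /d => -[] /eqP.
by rewrite subr_eq0 => /eqP.
Qed.

Lemma pseries_coefE : pseries_coef (fun x => sinh x / (cosh x - cos omega)) =
  fun k => complex.Re (sinh_coshB_fps k).
Proof.
have h : is_pseries (fun x => sinh x / (cosh x - cos omega)) (fun k => complex.Re (sinh_coshB_fps k)).
  by apply: filterS near_sinh_coshB => x /cvg_psum_real.
by apply: xget_unique => // y hy; exact: is_pseries_uniq hy h.
Qed.

(** The coefficients and their real parts expand the same real function. *)
Lemma sinh_coshB_real k : sinh_coshB_fps k = (complex.Re (sinh_coshB_fps k))%:C.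
Proof.
have G0 : coshB_fps 0 != 0 by rewrite coshB_fps0.
have [M [r [r0 bu _]]] := fps_mul fps_sinh (fps_inv_at fps_coshB G0).
pose d j := sinh_coshB_fps j - (complex.Re (sinh_coshB_fps j))%:C.
have bd : gbound d (2 * M) r.
  move=> j; rewrite (le_trans (cnormD _ _))// cnormN cnorm_real.
  by have := bu j; have := Re_le_cnorm (sinh_coshB_fps j); rewrite -/sinh_coshB_fps; lra.
apply/eqP; rewrite -subr_eq0 -/(d k); apply/eqP; apply: (fps_zero r0 bd) => e e0.
have := near_sinh_coshB => /nbhs_ballP[e1 /= e10 h].
pose x := Num.min (e / 2) (e1 / 2).
have x0 : 0 < x by rewrite lt_min !divr_gt0.
exists x%:C; rewrite cnorm_real gtr0_norm//; split.
- by rewrite eq_complex /= negb_and gt_eqF.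
- by rewrite gt_min; apply/orP; left; lra.
have hx : cvgC \oo (psum sinh_coshB_fps x%:C) (sinh x / (cosh x - cos omega))%:C.
  apply: h; rewrite /ball/= sub0r normrN gtr0_norm// gt_min; apply/orP; right; lra.
pose proof (cvgC_B hx (iffRL (cvgC_real _ _) (cvg_psum_real hx))) as h3.
rewrite subrr in h3; apply: near_cvgC h3; apply: nearW => n.
rewrite rmorph_sum -sumrB; apply: eq_bigr => j _.
by rewrite /d mulrBl rmorphM rmorphXn.
Qed.

Lemma c_coefE k : c_coef k omega = complex.Re (sinh_coshB_fps (2 * k + 1)).
Proof. by rewrite /c_coef pseries_coefE. Qed.

(** The even coefficients vanish, so the partial sums of even order of the whole series are
those of the odd part. *)
Lemma c_coef_series : \forall x \near (0 : R),
  \sum_(0 <= k < n) c_coef k omega * x ^+ (2 * k + 1) @[n --> \oo]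
    --> sinh x / (cosh x - cos omega).
Proof.
apply: filterS near_sinh_coshB => x /cvg_psum_real h.
have h2 : \sum_(0 <= k < 2 * n) complex.Re (sinh_coshB_fps k) * x ^+ k @[n --> \oo]
    --> sinh x / (cosh x - cos omega).
  exact: (@cvg_comp _ _ _ (fun n => 2 * n)%N (fun n => \sum_(0 <= k < n) complex.Re (sinh_coshB_fps k) * x ^+ k) \oo \oo _ (@cvg_mulnl 2 isT) h).
apply: cvg_trans h2; apply: near_eq_cvg; apply: nearW => n.
elim: n => [|n IH]; first by rewrite !big_geq.
have -> : (2 * n.+1 = (2 * n).+2)%N by lia.
rewrite !big_nat_recr//= IH c_coefE sinh_coshB_even mul0r addr0.
by rewrite addn1.
Qed.

Let conv_GS k : conv sinh_coshB_fps coshB_fps k = sinh_fps k.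
Proof.
have G0 : coshB_fps 0 != 0 by rewrite coshB_fps0.
by rewrite /sinh_coshB_fps -conv_assoc [conv (fps_inv _) _]conv_comm conv_invr// conv1.
Qed.

Let odd_even (k : nat) : sinh_coshB_fps (2 * k + 1) = (c_coef k omega)%:C.
Proof. by rewrite c_coefE -sinh_coshB_real. Qed.

(** Comparison of the coefficients of [x], [x ^ 3] and [x ^ 5] in the product of the quotient
with [cosh x - cos omega]. *)
Lemma c_coef_values : [/\ c_coef 0 omega = 1 / (1 - cos omega),
    c_coef 1 omega = - ((2 + cos omega) / (6 * (1 - cos omega) ^+ 2))
  & c_coef 2 omega = (33 + 26 * cos omega + cos (2 * omega)) /
                             (240 * (1 - cos omega) ^+ 3)].
Proof.
have d0 : 1 - cos omega != 0 by rewrite subr_eq0 eq_sym.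
have u0 : sinh_coshB_fps 0 = 0 by exact: (sinh_coshB_even 0).
have u2 : sinh_coshB_fps 2 = 0 by exact: (sinh_coshB_even 1).
have u4 : sinh_coshB_fps 4 = 0 by exact: (sinh_coshB_even 2).
have u1 : sinh_coshB_fps 1 = (c_coef 0 omega)%:C by exact: (odd_even 0).
have u3 : sinh_coshB_fps 3 = (c_coef 1 omega)%:C by exact: (odd_even 1).
have u5 : sinh_coshB_fps 5 = (c_coef 2 omega)%:C by exact: (odd_even 2).
have G2 : coshB_fps 2 = (2^-1)%:C.
  rewrite /coshB_fps /alt /fps1 /exp_fps /= fmorphV rmorph_nat /=.
  by rewrite !factS fact0; field.
have G4 : coshB_fps 4 = (24^-1)%:C.
  rewrite /coshB_fps /alt /fps1 /exp_fps /= fmorphV rmorph_nat /=.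
  by rewrite !factS fact0; field.
have G0 : coshB_fps 0 = (1 - cos omega)%:C by rewrite coshB_fps0 rmorphB rmorph1.
have S1 : sinh_fps 1 = 1%:C.
  by rewrite /sinh_fps /alt /exp_fps /= factS fact0; field.
have S3 : sinh_fps 3 = (6^-1)%:C.
  by rewrite /sinh_fps /alt /exp_fps /= fmorphV rmorph_nat !factS fact0; field.
have S5 : sinh_fps 5 = (120^-1)%:C.
  by rewrite /sinh_fps /alt /exp_fps /= fmorphV rmorph_nat !factS fact0; field.
have e1 : c_coef 0 omega * (1 - cos omega) = 1.
  apply: (@complexI R); have := conv_GS 1; rewrite /conv 2!big_ord_recl big_ord0 /=.
  by rewrite /bump /= u0 u1 G0 S1 mul0r add0r addr0 -rmorphM.
have e3 : c_coef 0 omega * 2^-1 + c_coef 1 omega * (1 - cos omega) = 6^-1.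
  apply: (@complexI R); have := conv_GS 3; rewrite /conv 4!big_ord_recl big_ord0 /=.
  by rewrite /bump /= u0 u1 u2 u3 G0 G2 S3 !mul0r !add0r addr0 -!rmorphM -rmorphD.
have e5 : c_coef 0 omega * 24^-1 + c_coef 1 omega * 2^-1 + c_coef 2 omega * (1 - cos omega) = 120^-1.
  apply: (@complexI R); have := conv_GS 5; rewrite /conv 6!big_ord_recl big_ord0 /=.
  by rewrite /bump /= u0 u1 u2 u3 u4 u5 G0 G2 G4 S5 !mul0r !add0r addr0 addrA -!rmorphM -!rmorphD.
have c0E : c_coef 0 omega = 1 / (1 - cos omega).
  by apply: (mulIf d0); rewrite e1 mul1r mulVf.
have c1E : c_coef 1 omega = - ((2 + cos omega) / (6 * (1 - cos omega) ^+ 2)).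
  apply: (mulIf d0); have -> : c_coef 1 omega * (1 - cos omega) = 6^-1 - c_coef 0 omega * 2^-1.
    by rewrite -e3; ring.
  by rewrite c0E; field.
split => //.
apply: (mulIf d0); have -> : c_coef 2 omega * (1 - cos omega) =
  120^-1 - (c_coef 0 omega * 24^-1 + c_coef 1 omega * 2^-1) by rewrite -e5; ring.
have -> : cos (2 * omega) = 2 * cos omega ^+ 2 - 1.
  by rewrite mulrC mulr_natr cos_mulr2n; ring.
by rewrite c0E c1E; field.
Qed.

End HyperbolicQuotient.

(** * The spectrum of the spline *)

Section SplineSpectrum.
Variable R : realType.
Local Notation C := R[i].
Implicit Types (v : C) (omega : R).

(** For [|v| = 1] this is [\int_0^1 |zak p r v|^2], see [conj_zak]. *)
Definition spline_spectrum p r v : C := pint (zak p r v * zak p r v^-1).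

Let C0 (n : nat) : (n.+1%:R : C) != 0. Proof. by rewrite pnatr_eq0. Qed.

Lemma conj_zak p r v : v^*%C = v^-1 -> map_poly (@conjc R) (zak p r v) = zak p r v^-1.
Proof.
move=> cv; rewrite /zak rmorph_sum/=; apply: eq_bigr => h _.
rewrite linearZ/= rmorphXn/= cv; congr (_ *: _).
rewrite rmorph_sum/=; apply: eq_bigr => k _.
have -> : (-1) ^+ k * 'C(p, k)%:R / r`!%:R = ((-1) ^+ k * 'C(p, k)%:R / r`!%:R)%:C :> C.
  by rewrite !rmorphM/= fmorphV/= rmorphXn/= rmorphN1 !rmorph_nat.
rewrite map_polyZ; congr (_ *: _); first exact: conjc_real.
by rewrite rmorphXn/= rmorphD/= map_polyX map_polyC/= rmorph_nat.
Qed.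

(** The leading coefficient of [zak p r v] is not [0] when [v <> 1], by [zak_apoly]. *)
Lemma spline_spectrum_neq0 p r v : (0 < p)%N -> (r < p)%N -> v != 0 ->
  v^*%C = v^-1 -> (v = 1 -> r = p.-1) -> spline_spectrum p r v != 0.
Proof.
move=> p0 rp v0 cv v1r; rewrite /spline_spectrum -conj_zak// pint_conj_neq0//.
have [v1|v1] := eqVneq v 1.
  apply/eqP => z0; have : pint (zak p r v) = 1 by rewrite (v1r v1) v1 pint_zak1.
  by rewrite z0 pint0 => /eqP; rewrite eq_sym oner_eq0.
have w1 : v^-1 != 1 by rewrite invr_eq1.
rewrite zak_apoly// scaler_eq0 negb_or mulf_neq0 ?expf_neq0 ?subr_eq0 1?eq_sym//=.
apply/eqP => /(congr1 (fun P : {poly C} => P`_r)); rewrite coef0 coef_sum (bigD1 ord_max)//=.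
rewrite coefZ coefXn eqxx mulr1 subnn big1 ?addr0.
  move/esym/eqP; rewrite mulf_eq0 /exp_fps invr_eq0 pnatr_eq0 -leqn0 leqNgt fact_gt0 orbF.
  by rewrite /inv_expB fps_invE big_ord0 subr0 mul1r invr_eq0 expB_fps0 subr_eq0 eq_sym (negPf w1).
move=> j jr; rewrite coefZ coefXn; have /negPf -> : r != j.
  by apply: contra jr => /eqP rj; apply/eqP/val_inj.
by rewrite mulr0.
Qed.

Lemma spline_spectrumE p r omega : (0 < p)%N -> (r < p)%N -> cos omega != 1 ->
  spline_spectrum p r (cos omega +i* - sin omega) =
  ((-1) ^+ r * c_coef r omega * 2 ^+ p.-1 * (1 - cos omega) ^+ p)%:C.
Proof.
move=> p0 rp cos1; set v : C := _ +i* _.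
pose w : C := cos omega +i* sin omega.
have wv : w * v = 1.
  apply/eqP; rewrite eq_complex /=; apply/andP; split; apply/eqP; last by ring.
  by rewrite -[RHS](cos2Dsin2 omega); ring.
have wpv : w + v = 2 * (cos omega)%:C.
  by rewrite mulr2n mulrDl mul1r; apply/eqP; rewrite eq_complex /= subrr addr0 !eqxx.
have v0 : v != 0 by apply: contra_eq_neq wv => ->; rewrite mulr0 eq_sym oner_eq0.
have w0 : w != 0 by apply: contra_eq_neq wv => ->; rewrite mul0r eq_sym oner_eq0.
have v1 : v != 1 by rewrite eq_complex /= negb_and cos1.
have w1 : w != 1 by rewrite eq_complex /= negb_and cos1.
have vI : v^-1 = w by rewrite -[LHS]mul1r -wv mulfK.
have wI : w^-1 = v by rewrite -vI invrK.
rewrite /spline_spectrum zak_apoly// vI zak_apoly ?wI// -scalerAl -scalerAr !pintZ.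
rewrite pint_apoly ?wv//; last by rewrite mulrC.
have o := sinh_coshB_odd cos1 r; rewrite -/w in o.
have cE : (c_coef r omega)%:C = 2 * w * inv_expB w (2 * r + 1).
  by rewrite -o c_coefE// -sinh_coshB_real.
have pE : (2 ^+ p.-1 * (1 - cos omega) ^+ p)%:C = ((1 - v) * (1 - w)) ^+ p.-1 * (1 - (cos omega)%:C).
  have -> : (1 - v) * (1 - w) = 2 * (1 - (cos omega)%:C).
    have -> : (1 - v) * (1 - w) = 1 + w * v - (w + v) by ring.
    by rewrite wv wpv; ring.
  rewrite -{2}(prednK p0) rmorphM !rmorphXn rmorphB rmorph1 rmorph_nat exprMn exprSr mulrA.
  by [].
have -> : ((-1) ^+ r * c_coef r omega * 2 ^+ p.-1 * (1 - cos omega) ^+ p)%:C =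
    (-1) ^+ r * (c_coef r omega)%:C * (2 ^+ p.-1 * (1 - cos omega) ^+ p)%:C.
  by rewrite -mulrA [LHS]rmorphM rmorphM/= rmorphXn/= rmorphN1.
rewrite pE cE exprMn.
have e : 2 * w * (1 - (cos omega)%:C) = (1 - w) * (w - 1).
  have -> : 2 * w * (1 - (cos omega)%:C) = 2 * w - w * (w + v) by rewrite wpv; ring.
  by rewrite mulrDr wv; ring.
transitivity ((-1) ^+ r * inv_expB w (2 * r + 1) * ((1 - v) ^+ p.-1 * (1 - w) ^+ p.-1) *
  ((1 - w) * (w - 1))); last by rewrite -e; ring.
by field; rewrite subr_eq0 eq_sym.
Qed.

End SplineSpectrum.

(** * Square integrable functions *)

Section SquareIntegrable.
Context {d : measure_display} {T : measurableType d} {R : realType}.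
Variable mu : {measure set T -> \bar R}.
Implicit Types f g h : T -> R.

Definition sq_integrable f : Prop :=
  measurable_fun setT f /\ mu.-integrable setT (EFin \o (fun x => f x ^+ 2)).

(** The inner product of the square integrable functions; for a probability it gives the
second moments. *)
Definition ip f g : R := \int[mu]_x (f x * g x).

Lemma sq_integrable_mul f g : sq_integrable f -> sq_integrable g ->
  mu.-integrable setT (EFin \o (fun x => f x * g x)).
Proof.
move=> [mf intf] [mg intg].
apply: (le_integrable measurableT _ _ (integrableD measurableT intf intg)).
  by apply/measurable_EFinP; exact: measurable_funM.
move=> x _ /=; rewrite lee_fin normrM [leRHS]ger0_norm ?addr_ge0 ?sqr_ge0//.
rewrite -(real_normK (num_real (f x))) -(real_normK (num_real (g x))).
have := sqr_ge0 (`|f x| - `|g x|); have := sqr_ge0 (`|f x| + `|g x|); nra.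
Qed.

Lemma sq_integrableD f g : sq_integrable f -> sq_integrable g ->
  sq_integrable (fun x => f x + g x).
Proof.
move=> sf sg; have [mf intf] := sf; have [mg intg] := sg.
split; first exact: measurable_funD.
pose F := EFin \o (fun x => f x ^+ 2); pose G := EFin \o (fun x => g x ^+ 2).
pose H := EFin \o (fun x => f x * g x).
have -> : EFin \o (fun x => (f x + g x) ^+ 2) = (F \+ (G \+ (H \+ H)))%E.
  by apply/funext => x /=; rewrite -!EFinD; congr EFin; ring.
have iH : mu.-integrable setT H by exact: sq_integrable_mul.
by apply: integrableD => //; apply: integrableD => //; apply: integrableD.
Qed.

Lemma sq_integrableZ (c : R) f : sq_integrable f -> sq_integrable (fun x => c * f x).
Proof.
move=> [mf intf]; split; first exact: measurable_funM.
pose F := EFin \o (fun x => f x ^+ 2).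
have -> : EFin \o (fun x => (c * f x) ^+ 2) = (fun x => ((c ^+ 2)%:E * F x)%E).
  by apply/funext => x /=; rewrite -EFinM exprMn.
exact: integrableZl.
Qed.

Lemma sq_integrableN f : sq_integrable f -> sq_integrable (fun x => - f x).
Proof.
move=> /(sq_integrableZ (-1)); congr sq_integrable; apply/funext => x.
by rewrite mulN1r.
Qed.

Lemma sq_integrableB f g : sq_integrable f -> sq_integrable g ->
  sq_integrable (fun x => f x - g x).
Proof. by move=> sf sg; exact: sq_integrableD sf (sq_integrableN sg). Qed.

Lemma sq_integrable0 : sq_integrable (fun=> 0).
Proof.
split; first exact: measurable_cst.
have -> : EFin \o (fun=> 0 ^+ 2) = cst 0%E :> (T -> \bar R).
  by apply/funext => x /=; rewrite expr0n.
exact: integrable0.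
Qed.

Lemma sq_integrable_sum (I : Type) (s : seq I) (F : I -> T -> R) :
  (forall i, sq_integrable (F i)) -> sq_integrable (fun x => \sum_(i <- s) F i x).
Proof.
move=> h; elim: s => [|i s IH].
  by under eq_fun do rewrite big_nil; exact: sq_integrable0.
by under eq_fun do rewrite big_cons; exact: sq_integrableD.
Qed.

Lemma ipC f g : ip f g = ip g f.
Proof. by apply: eq_Rintegral => x _; rewrite mulrC. Qed.

Lemma ipDl f g h : sq_integrable f -> sq_integrable g -> sq_integrable h ->
  ip (fun x => f x + g x) h = ip f h + ip g h.
Proof.
move=> sf sg sh; rewrite /ip -RintegralD//; try exact: sq_integrable_mul.
by apply: eq_Rintegral => x _; rewrite mulrDl.
Qed.

Lemma ipZl (c : R) f h : sq_integrable f -> sq_integrable h ->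
  ip (fun x => c * f x) h = c * ip f h.
Proof.
move=> sf sh; rewrite /ip -RintegralZl//; last exact: sq_integrable_mul.
by apply: eq_Rintegral => x _; rewrite mulrA.
Qed.

Lemma ipNl f h : sq_integrable f -> sq_integrable h -> ip (fun x => - f x) h = - ip f h.
Proof.
move=> sf sh; rewrite -mulN1r -ipZl//; congr ip; apply/funext => x.
by rewrite mulN1r.
Qed.

Lemma ipBl f g h : sq_integrable f -> sq_integrable g -> sq_integrable h ->
  ip (fun x => f x - g x) h = ip f h - ip g h.
Proof. by move=> sf sg sh; rewrite ipDl ?ipNl//; exact: sq_integrableN. Qed.

Lemma ipDr f g h : sq_integrable f -> sq_integrable g -> sq_integrable h ->
  ip h (fun x => f x + g x) = ip h f + ip h g.
Proof. by move=> sf sg sh; rewrite ipC ipDl// ![ip _ h]ipC. Qed.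

Lemma ipBr f g h : sq_integrable f -> sq_integrable g -> sq_integrable h ->
  ip h (fun x => f x - g x) = ip h f - ip h g.
Proof. by move=> sf sg sh; rewrite ipC ipBl// ![ip _ h]ipC. Qed.

Lemma ipZr (c : R) f h : sq_integrable f -> sq_integrable h ->
  ip h (fun x => c * f x) = c * ip h f.
Proof. by move=> sf sh; rewrite ipC ipZl// ipC. Qed.

Lemma ip_suml (I : Type) (s : seq I) (F : I -> T -> R) h :
  (forall i, sq_integrable (F i)) -> sq_integrable h ->
  ip (fun x => \sum_(i <- s) F i x) h = \sum_(i <- s) ip (F i) h.
Proof.
move=> sF sh; elim: s => [|i s IH].
  rewrite big_nil /ip (@eq_Rintegral _ _ _ mu setT (cst 0)); last first.
    by move=> x _; rewrite big_nil mul0r.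
  by rewrite /Rintegral integral0.
rewrite big_cons -IH -ipDl//; last exact: sq_integrable_sum.
by congr ip; apply/funext => x; rewrite big_cons.
Qed.

Lemma ip_sumr (I : Type) (s : seq I) (F : I -> T -> R) h :
  (forall i, sq_integrable (F i)) -> sq_integrable h ->
  ip h (fun x => \sum_(i <- s) F i x) = \sum_(i <- s) ip h (F i).
Proof.
by move=> sF sh; rewrite ipC ip_suml//; apply: eq_bigr => i _; rewrite ipC.
Qed.

Lemma ip_ge0 f : 0 <= ip f f.
Proof. by apply: Rintegral_ge0 => x _; rewrite -expr2 sqr_ge0. Qed.

Lemma ip_subr_sqr f g : sq_integrable f -> sq_integrable g ->
  ip (fun x => f x - g x) (fun x => f x - g x) = ip f f - 2 * ip f g + ip g g.
Proof.
move=> sf sg; have sfg := sq_integrableB sf sg.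
rewrite ipBl// ipC [X in _ - X]ipC !ipBl// [ip g f]ipC; ring.
Qed.

(** The quadratic polynomial [ip (f - t g) (f - t g)] in [t] is nonnegative; the value of [t]
tested when [ip g g = 0] would make it negative. *)
Lemma ip_cauchy_schwarz f g : sq_integrable f -> sq_integrable g ->
  ip f g ^+ 2 <= ip f f * ip g g.
Proof.
move=> sf sg; have q t : 0 <= ip f f - 2 * t * ip f g + t ^+ 2 * ip g g.
  have st := sq_integrableZ t sg.
  have := ip_ge0 (fun x => f x - t * g x); rewrite ip_subr_sqr//.
  rewrite (ipC f (fun x => t * g x)) !(@ipZl t g)// (ipC g (fun x => t * g x)) (@ipZl t g g)// (ipC g f).
  by move=> h; apply: le_trans h _; rewrite le_eqVlt; apply/orP; left; apply/eqP; ring.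
have [g0|g0] := eqVneq (ip g g) 0.
  rewrite g0 mulr0; have := q ((ip f f + 1) / (2 * ip f g)); rewrite g0 mulr0 addr0.
  have [->|fg0] := eqVneq (ip f g) 0; first by rewrite expr0n.
  rewrite (_ : 2 * _ * _ = ip f f + 1); last by field.
  by rewrite opprD addrA subrr sub0r oppr_ge0 ler10.
have gp : 0 < ip g g by rewrite lt_def g0 ip_ge0.
have := q (ip f g / ip g g).
rewrite (_ : _ + _ = (ip f f * ip g g - ip f g ^+ 2) / ip g g); last by field.
by rewrite pmulr_lge0 ?invr_gt0// subr_ge0.
Qed.

Lemma eq_ip_ae f f' g g' : measurable_fun setT f -> measurable_fun setT f' ->
  measurable_fun setT g -> measurable_fun setT g' ->
  {ae mu, forall x, f x = f' x} -> {ae mu, forall x, g x = g' x} ->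
  ip f g = ip f' g'.
Proof.
move=> mf mf' mg mg' ff' gg'; rewrite /ip /Rintegral; congr fine.
apply: ae_eq_integral => //.
- by apply/measurable_EFinP; exact: measurable_funM.
- by apply/measurable_EFinP; exact: measurable_funM.
- by apply: filterS (filterI ff' gg') => x [ff gg] _ /=; rewrite ff gg.
Qed.

Lemma ip_EFin f : sq_integrable f -> (\int[mu]_x (f x ^+ 2)%:E = (ip f f)%:E)%E.
Proof.
move=> [mf intf]; rewrite /ip /Rintegral.
have -> : (fun x => (f x * f x)%:E) = EFin \o (fun x => f x ^+ 2).
  by apply/funext => x /=; rewrite expr2.
by rewrite fineK//; exact: integrable_fin_num.
Qed.

Lemma sq_integrable_lty f : measurable_fun setT f ->
  (\int[mu]_x (f x ^+ 2)%:E < +oo)%E -> sq_integrable f.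
Proof.
move=> mf lt; split => //; apply/integrableP; split.
  by apply/measurable_EFinP; exact: measurable_funX.
apply: le_lt_trans lt; apply: ge0_le_integral => //=.
- by apply/measurable_EFinP; apply: measurableT_comp => //; exact: measurable_funX.
- by apply/measurable_EFinP; exact: measurable_funX.
- by move=> x _; rewrite lee_fin ger0_norm ?sqr_ge0.
Qed.

Definition cvg_L2 (F : nat -> T -> R) f :=
  (\int[mu]_x ((F n x - f x) ^+ 2)%:E)%E @[n --> \oo] --> 0%E.

Lemma cvg_L2_sq_integrable F f : (forall n, sq_integrable (F n)) -> measurable_fun setT f ->
  cvg_L2 F f -> sq_integrable f.
Proof.
move=> sF mf Ff.
have lt1 : \forall n \near \oo, (\int[mu]_x ((F n x - f x) ^+ 2)%:E < 1%:E)%E.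
  have h : nbhs (0%E : \bar R) [set x | (x < 1%:E)%E] by apply: open_ereal_lt'; exact: lte01.
  exact: (Ff _ h).
have [n /= ln] := filter_ex lt1.
have sd : sq_integrable (fun x => F n x - f x).
  apply: sq_integrable_lty; last by rewrite (lt_trans ln)// ltry.
  by apply: measurable_funB => //; exact: (sF n).1.
have := sq_integrableB (sF n) sd; congr sq_integrable; apply/funext => x.
by rewrite opprB addrC subrK.
Qed.

Lemma cvg_L2_norm F f : (forall n, sq_integrable (F n)) -> sq_integrable f -> cvg_L2 F f ->
  ip (fun x => F n x - f x) (fun x => F n x - f x) @[n --> \oo] --> (0 : R).
Proof.
move=> sF sf Ff.
have : (ip (fun x => F n x - f x) (fun x => F n x - f x))%:E @[n --> \oo] --> 0%E.
  move: Ff; rewrite /cvg_L2.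
  have -> : (fun n => (\int[mu]_x ((F n x - f x) ^+ 2)%:E)%E) =
      fun n => (ip (fun x => F n x - f x) (fun x => F n x - f x))%:E; last by [].
  by apply/funext => n; rewrite ip_EFin//; exact: sq_integrableB.
by move/fine_cvgP => [_].
Qed.

Lemma cvg_ip0 (F G : nat -> T -> R) (l : R) :
  (forall n, sq_integrable (F n)) -> (forall n, sq_integrable (G n)) ->
  ip (F n) (F n) @[n --> \oo] --> (0 : R) -> ip (G n) (G n) @[n --> \oo] --> l ->
  ip (F n) (G n) @[n --> \oo] --> (0 : R).
Proof.
move=> sF sG F0 Gl; have c2 : ip (F n) (G n) ^+ 2 @[n --> \oo] --> (0 : R).
  apply: (@squeeze_cvgr _ _ _ _ (fun=> 0) (fun n => ip (F n) (F n) * ip (G n) (G n))).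
  - by apply: nearW => n; rewrite sqr_ge0 ip_cauchy_schwarz.
  - exact: cvg_cst.
  - by rewrite -[X in _ --> X](mul0r l); exact: cvgM.
apply/cvgr0Pnorm_lt => eps e0; have e20 : 0 < eps ^+ 2 by rewrite exprn_gt0.
move/cvgr0Pnorm_lt : c2 => /(_ _ e20); apply: filterS => n.
by rewrite normrX ltr_pXn2r// ?nnegrE// ltW.
Qed.

Lemma cvg_L2_ip F f G g : (forall n, sq_integrable (F n)) -> (forall n, sq_integrable (G n)) ->
  sq_integrable f -> sq_integrable g -> cvg_L2 F f -> cvg_L2 G g ->
  ip (F n) (G n) @[n --> \oo] --> ip f g.
Proof.
move=> sF sG sf sg Ff Gg.
have sd n := sq_integrableB (sF n) sf; have F0 := cvg_L2_norm sF sf Ff.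
have se n := sq_integrableB (sG n) sg; have G0 := cvg_L2_norm sG sg Gg.
have c1 := cvg_ip0 sd (fun=> sg) F0 (cvg_cst (ip g g)).
have c2 := cvg_ip0 se (fun=> sf) G0 (cvg_cst (ip f f)).
have c3 := cvg_ip0 sd se F0 G0.
have -> : (fun n => ip (F n) (G n)) = fun n => ip f g +
   (ip (fun x => F n x - f x) g + ip (fun x => G n x - g x) f +
    ip (fun x => F n x - f x) (fun x => G n x - g x)).
  apply/funext => n; rewrite (ipBl (sF n) sf (se n)) (ipBl (sF n) sf sg) (ipBl (sG n) sg sf).
  by rewrite (ipBr (sG n) sg (sF n)) (ipBr (sG n) sg sf) [ip (G n) f]ipC [ip g f]ipC; ring.
rewrite -[X in _ --> X]addr0; apply: cvgD; first exact: cvg_cst.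
rewrite -[X in _ --> X]addr0; apply: cvgD => //.
by rewrite -[X in _ --> X]addr0; apply: cvgD; [exact: c1|exact: c2].
Qed.

Lemma sq_chebyshev f (e : R) : sq_integrable f -> 0 < e ->
  ((e ^+ 2)%:E * mu [set x | (e <= `|f x|)%R] <= (ip f f)%:E)%E.
Proof.
move=> sf e0; have [mf intf] := sf.
set A := [set x | _].
have mA : measurable A.
  rewrite [A](_ : _ = setT `&` (fun x => `|f x|) @^-1` `[e, +oo[%classic).
    by apply: measurableT_comp.
  by rewrite setTI; apply/seteqP; split => x /=; rewrite in_itv/= andbT.
have m2 : measurable_fun setT (fun x => (f x ^+ 2)%:E).
  by apply/measurable_EFinP; exact: measurable_funX.
rewrite -ip_EFin// -integral_cst//.
apply: (@le_trans _ _ (\int[mu]_(x in A) (f x ^+ 2)%:E)%E).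
  apply: ge0_le_integral.
  - exact: mA.
  - by move=> x _; rewrite lee_fin exprn_ge0// ltW.
  - exact: measurable_cst.
  - exact: measurable_funS m2.
  - move=> x /= ex; rewrite lee_fin -(real_normK (num_real (f x))).
    by rewrite lerXn2r// ?nnegrE// ltW.
apply: ge0_subset_integral => //.
by move=> x _; rewrite lee_fin sqr_ge0.
Qed.

End SquareIntegrable.

(** * Square integrable random variables *)

Section SquareIntegrableProbability.
Context {d : measure_display} {T : measurableType d} {R : realType}.
Variable P : probability T R.
Implicit Types X Y : T -> R.

Lemma Lfun2_sq_integrable X : X \in Lfun P 2%:E -> sq_integrable P X.
Proof.
move=> XL; split; last exact: Lfun2_integrable_sqr.
by have /sub_Lfun_mfun := XL; rewrite inE.
Qed.

Lemma sq_integrable_cst (c : R) : sq_integrable P (fun=> c).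
Proof.
split => //; have -> : EFin \o (fun=> c ^+ 2) = cst (c ^+ 2)%:E :> (T -> \bar R) by [].
exact: finite_measure_integrable_cst.
Qed.

Definition mean X : R := \int[P]_w X w.

Lemma mean_ip X : mean X = ip P X (fun=> 1).
Proof. by apply: eq_Rintegral => w _; rewrite mulr1. Qed.

Lemma sq_integrable_integrable X : sq_integrable P X -> P.-integrable setT (EFin \o X).
Proof.
move=> sX; have := sq_integrable_mul sX (sq_integrable_cst 1); congr (integrable _ _ _).
by apply/funext => w /=; rewrite mulr1.
Qed.

Lemma ip_cst1 : ip P (fun=> 1) (fun=> 1) = 1.
Proof.
rewrite -mean_ip /mean /Rintegral; have -> : (fun=> 1%:E) = cst 1%:E :> (T -> \bar R) by [].
by rewrite integral_cst//= mul1e probability_setT.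
Qed.

Lemma meanD X Y : sq_integrable P X -> sq_integrable P Y ->
  mean (fun w => X w + Y w) = mean X + mean Y.
Proof. by move=> sX sY; rewrite !mean_ip ipDl//; exact: sq_integrable_cst. Qed.

Lemma mean_sqr_le X : sq_integrable P X -> mean X ^+ 2 <= ip P X X.
Proof.
move=> sX; have := ip_cauchy_schwarz sX (sq_integrable_cst 1).
by rewrite ip_cst1 mulr1 mean_ip.
Qed.

End SquareIntegrableProbability.

(** * Products of independent random variables *)

Section Independence.
Context {d : measure_display} {T : measurableType d} {R : realType}.
Variable P : probability T R.

(** The joint law is the product of the marginal laws, since they agree on rectangles; then
Fubini's theorem applies. *)
Lemma ip_independent (X Y : {RV P >-> R}) :
  sq_integrable P X -> sq_integrable P Y ->
  (forall A B : set R, measurable A -> measurable B ->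
    P (X @^-1` A `&` Y @^-1` B) = (P (X @^-1` A) * P (Y @^-1` B))%E) ->
  ip P X Y = (\int[P]_w X w) * (\int[P]_w Y w).
Proof.
move=> sX sY indep.
have iXY := sq_integrable_mul sX sY.
have iX := sq_integrable_integrable sX; have iY := sq_integrable_integrable sY.
pose f (z : R * R) := (z.1 * z.2)%:E.
have mf : measurable_fun setT f.
  apply/measurable_EFinP; apply: measurable_funM; [exact: measurable_fst|exact: measurable_snd].
have mXY : measurable_fun setT (fun w => (X w, Y w)) by exact: measurable_fun_pair.
pose mu' := pushforward P (fun w => (X w, Y w)).
have E1 : (\int[mu']_z f z = \int[P]_w (X w * Y w)%:E)%E.
  by rewrite integral_pushforward//= preimage_setT.
have prodE : forall A, measurable A ->
    (distribution P X \x distribution P Y)%E A = mu' A.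
  apply: product_measure_unique => A B mA mB.
  rewrite /mu' /pushforward /distribution /pushforward -indep//.
have E2 : (\int[distribution P X \x distribution P Y]_z f z = \int[mu']_z f z)%E.
  by apply: eq_measure_integral => A mA _; exact: prodE.
have int2 : (distribution P X \x distribution P Y)%E.-integrable setT f.
  apply/integrableP; split => //.
  rewrite (eq_measure_integral mu'); last by move=> A mA _; exact: prodE.
  rewrite ge0_integral_pushforward//=.
    by rewrite preimage_setT; move/integrableP : iXY => [].
  by apply/measurable_EFinP; apply: measurableT_comp => //; exact/measurable_EFinP.
have fE (Z : {RV P >-> R}) : P.-integrable setT (EFin \o Z) ->
    (\int[P]_w (Z w)%:E = (\int[P]_w Z w)%:E)%E.
  by move=> iZ; rewrite /Rintegral fineK//; exact: integrable_fin_num.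
have inner x : fubini_F (distribution P Y) f x = (x * \int[P]_w Y w)%:E.
  rewrite /fubini_F /f /= integral_distribution/=.
  - under eq_integral do rewrite EFinM.
    by rewrite integralZl// fE// EFinM.
  - by apply/measurable_EFinP; apply: measurable_funM.
  - have := integrableZl measurableT x iY; congr (integrable _ _ _); exact/funext.
rewrite /ip /Rintegral -E1 -E2 -integral12_prod_meas1//.
rewrite (_ : (\int[_]_x fubini_F _ f x)%E =
    (\int[distribution P X]_x (x * \int[P]_w Y w)%:E)%E); last first.
  by apply: eq_integral => x _; exact: inner.
rewrite integral_distribution/=.
- under eq_integral do rewrite EFinM.
  by rewrite integralZr// fE// fE.
- by apply/measurable_EFinP; apply: measurable_funM.
- have := integrableZr measurableT (\int[P]_w Y w) iX; congr (integrable _ _ _); exact/funext.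
Qed.

End Independence.

(** * Moments of the increments of a square integrable Lévy process *)

Section LevyIncrements.
Context {d : measure_display} {T : measurableType d} {R : realType}.
Variable P : probability T R.
Variable L : R -> {RV P >-> R}.
Hypothesis L_levy : levy_process L.
Hypothesis L2 : forall t, (L t : T -> R) \in Lfun P 2%:E.

Definition incr (s t : R) : T -> R := fun w => L t w - L s w.

Lemma measurable_incr s t : measurable_fun setT (incr s t).
Proof. exact: measurable_funB. Qed.

HB.instance Definition _ s t := isMeasurableFun.Build _ _ _ _ (incr s t) (measurable_incr s t).

Lemma sq_integrable_incr s t : sq_integrable P (incr s t).
Proof. by apply: sq_integrableB; exact: Lfun2_sq_integrable. Qed.

Lemma incrD r s t w : incr r t w = incr r s w + incr s t w.
Proof. by rewrite /incr; ring. Qed.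

Lemma incr_stationary_mean s t h : s <= t -> mean P (incr (s + h) (t + h)) = mean P (incr s t).
Proof.
move=> st; have e u v : mean P (incr u v) = fine (\int[distribution P (incr u v : {RV P >-> R})]_x x%:E)%E.
  rewrite integral_distribution//=; last exact: sq_integrable_integrable (sq_integrable_incr u v).
rewrite !e; congr fine; apply: eq_measure_integral => A mA _.
exact: (levy_stationary L_levy).
Qed.

Lemma incr_stationary_sqr s t h : s <= t ->
  ip P (incr (s + h) (t + h)) (incr (s + h) (t + h)) = ip P (incr s t) (incr s t).
Proof.
move=> st; have e u v : ip P (incr u v) (incr u v) =
    fine (\int[distribution P (incr u v : {RV P >-> R})]_x (x * x)%:E)%E.
  rewrite integral_distribution//=.
    by apply/measurable_EFinP; apply: measurable_funM.
  exact: (sq_integrable_mul (sq_integrable_incr u v) (sq_integrable_incr u v)).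
rewrite !e; congr fine; apply: eq_measure_integral => A mA _.
exact: (levy_stationary L_levy).
Qed.

Lemma incr_indep r s t : r <= s -> s <= t ->
  ip P (incr r s) (incr s t) = mean P (incr r s) * mean P (incr s t).
Proof.
move=> rs st; apply: (ip_independent (sq_integrable_incr r s) (sq_integrable_incr s t)).
move=> A B mA mB.
pose u (k : nat) := if k is 0%N then r else if k is 1%N then s else t.
have um : {homo u : i j / (i <= j)%N >-> i <= j}.
  move=> [|[|i]] [|[|j]] //= _; exact: (le_trans rs).
have h := levy_indep L_levy um.
have {h} := h 2%N (fun i : 'I_2 => if i == ord0 then A else B).
rewrite !big_ord_recl big_ord0 /= mule1.
have -> : \bigcap_(i in [set: 'I_2]) ((fun w => L (u i.+1) w - L (u i) w) @^-1`
    (if i == ord0 then A else B)) = (incr r s) @^-1` A `&` (incr s t) @^-1` B.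
  apply/seteqP; split => w /=.
    by move=> hw; split; [exact: (hw ord0)|exact: (hw (lift ord0 ord0))].
  move=> [hA hB] i _; case: (eqVneq i ord0) => [->//|i0].
  have -> : i = lift ord0 ord0 by apply/val_inj; case: i i0 => [[|[|n]] ] //= i2 _.
  exact: hB.
by apply => i; case: ifP.
Qed.

Let m t := mean P (incr 0 t).
Let q t := ip P (incr 0 t) (incr 0 t).

Let mD s t : 0 <= s -> 0 <= t -> m (s + t) = m s + m t.
Proof.
move=> s0 t0; rewrite /m -(incr_stationary_mean s t0) add0r [t + s]addrC -meanD; try exact: sq_integrable_incr.
by congr mean; apply/funext => w; exact: incrD.
Qed.

Let qD s t : 0 <= s -> 0 <= t -> q (s + t) = q s + q t + 2 * (m s * m t).
Proof.
move=> s0 t0; have st : s <= s + t by rewrite lerDl.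
have i1 := sq_integrable_incr 0 s; have i2 := sq_integrable_incr s (s + t).
have -> : q (s + t) = ip P (fun w => incr 0 s w + incr s (s + t) w) (fun w => incr 0 s w + incr s (s + t) w).
  by rewrite /q; congr ip; apply/funext => w; exact: incrD.
rewrite ipDl//; last exact: sq_integrableD.
rewrite (ipDr i1 i2 i1) (ipDr i1 i2 i2) [ip P (incr s (s + t)) (incr 0 s)]ipC incr_indep//.
have := incr_stationary_mean s t0; rewrite add0r [t + s]addrC => ->.
have := incr_stationary_sqr s t0; rewrite add0r [t + s]addrC => ->.
rewrite /q /m; ring.
Qed.

(** The variance is additive on consecutive increments, unlike the second moment [q]. *)
Let v t := q t - m t ^+ 2.

Let vD s t : 0 <= s -> 0 <= t -> v (s + t) = v s + v t.
Proof. by move=> s0 t0; rewrite /v qD// mD//; ring. Qed.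

Let v_ge0 t : 0 <= v t.
Proof. by rewrite subr_ge0 mean_sqr_le//; exact: sq_integrable_incr. Qed.

Lemma additive_mulrn (f : R -> R) n t : (forall s t, 0 <= s -> 0 <= t -> f (s + t) = f s + f t) ->
  0 <= t -> f (n%:R * t) = n%:R * f t.
Proof.
move=> fD t0; elim: n => [|n IH].
  by rewrite !mul0r; have := fD 0 0 (lexx _) (lexx _); rewrite addr0; lra.
by rewrite -natr1 mulrDl mul1r fD// ?mulr_ge0// IH mulrDl mul1r.
Qed.

(** A nonnegative additive function is nondecreasing; comparing [f (n * t) = n * f t] with the
values at the integers next to [n * t] gives [f t = t * f 1] up to [f 1 / n]. *)
Lemma additive_nonneg_linear (f : R -> R) :
  (forall s t, 0 <= s -> 0 <= t -> f (s + t) = f s + f t) -> (forall t, 0 <= f t) ->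
  forall t, 0 <= t -> f t = t * f 1.
Proof.
move=> fD f0 t t0.
have mono x y : 0 <= x -> x <= y -> f x <= f y.
  move=> x0 xy; have -> : y = x + (y - x) by ring.
  by rewrite fD ?subr_ge0// lerDl.
have bound n : `|f t - t * f 1| * n.+1%:R <= f 1.
  pose k := Num.truncn (n.+1%:R * t).
  have nt0 : 0 <= n.+1%:R * t by rewrite mulr_ge0.
  have /andP[k1 k2] := truncn_itv nt0; rewrite -/k in k1 k2.
  have e1 : f (n.+1%:R * t) = n.+1%:R * f t by rewrite additive_mulrn.
  have e2 j : f j%:R = j%:R * f 1 by rewrite -[in LHS](mulr1 j%:R) additive_mulrn.
  have h1 : k%:R * f 1 <= n.+1%:R * f t by rewrite -e1 -e2 mono.
  have h2 : n.+1%:R * f t <= k.+1%:R * f 1 by rewrite -e1 -e2 mono// ltW.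
  have f10 := f0 1.
  rewrite -[X in _ * X]ger0_norm// -normrM ler_norml.
  have -> : (f t - t * f 1) * n.+1%:R = n.+1%:R * f t - (n.+1%:R * t) * f 1 by ring.
  rewrite -natr1 mulrDl mul1r in h2.
  have g1 := ler_wpM2r f10 k1.
  have g2 := ler_wpM2r f10 (ltW k2); rewrite -natr1 mulrDl mul1r in g2.
  by apply/andP; split; lra.
apply/eqP; rewrite -subr_eq0 -normr_eq0; apply: contraT => d0.
have dp : 0 < `|f t - t * f 1| by rewrite lt_def d0 normr_ge0.
pose N := Num.truncn (f 1 / `|f t - t * f 1|).
have := bound N; have := truncnS_gt (f 1 / `|f t - t * f 1|); rewrite -/N.
rewrite ltr_pdivrMr// mulrC => h1 h2.
by have := lt_le_trans h1 h2; rewrite ltxx.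
Qed.

Let vE t : 0 <= t -> v t = t * v 1.
Proof. by apply: additive_nonneg_linear; [exact: vD|exact: v_ge0]. Qed.

(** The increments over short intervals are small both around [0], by stochastic
continuity, and around their mean, by Chebyshev's inequality. *)
Let m_small (e : R) : 0 < e -> exists2 r, 0 < r & forall t, 0 <= t -> t < r -> `|m t| <= 2 * e.
Proof.
move=> e0.
have h12 : nbhs (0%E : \bar R) [set x | (x < (2^-1)%:E)%E].
  by apply: open_ereal_lt'; rewrite lte_fin invr_gt0.
have := levy_stoch_cont L_levy 0 e0 => /(_ _ h12) /nbhs_ballP[r /= r0 hr].
pose B := 4 * v 1 / e ^+ 2 + 1.
have e20 : 0 < e ^+ 2 by rewrite exprn_gt0.
have B0 : 0 < B by rewrite ltr_wpDl// divr_ge0 ?mulr_ge0// ltW.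
exists (Num.min r B^-1) => [|t t0]; first by rewrite lt_min r0 invr_gt0.
rewrite lt_min => /andP[tr tB].
have p1 : (P [set w | (e < `|incr 0 t w|)%R] < (2^-1)%:E)%E.
  by apply: (hr t); rewrite /ball/= sub0r normrN ger0_norm.
pose X w := incr 0 t w - m t.
have sX : sq_integrable P X by apply: sq_integrableB; [exact: sq_integrable_incr|exact: sq_integrable_cst].
have ipX : ip P X X = v t.
  rewrite ip_subr_sqr; [|exact: sq_integrable_incr|exact: sq_integrable_cst].
  have -> : (fun=> m t) = (fun w => m t * (fun=> 1) w) :> (T -> R) by apply/funext => w; rewrite mulr1.
  have s1 := @sq_integrable_cst _ _ _ P 1; have si := sq_integrable_incr 0 t.
  rewrite ipZr// ipZl// ?ipZr//; last exact: sq_integrableZ.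
  by rewrite -mean_ip ip_cst1 /v /q -/(m t); ring.
have p2 : (P [set w | (e <= `|X w|)%R] < (2^-1)%:E)%E.
  have := sq_chebyshev sX e0; rewrite ipX vE// => h.
  have h2 : (P [set w | (e <= `|X w|)%R] <= (t * v 1 / e ^+ 2)%:E)%E.
    rewrite EFinM -[X in (X * _)%E]EFinM lee_pdivlMr//.
    by rewrite muleC.
  apply: le_lt_trans h2 _; rewrite lte_fin.
  have h3 : t * B < 1.
    by rewrite -(@mulVf _ B) ?gt_eqF// ltr_pM2r.
  have v1 := v_ge0 1.
  have : t * v 1 / e ^+ 2 = t * (v 1 / e ^+ 2) by rewrite mulrA.
  rewrite /B in h3; have : t * (4 * v 1 / e ^+ 2 + 1) = 4 * (t * (v 1 / e ^+ 2)) + t by ring.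
  lra.
have mA : measurable [set w | (e < `|incr 0 t w|)%R].
  rewrite [X in measurable X](_ : _ = setT `&` (fun w => `|incr 0 t w|) @^-1` `]e, +oo[%classic).
    by apply: measurableT_comp.
  by rewrite setTI; apply/seteqP; split => x /=; rewrite in_itv/= andbT.
have mB : measurable [set w | (e <= `|X w|)%R].
  rewrite [X in measurable X](_ : _ = setT `&` (fun w => `|X w|) @^-1` `[e, +oo[%classic).
    by apply: measurableT_comp => //; exact: sX.1.
  by rewrite setTI; apply/seteqP; split => x /=; rewrite in_itv/= andbT.
have : ([set w | (e < `|incr 0 t w|)%R] `|` [set w | (e <= `|X w|)%R]) != setT.
  apply/eqP => U; have : (P setT < 1)%E.
    rewrite -U (le_lt_trans (measureU2 _ _ _))//.
    have -> : 1%E = ((2^-1)%:E + (2^-1)%:E)%E :> \bar R by rewrite -EFinD; congr EFin; lra.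
    exact: lteD.
  by rewrite probability_setT ltxx.
move=> /eqP U; apply: contrapT => mt; apply: U; apply/seteqP; split => // w _ /=.
apply: contrapT => /not_orP[/negP h1 /negP h2]; apply: mt.
move: h1 h2; rewrite -leNgt -ltNge => h1 h2.
have -> : m t = incr 0 t w - X w by rewrite /X; ring.
by rewrite (le_trans (ler_normB _ _))//; lra.
Qed.

Hypothesis L_mean : ('E_P[L 1%R] = 0)%E.
Variable sigma : R.
Hypothesis L_var : ('E_P[fun w => (L 1%R w ^+ 2)%R] = (sigma ^+ 2)%:E)%E.

Let incr01 : {ae P, forall w, incr 0 1 w = L 1 w}.
Proof. by apply: filterS (levy_start L_levy) => w h; rewrite /incr h subr0. Qed.

Let m1 : m 1 = 0.
Proof.
rewrite /m /mean /Rintegral (@ae_eq_integral _ _ _ P setT (EFin \o L 1))//.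
- by have := L_mean; rewrite unlock => ->.
- exact/measurable_EFinP/measurable_incr.
- exact/measurable_EFinP.
- by apply: filterS incr01 => w h _ /=; rewrite h.
Qed.

Let q1 : q 1 = sigma ^+ 2.
Proof.
rewrite /q (@eq_ip_ae _ _ _ P _ (L 1) _ (L 1))//; try exact: measurable_incr.
have := L_var; rewrite unlock (ip_EFin (Lfun2_sq_integrable (L2 1))).
by case.
Qed.

(** The mean is additive and vanishes at [1], hence at all nonnegative rational numbers, and
is small near [0]. *)
Let m0 t : 0 <= t -> m t = 0.
Proof.
move=> t0; apply/eqP; apply: contraT => mt0.
have mp : 0 < `|m t| / 4 by rewrite divr_gt0// normr_gt0.
have [r r0 hr] := m_small mp.
pose N := Num.truncn r^-1.
have rN : r^-1 < N.+1%:R by exact: truncnS_gt.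
have N0 : 0 < N.+1%:R :> R by [].
pose k := Num.truncn (N.+1%:R * t).
have nt0 : 0 <= N.+1%:R * t by rewrite mulr_ge0.
have /andP[k1 k2] := truncn_itv nt0; rewrite -/k in k1 k2.
have mk : m (k%:R / N.+1%:R) = 0.
  rewrite (additive_mulrn _ mD) ?invr_ge0//.
  have : m (N.+1%:R * N.+1%:R^-1) = N.+1%:R * m N.+1%:R^-1.
    by rewrite (additive_mulrn _ mD) ?invr_ge0.
  rewrite mulfV// m1 => /esym/eqP; rewrite mulf_eq0 (gt_eqF N0)/= => /eqP ->.
  by rewrite mulr0.
have kt : k%:R / N.+1%:R <= t by rewrite ler_pdivrMr// mulrC.
have k0 : 0 <= k%:R / N.+1%:R :> R by rewrite divr_ge0.
have mt : m t = m (t - k%:R / N.+1%:R).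
  have tk : 0 <= t - k%:R / N.+1%:R by rewrite subr_ge0.
  by have := mD k0 tk; rewrite mk add0r addrC subrK.
have dr : t - k%:R / N.+1%:R < r.
  have : N.+1%:R * (t - k%:R / N.+1%:R) < 1.
    rewrite mulrBr mulrCA mulfV// mulr1; rewrite -natr1 in k2; lra.
  rewrite -ltr_pdivlMl// mulr1 => /lt_trans; apply.
  by rewrite -[X in _ < X]invrK ltf_pV2// ?posrE ?invr_gt0.
have := hr (t - k%:R / N.+1%:R); rewrite subr_ge0 => /(_ kt dr); rewrite -mt.
have mtp : 0 < `|m t| by rewrite normr_gt0.
lra.
Qed.

Lemma incr_sqr s t : s <= t -> ip P (incr s t) (incr s t) = sigma ^+ 2 * (t - s).
Proof.
move=> st; have ts0 : 0 <= t - s by rewrite subr_ge0.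
have := incr_stationary_sqr s ts0; rewrite add0r subrK => ->.
have := vE ts0; rewrite /v -/(q _) !m0// q1 expr0n !subr0 => ->.
by rewrite mulrC.
Qed.

Lemma incr_sqr_norm s t : ip P (incr s t) (incr s t) = sigma ^+ 2 * `|t - s|.
Proof.
have [st|ts] := leP s t; first by rewrite incr_sqr// ger0_norm// subr_ge0.
have -> : incr s t = fun w => - incr t s w by apply/funext => w; rewrite /incr; ring.
have i := sq_integrable_incr t s.
rewrite ipNl//; last exact: sq_integrableN.
rewrite ipC ipNl// opprK incr_sqr ?(ltW ts)//.
by rewrite ltr0_norm ?subr_lt0// opprB.
Qed.

(** Polarization reduces all the covariances of increments to their variances. *)
Lemma incr_ip s t s' t' : ip P (incr s t) (incr s' t') =
  sigma ^+ 2 * ((`|t - s'| + `|s - t'| - `|t - t'| - `|s - s'|) / 2).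
Proof.
have X u := Lfun2_sq_integrable (L2 u).
have e u w : ip P (L u) (L u) - 2 * ip P (L u) (L w) + ip P (L w) (L w) = sigma ^+ 2 * `|u - w|.
  by rewrite -ip_subr_sqr// -incr_sqr_norm.
have B u w x y : ip P (incr u w) (incr x y) =
    ip P (L w) (L y) - ip P (L w) (L x) - ip P (L u) (L y) + ip P (L u) (L x).
  rewrite /incr ipBl//; last exact: sq_integrableB.
  by rewrite !ipBr//; ring.
rewrite B; have := e t s'; have := e s t'; have := e t t'; have := e s s'.
by set a := `|_|; set b := `|_|; set c := `|_|; set d' := `|_|; lra.
Qed.

End LevyIncrements.

(** * Step functions *)

Section StepFunctions.
Context {R : realType}.
Local Notation mu := (@lebesgue_measure R).

(** The length of the intersection, in the form taken by [incr_ip]. *)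
Lemma ip_indic_itv (s t s' t' : R) : s <= t -> s' <= t' ->
  ip mu (\1_(`]s, t]%classic)) (\1_(`]s', t']%classic)) =
  (`|t - s'| + `|s - t'| - `|t - t'| - `|s - s'|) / 2.
Proof.
move=> st st'; rewrite /ip.
have -> : (fun x => \1_(`]s, t]%classic) x * \1_(`]s', t']%classic) x) =
   \1_(`]Num.max s s', Num.min t t']%classic) :> (R -> R).
  apply/funext => x; rewrite !indicE -natrM mulnb; congr (_%:R).
  congr nat_of_bool; rewrite -in_setI; congr (_ \in _).
  apply/seteqP; split => y /=; rewrite !in_itv/= gt_max le_min.
    by move=> [/andP[-> ->] /andP[-> ->]].
  by move=> /andP[/andP[-> ->] /andP[-> ->]].
rewrite /Rintegral integral_indic//= setIT lebesgue_measure_itv/= lte_fin.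
have -> : fine (if Num.max s s' < Num.min t t' then ((Num.min t t')%:E + (- Num.max s s')%:E)%E
    else 0%E) = Num.max 0 (Num.min t t' - Num.max s s').
  case: ltP => a; first by rewrite /= (@max_r _ _ 0)// subr_ge0 ltW.
  by rewrite /= (@max_l _ _ 0)// subr_le0.
have nl (x y : R) : x <= y -> `|x - y| = y - x by move=> h; rewrite distrC ger0_norm ?subr_ge0.
have nr (x y : R) : x <= y -> `|y - x| = y - x by move=> h; rewrite ger0_norm ?subr_ge0.
have [a1|a1] := lerP s s'; have [a2|a2] := lerP t t'.
- rewrite (nl s t') ?(le_trans st)//.
  by case: (lerP s' t) => h; rewrite /Num.max subr_gt0; case: ltP => ?; lra.
- rewrite (nl s t') ?(le_trans a1)// (nr s' t) ?(le_trans st' (ltW a2))//.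
  by rewrite /Num.max subr_gt0; case: ltP => ?; lra.
- rewrite (nl s t') ?(le_trans st)// (nr s' t) ?(le_trans (ltW a1))//.
  by rewrite /Num.max subr_gt0; case: ltP => ?; lra.
- rewrite (nr s' t) ?(le_trans (ltW a1))//.
  by case: (lerP s t') => h; rewrite /Num.max subr_gt0; case: ltP => ?; lra.
Qed.

Lemma sq_integrable_indic_itv (s t : R) : sq_integrable mu (\1_(`]s, t]%classic)).
Proof.
split; first exact: measurable_indic.
have -> : EFin \o (fun x => \1_(`]s, t]%classic) x ^+ 2) = EFin \o (\1_(`]s, t]%classic) : R -> R).
  by apply/funext => x /=; rewrite indicE; case: (_ \in _); rewrite ?expr1n ?expr0n.
apply: integrable_indic_itv.
Qed.

Lemma sq_integrable_step S : sq_integrable mu (step_fun S).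
Proof.
have := @sq_integrable_sum _ _ _ mu _ S (fun x u => x.1 * \1_(`]x.2.1, x.2.2]%classic) u).
by apply => x; apply: sq_integrableZ; exact: sq_integrable_indic_itv.
Qed.

End StepFunctions.

(** * The isometry of the stochastic integral *)

Section Isometry.
Context {d : measure_display} {T : measurableType d} {R : realType}.
Variable P : probability T R.
Variable L : R -> {RV P >-> R}.
Variable sigma : R.
Hypothesis L_levy : levy_process L.
Hypothesis L2 : forall t, (L t : T -> R) \in Lfun P 2%:E.
Hypothesis L_mean : ('E_P[L 1%R] = 0)%E.
Hypothesis L_var : ('E_P[fun w => (L 1%R w ^+ 2)%R] = (sigma ^+ 2)%:E)%E.
Local Notation mu := (@lebesgue_measure R).
Local Notation Lf := (fun t => L t : T -> R).

Lemma sq_integrable_step_integral S : sq_integrable P (step_integral Lf S).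
Proof.
have := @sq_integrable_sum _ _ _ P _ S (fun x w => x.1 * (L x.2.2 w - L x.2.1 w)).
by apply => x; apply: sq_integrableZ; exact: (sq_integrable_incr L2).
Qed.

Lemma step_isometry (S S' : seq (R * (R * R))) :
  all (fun x => x.2.1 <= x.2.2) S -> all (fun x => x.2.1 <= x.2.2) S' ->
  ip P (step_integral Lf S) (step_integral Lf S') = sigma ^+ 2 * ip mu (step_fun S) (step_fun S').
Proof.
move=> /allP aS /allP aS'.
have iL x : sq_integrable P (fun w => x.1 * (L x.2.2 w - L x.2.1 w)).
  by apply: sq_integrableZ; exact: (sq_integrable_incr L2).
have iI (x : R * (R * R)) : sq_integrable mu (fun u => x.1 * \1_(`]x.2.1, x.2.2]%classic) u).
  by apply: sq_integrableZ; exact: sq_integrable_indic_itv.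
rewrite ip_suml//; last exact: sq_integrable_step_integral.
rewrite [in RHS]ip_suml//; last exact: sq_integrable_step.
rewrite mulr_sumr; apply: eq_big_seq => x xS.
rewrite ip_sumr// [in RHS]ip_sumr// mulr_sumr; apply: eq_big_seq => y yS.
have i1 := sq_integrable_incr L2 x.2.1 x.2.2.
have i2 := sq_integrable_incr L2 y.2.1 y.2.2.
have j1 := sq_integrable_indic_itv x.2.1 x.2.2.
have j2 := sq_integrable_indic_itv y.2.1 y.2.2.
rewrite (ipZl _ i1 (iL y)) (ipZr _ i2 i1) (ipZl _ j1 (iI y)) (ipZr _ j2 j1).
have -> : ip P (incr L x.2.1 x.2.2) (incr L y.2.1 y.2.2) = sigma ^+ 2 *
    ip mu (\1_(`]x.2.1, x.2.2]%classic)) (\1_(`]y.2.1, y.2.2]%classic)).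
  by rewrite (incr_ip L_levy L2 L_mean L_var) (ip_indic_itv (aS _ xS) (aS' _ yS)).
by rewrite ![_ * (sigma ^+ 2 * _)]mulrCA.
Qed.

Lemma levy_integral_sq_integrable f (X : {RV P >-> R}) : is_levy_integral P Lf f X ->
  sq_integrable mu f /\ sq_integrable P X.
Proof.
move=> [mf [S [_ Sf SX]]]; split.
  by apply: (@cvg_L2_sq_integrable _ _ _ mu (fun n => step_fun (S n))) => // n; exact: sq_integrable_step.
apply: (@cvg_L2_sq_integrable _ _ _ P (fun n => step_integral Lf (S n))) => //.
  by move=> n; exact: sq_integrable_step_integral.
by move: SX; rewrite unlock.
Qed.

(** The identity holds for step functions by [step_isometry] and passes to mean square
limits on both sides. *)
Lemma levy_isometry f g (X Y : {RV P >-> R}) :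
  is_levy_integral P Lf f X -> is_levy_integral P Lf g Y ->
  ip P X Y = sigma ^+ 2 * ip mu f g.
Proof.
move=> hX hY; have [sf sX] := levy_integral_sq_integrable hX.
have [sg sY] := levy_integral_sq_integrable hY.
case: hX hY => [mf [S [aS Sf SX]]] [mg [S' [aS' Sg SY]]].
rewrite unlock in SX; rewrite unlock in SY.
have c1 := cvg_L2_ip (fun n => sq_integrable_step_integral (S n))
  (fun n => sq_integrable_step_integral (S' n)) sX sY SX SY.
have c2 := cvg_L2_ip (fun n => sq_integrable_step (S n))
  (fun n => sq_integrable_step (S' n)) sf sg Sf Sg.
have c3 : sigma ^+ 2 * ip mu (step_fun (S n)) (step_fun (S' n)) @[n --> \oo] --> sigma ^+ 2 * ip mu f g.
  by apply: cvgM => //; exact: cvg_cst.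
have e : (fun n => ip P (step_integral Lf (S n)) (step_integral Lf (S' n))) =
    fun n => sigma ^+ 2 * ip mu (step_fun (S n)) (step_fun (S' n)).
  by apply/funext => n; rewrite step_isometry.
rewrite e in c1.
exact: (@cvg_unique _ (@norm_hausdorff _ R) _ _ _ _ c1 c3).
Qed.

End Isometry.

(** * Uniform asymptotics for small sampling intervals *)

Section UniformApproximation.
Context {R : realType}.
Implicit Types (A B : R -> R -> R) (f g : R -> R).

(** The bound on [f] makes these approximations stable under products. *)
Definition uapprox (r : nat) A f : Prop :=
  (exists M, forall s, 0 < s <= 1 -> `|f s| <= M) /\
  forall e, 0 < e -> \forall D \near (0 : R)^'+,
    forall s, 0 < s <= 1 -> `|A D s - D ^+ r * f s| <= e * D ^+ r.

Lemma uapprox0 r : uapprox r (fun _ _ => 0) (fun=> 0).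
Proof.
split; first by exists 0 => s _; rewrite normr0.
move=> e e0; near=> D => s _.
by rewrite mulr0 subrr normr0 mulr_ge0 ?exprn_ge0// ltW.
Unshelve. all: by end_near.
Qed.

Lemma uapproxD r A B f g : uapprox r A f -> uapprox r B g ->
  uapprox r (fun D s => A D s + B D s) (fun s => f s + g s).
Proof.
move=> [[M hM] hA] [[N hN] hB]; split.
  by exists (M + N) => s s01; rewrite (le_trans (ler_normD _ _))// lerD ?hM ?hN.
move=> e e0; have e2 : 0 < e / 2 by rewrite divr_gt0.
apply: filterS2 (hA _ e2) (hB _ e2) => D a b s s01.
rewrite (_ : _ - _ = (A D s - D ^+ r * f s) + (B D s - D ^+ r * g s)); last by ring.
rewrite (le_trans (ler_normD _ _))//.
rewrite (_ : e * _ = e / 2 * D ^+ r + e / 2 * D ^+ r); last by field.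
by rewrite lerD ?a ?b.
Qed.

Lemma uapprox_sum (I : Type) (s : seq I) r (A : I -> R -> R -> R) (f : I -> R -> R) :
  (forall i, uapprox r (A i) (f i)) ->
  uapprox r (fun D x => \sum_(i <- s) A i D x) (fun x => \sum_(i <- s) f i x).
Proof.
move=> h; elim: s => [|i s IH].
  have := uapprox0 r; congr (uapprox r _ _).
    by apply/funext => D; apply/funext => x; rewrite big_nil.
  by apply/funext => x; rewrite big_nil.
have := uapproxD (h i) IH; congr (uapprox r _ _).
  by apply/funext => D; apply/funext => x; rewrite big_cons.
by apply/funext => x; rewrite big_cons.
Qed.

Lemma uapproxM r r' A B f g : uapprox r A f -> uapprox r' B g ->
  uapprox (r + r') (fun D s => A D s * B D s) (fun s => f s * g s).
Proof.
move=> [[M hM] hA] [[N hN] hB].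
have M0 : 0 <= M by apply: le_trans (hM 1 _); rewrite ?normr_ge0 ?ltr01 ?lexx.
have N0 : 0 <= N by apply: le_trans (hN 1 _); rewrite ?normr_ge0 ?ltr01 ?lexx.
split.
  by exists (M * N) => s s01; rewrite normrM ler_pM ?hM ?hN.
move=> e e0; pose K := M + N + 1.
have K0 : 0 < K by rewrite ltr_wpDl ?addr_ge0.
pose eps := Num.min 1 (e / K).
have eps0 : 0 < eps by rewrite lt_min ltr01 divr_gt0.
have epsK : eps * K <= e by rewrite -ler_pdivlMr// ge_min lexx orbT.
have eps1 : eps <= 1 by rewrite ge_min lexx.
apply: filterS3 (nbhs_right_gt 0) (hA _ eps0) (hB _ eps0) => D D0 a b s s01.
move: (a s s01) (b s s01) => {}a {}b.
have p1 : 0 <= D ^+ r by rewrite exprn_ge0// ltW.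
have p2 : 0 <= D ^+ r' by rewrite exprn_ge0// ltW.
set x := A D s - _ in a; set y := B D s - _ in b.
have -> : A D s * B D s - D ^+ (r + r') * (f s * g s) =
    x * y + (x * (D ^+ r' * g s) + D ^+ r * f s * y) by rewrite /x /y exprD; ring.
have fM := hM _ s01; have gN := hN _ s01.
have h1 : `|x * y| <= eps * D ^+ r * (1 * D ^+ r').
  by rewrite normrM ler_pM// (le_trans b)// ler_wpM2r.
have h2 : `|x * (D ^+ r' * g s)| <= eps * D ^+ r * (D ^+ r' * N).
  by rewrite normrM ler_pM// normrM ger0_norm// ler_wpM2l.
have h3 : `|D ^+ r * f s * y| <= D ^+ r * M * (eps * D ^+ r').
  by rewrite normrM ler_pM// normrM ger0_norm// ler_wpM2l.
rewrite (le_trans (ler_normD _ _))// (le_trans (lerD h1 (le_trans (ler_normD _ _) (lerD h2 h3))))//.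
rewrite (_ : _ + _ = eps * K * (D ^+ r * D ^+ r')); last by rewrite /K; ring.
by rewrite exprD ler_wpM2r// mulr_ge0.
Qed.

Lemma uapprox_cst (c : R -> R) (l : R) : c D @[D --> (0 : R)^'+] --> l ->
  uapprox 0 (fun D _ => c D) (fun=> l).
Proof.
move=> cl; split; first by exists `|l|.
move=> e e0; move/cvgrPdist_le : cl => /(_ _ e0); apply: filterS => D h s _.
by rewrite !expr0 mul1r mulr1 distrC.
Qed.

Lemma near_uapprox r A B f : (\forall D \near (0 : R)^'+, forall s, 0 < s <= 1 -> A D s = B D s) ->
  uapprox r A f -> uapprox r B f.
Proof.
move=> AB [fM h]; split => // e e0.
by apply: filterS2 AB (h _ e0) => D ab hD s s01; rewrite -ab// hD.
Qed.

Lemma integrable_horner (G : {poly R}) (a b : R) :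
  lebesgue_measure.-integrable `[a, b[ (EFin \o (horner G)).
Proof.
have h : lebesgue_measure.-integrable `[a, b] (EFin \o (horner G)).
  apply: continuous_compact_integrable; first exact: segment_compact.
  by apply: continuous_subspaceT => x; exact: continuous_horner.
apply: (integrableS _ _ _ h) => //.
by apply: subset_itvl; rewrite bnd_simp.
Qed.

Lemma integral_horner (G : {poly R}) (a b : R) : a < b ->
  \int[lebesgue_measure]_(u in `[a, b[) G^`().[u] = G.[b] - G.[a].
Proof.
move=> ab; rewrite Rintegral_itv_bndo_bndc; last first.
  apply: integrable_horner.
rewrite /Rintegral (@continuous_FTC2 _ (horner G^`()) (horner G) a b)//.
- by apply: continuous_subspaceT => x; exact: continuous_horner.
- split => [x _||].
  + exact: derivable_horner.
  + by apply: cvg_at_right_filter; exact: continuous_horner.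
  + by apply: cvg_at_left_filter; exact: continuous_horner.
- by move=> x _; rewrite derive1E; have [_ ->] := is_derive_poly G x.
Qed.

(** Rescaling by [s |-> c - D * s] turns the integral over an interval of length [D]
into [D] times one over the unit interval. *)
Lemma itv_integral_approx (F : R -> R) (Q : {poly R}) (c D e : R) : 0 < D ->
  lebesgue_measure.-integrable `[c - D, c[ (EFin \o F) ->
  (forall s, 0 < s <= 1 -> `|F (c - D * s) - Q.[s]| <= e) ->
  `|\int[lebesgue_measure]_(u in `[c - D, c[) F u - D * pint Q| <= e * D.
Proof.
move=> D0 intF FQ; have cD : c - D < c by rewrite gtrBl.
have Dn0 : D != 0 by rewrite gt_eqF.
have [S SQ pQ] := pint_primitive Q.
pose A := (c / D)%:P - D^-1 *: 'X : {poly R}.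
pose G := - D *: (S \Po A).
have GQ : G^`() = Q \Po A.
  rewrite derivZ deriv_comp SQ /A derivB derivC derivZ derivX sub0r mulrN.
  by rewrite scaleNr scalerN opprK -scalerAr scalerA mulfV// scale1r mulr1.
have AE u : A.[u] = (c - u) / D by rewrite !hornerE/=; ring.
have GE u : G.[u] = - D * S.[(c - u) / D] by rewrite hornerZ horner_comp AE.
have I : \int[lebesgue_measure]_(u in `[c - D, c[) Q.[(c - u) / D] = D * pint Q.
  transitivity (\int[lebesgue_measure]_(u in `[c - D, c[) G^`().[u]).
    by apply: eq_Rintegral => u _; rewrite GQ horner_comp AE.
  have e1 : (c - (c - D)) / D = 1 by field.
  by rewrite integral_horner// !GE pQ e1 subrr mul0r; ring.
have iQ : lebesgue_measure.-integrable `[c - D, c[ (EFin \o (fun u => Q.[(c - u) / D])).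
  have := integrable_horner (Q \Po A) (c - D) c; congr (integrable _ _ _).
  by apply/funext => u /=; rewrite horner_comp AE.
have iB : lebesgue_measure.-integrable `[c - D, c[ (EFin \o (fun u => F u - Q.[(c - u) / D])).
  exact: (integrableB _ intF iQ).
rewrite -I -RintegralB//.
apply: le_trans (le_normr_Rintegral _ iB) _ => //.
have ei : e * D = \int[lebesgue_measure]_(u in `[c - D, c[) e.
  rewrite Rintegral_cst//= lebesgue_measure_itv/= lte_fin cD -EFinB/=.
  by congr (_ * _); ring.
rewrite ei; apply: le_Rintegral => //.
- exact: integrable_norm.
- have := integrable_horner e%:P (c - D) c; congr (integrable _ _ _).
  by apply/funext => u /=; rewrite hornerC.
move=> u /=; rewrite in_itv/= => /andP[u1 u2].
have Du : c - D * ((c - u) / D) = u :> R by field.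
have := FQ ((c - u) / D); rewrite Du; apply.
by rewrite divr_gt0 ?subr_gt0//= ler_pdivrMr// mul1r; lra.
Qed.

End UniformApproximation.

(** * Spectral densities with finitely many autocovariances *)

Section SpectralSums.
Context {R : realType}.

(** Both the sums over lags and the limit which defines a spectral density are sums of
finitely supported functions on the integers, over windows containing the support. *)
Lemma sum_int_shift (V : nmodType) (f : int -> V) (p m M : nat) : (m + p <= M)%N ->
  (forall i : int, (i < 0) || (p%:Z <= i) -> f i = 0) ->
  \sum_(0 <= k < M) f (k%:Z - m%:Z) = \sum_(k < p) f k%:Z.
Proof.
move=> mM f0; rewrite (big_cat_nat (n := m))//=; last by lia.
rewrite big_nat_cond big1 ?add0r; last first.
  by move=> k /andP[/andP[_ km] _]; apply: f0; apply/orP; left; lia.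
rewrite (big_cat_nat (n := m + p))//=; last by lia.
rewrite [X in _ + X]big_nat_cond [X in _ + X]big1 ?addr0; last first.
  by move=> k /andP[/andP[km _] _]; apply: f0; apply/orP; right; lia.
rewrite -{1}[m]add0n big_addn addKn big_mkord; apply: eq_bigr => k _.
by congr f; lia.
Qed.

(** [e^(- i omega)]. *)
Definition phase (omega : R) : R[i] := cos omega +i* - sin omega.

Lemma phase_neq0 omega : phase omega != 0.
Proof.
apply/eqP => /eqP; rewrite eq_complex/= oppr_eq0 => /andP[/eqP c0 /eqP s0].
by have := cos2Dsin2 omega; rewrite c0 s0 expr0n addr0 => /eqP; rewrite eq_sym oner_eq0.
Qed.

Lemma conj_phase omega : (phase omega)^*%C = (phase omega)^-1.
Proof.
apply: (mulfI (phase_neq0 omega)); rewrite mulfV ?phase_neq0//.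
apply/eqP; rewrite eq_complex/= opprK; apply/andP; split; apply/eqP.
  by rewrite mulNr opprK -!expr2 cos2Dsin2.
by rewrite mulrC; ring.
Qed.

Lemma cexp_phase (j : int) omega : cexp (0 +i* - (j%:~R * omega)) = phase omega ^ j.
Proof.
have nat_case n : cexp (0 +i* - (n%:R * omega)) = phase omega ^+ n.
  have -> : phase omega = cexp (0 +i* - omega).
    by rewrite /cexp/= expR0 !mul1r cosN sinN.
  rewrite -cexpMn; congr cexp; elim: n => [|n IH]; first by rewrite mul0r oppr0.
  rewrite [in RHS]mulrSr -IH; apply/eqP; rewrite eq_complex/= addr0 eqxx/= -natr1; apply/eqP; ring.
case: j => n; first exact: nat_case.
rewrite NegzE -exprnN -nat_case -cexpN; congr cexp.
by apply/eqP; rewrite eq_complex/= oppr0 eqxx/= rmorphN/= mulNr.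
Qed.

(** The symmetric partial sums are constant as soon as they contain all the lags with
nonzero autocovariance. *)
Lemma spectral_density_finite (gamma : int -> R) (p : nat) omega :
  (forall j : int, (p <= `|j|)%N -> gamma j = 0) ->
  spectral_density gamma omega =
  ((2 * pi)^-1)%:C * \sum_(0 <= k < p.*2.+1) (gamma (k%:Z - p%:Z))%:C * phase omega ^ (k%:Z - p%:Z).
Proof.
move=> g0; rewrite /spectral_density; congr (_ * _).
pose f (i : int) : R[i] := (gamma (i - p%:Z))%:C * phase omega ^ (i - p%:Z).
have f0 (i : int) : (i < 0) || ((p.*2.+1)%:Z <= i) -> f i = 0.
  by move=> h; rewrite /f g0 ?mul0r//; move/orP: h; lia.
have sumE N : (p <= N)%N -> \sum_(0 <= k < N.*2.+1) ((gamma (k%:Z - N%:Z))%:C *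
    cexp (0 +i* - ((k%:Z - N%:Z)%:~R * omega))) = \sum_(k < p.*2.+1) f k%:Z.
  move=> pN; rewrite -(@sum_int_shift _ f _ (N - p) N.*2.+1)//; last by lia.
  apply: eq_bigr => k _; rewrite cexp_phase /f.
  by have -> : k%:Z - (N - p)%N%:Z - p%:Z = k%:Z - N%:Z by lia.
rewrite big_mkord; apply: (@lim_near_cst (R[i])^o (@norm_hausdorff _ (R[i])^o)).
by exists p => // N /= pN; rewrite sumE.
Qed.

(** The pieces of the spline, extended by [0] to all integers so that lags can be added. *)
Definition spline_int (p r : nat) (i : int) : {poly R} :=
  if i is Posz n then if (n < p)%N then spline R p r n else 0 else 0.

Definition spline_cov (p r : nat) (j : int) : R :=
  \sum_(h < p) pint (spline_int p r (h%:Z + j) * spline R p r h).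

Lemma map_spline p r h : map_poly (real_complex R) (spline R p r h) = spline _ p r h.
Proof.
rewrite rmorph_sum/=; apply: eq_bigr => k _.
rewrite map_polyZ rmorphXn/= rmorphD/= map_polyX map_polyC/= rmorph_nat; congr (_ *: _).
by rewrite rmorphM/= fmorphV/= rmorph_nat rmorphM/= rmorphXn/= rmorphN1 rmorph_nat.
Qed.

(** The product of two sums over pieces, sorted by the difference of the indices. *)
Lemma spline_spectrum_cov p r (v : R[i]) : v != 0 ->
  \sum_(0 <= k < p.*2.+1) (spline_cov p r (k%:Z - p%:Z))%:C * v ^ (k%:Z - p%:Z) =
  spline_spectrum p r v.
Proof.
move=> v0; pose c (i : int) (h : nat) : R[i] := (pint (spline_int p r i * spline R p r h))%:C.
transitivity (\sum_(h < p) \sum_(0 <= k < p.*2.+1)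
    c (k%:Z - (p - h)%N%:Z) h * v ^ (k%:Z - (p - h)%N%:Z) * v ^- h).
  rewrite exchange_big/=; apply: eq_bigr => k _.
  rewrite /spline_cov rmorph_sum/= mulr_suml; apply: eq_bigr => h _.
  have hp := ltn_ord h; rewrite -mulrA; congr (_ * _).
    by rewrite /c; congr (pint (spline_int p r _ * _))%:C; lia.
  by rewrite exprnN -expfzDr//; congr (v ^ _); lia.
transitivity (\sum_(h < p) \sum_(h' < p) c h' h * v ^+ h' * v ^- h).
  apply: eq_bigr => h _.
  rewrite (@sum_int_shift _ (fun i => c i h * v ^ i * v ^- h) p); first by [].
    by have := ltn_ord h; lia.
  move=> i hi; rewrite /c; suff -> : spline_int p r i = 0 by rewrite mul0r pint0 !mul0r.
  by case: i hi => // n hi /=; rewrite ifF//; lia.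
rewrite /spline_spectrum /zak mulr_suml pint_sum exchange_big; apply: eq_bigr => h' _.
rewrite mulr_sumr pint_sum; apply: eq_bigr => h _.
have e : spline _ p r h' * spline _ p r h =
    map_poly (real_complex R) (spline R p r h' * spline R p r h).
  by rewrite rmorphM/= !map_spline.
rewrite -[in RHS]scalerAl -[in RHS]scalerAr !pintZ e pint_real /c /= ltn_ord.
by rewrite exprVn; ring.
Qed.

End SpectralSums.

(** * The kernel of the moving average *)

Section ArmaKernel.
Context {R : realType}.
Variables (a b : {poly R}) (lam : seq R[i]) (q r : nat).
Hypothesis a_zeroes : map_poly (real_complex R) a = \prod_(l <- lam) ('X - l%:P).
Hypothesis size_lam : size lam = (r + q).+1.
Hypothesis b_size : (size b <= q.+1)%N.
Hypothesis b_q : b`_q = 1.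
Local Notation p := (size lam).
Local Notation bC := (map_poly (real_complex R) b).

Definition ar_coef (D : R) (k : nat) : R := complex.Re (ar_poly lam D)`_k.

(** The kernel which represents the moving average [phi(B) Y] as an integral with
respect to the driving process. *)
Definition arma_kernel (D t : R) : R :=
  \sum_(k < p.+1) ar_coef D k * carma_kernel a b lam (t - k%:R * D).

Lemma size_ar_poly (D : R) : (size (ar_poly lam D) <= p.+1)%N.
Proof.
rewrite /ar_poly; elim: lam => [|l s IH]; first by rewrite big_nil size_poly1.
rewrite big_cons (leq_trans (size_polyMleq _ _))//=.
have h : (size (1 - (cexp (l * D%:C))%:P * 'X : {poly R[i]})%R <= 2)%N.
  rewrite (leq_trans (size_polyD _ _))// geq_max size_poly1/= size_polyN.
  by rewrite (leq_trans (size_polyMleq _ _))// size_polyX addn2/= ltnS size_polyC leq_b1.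
by rewrite -subn1 leq_subLR (leq_trans (leq_add h IH)).
Qed.

Lemma arma_kernel_nonpos D t : 0 < D -> t <= 0 -> arma_kernel D t = 0.
Proof.
move=> D0 t0; rewrite /arma_kernel big1// => k _.
rewrite (carma_kernelE _ _ a_zeroes) ifF ?mulr0//; apply/negbTE; rewrite -leNgt.
by rewrite subr_le0 (le_trans t0)// mulr_ge0// ltW.
Qed.

(** All the arguments [t - k D] are positive, so [ar_poly_kernel] applies. *)
Lemma arma_kernel_large D t : 0 < D -> p%:R * D < t -> arma_kernel D t = 0.
Proof.
move=> D0 tD; have := ar_poly_kernel bC lam D t.
rewrite (big_ord_widen p.+1 (fun k => (ar_poly lam D)`_k * entire_kernel bC lam (t - k%:R * D)))
  ?size_ar_poly// => /(congr1 (@complex.Re R)).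
rewrite big_mkcond raddf_sum/= => h; rewrite -[RHS]h; apply: eq_bigr => k _.
rewrite (carma_kernelE _ _ a_zeroes) ifT; last first.
  by rewrite subr_gt0 (le_lt_trans _ tD)// ler_wpM2r ?(ltW D0)// ler_nat -ltnS.
rewrite /ar_coef; case: ifPn => [_|]; last by rewrite -leqNgt => ks; rewrite nth_default// mul0r.
by rewrite (ar_poly_real _ a_zeroes); case: (entire_kernel _ _ _) => x y /=; rewrite mul0r subr0.
Qed.

Lemma cvg_cexp0 (l : R[i]) : cvgC (0 : R)^'+ (fun D : R => cexp (l * D%:C)) 1.
Proof.
have [K hK] := bigO_exp_taylor l 1.
apply: (cvgC_le (e := fun D => K * `|D|)).
  near=> D; have := hK D; rewrite expr1 /psum big_nat1 expr0 mulr1 /exp_fps fact0 invr1; apply.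
  rewrite ger0_norm; first by near: D; exact: nbhs_right_le.
  by near: D; exact: nbhs_right_ge.
rewrite -[X in _ --> X](mulr0 K); apply: cvgM; first exact: cvg_cst.
rewrite -[X in _ --> X](@normr0 _ R); apply: cvg_norm.
by apply: cvg_at_right_filter; exact: cvg_id.
Unshelve. all: by end_near.
Qed.

(** All the factors [1 - e^(l D) X] tend to [1 - X]. *)
Lemma cvg_ar_coef k : ar_coef D k @[D --> (0 : R)^'+] --> ((-1) ^+ k * 'C(p, k)%:R : R).
Proof.
have h : forall j, cvgC (0 : R)^'+ (fun D => (ar_poly lam D)`_j) ((1 - 'X) ^+ p : {poly R[i]})`_j.
  rewrite /ar_poly; elim: lam => [|l s IH] j.
    rewrite (_ : (fun D => _) = fun=> (1 : {poly R[i]})`_j); last first.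
      by apply/funext => D; rewrite big_nil.
    by rewrite expr0; exact: cvgC_cst.
  pose pred_coef (P : {poly R[i]}) := if j == 0%N then 0 else P`_j.-1.
  have e (c : R[i]) (P : {poly R[i]}) : ((1 - c%:P * 'X) * P)`_j = P`_j - c * pred_coef P.
    by rewrite mulrBl mul1r coefB -mulrA coefCM coefXM.
  rewrite (_ : (fun D => _) = fun D => (\prod_(l <- s) (1 - (cexp (l * D%:C))%:P * 'X))`_j -
      cexp (l * D%:C) * pred_coef (\prod_(l <- s) (1 - (cexp (l * D%:C))%:P * 'X))); last first.
    by apply/funext => D; rewrite big_cons e.
  have -> : ((1 - 'X) ^+ size (l :: s))`_j = ((1 - 'X) ^+ size s)`_j - 1 * pred_coef ((1 - 'X) ^+ size s).
    by rewrite /= exprS -[X in 1 - X]mul1r -[X in X * 'X]polyC1 e.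
  apply: cvgC_B; first exact: IH.
  apply: cvgC_M; first exact: cvg_cexp0.
  by rewrite /pred_coef; case: (j == 0%N); [exact: cvgC_cst|exact: IH].
pose proof (cvgC_Re (h k)) as hk; move: hk; rewrite coef_1BX_exp.
have -> : (-1) ^+ k * 'C(p, k)%:R = ((-1) ^+ k * 'C(p, k)%:R : R)%:C :> R[i]; last by [].
by rewrite rmorphM/= rmorphXn/= rmorphN1 rmorph_nat.
Qed.

Lemma uapprox_carma_kernel (m : nat) :
  uapprox r (fun D s => carma_kernel a b lam (D * (s + m%:R))) (fun s => (s + m%:R) ^+ r / r`!%:R).
Proof.
have bC_size : (size bC <= q.+1)%N by rewrite size_map_poly.
have bC_q : bC`_q = 1 by rewrite coef_map b_q.
have [K hK] := entire_kernel_small size_lam bC_size bC_q.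
have m1 : 0 < (m.+1)%:R :> R by [].
split.
  exists (m.+1%:R ^+ r) => s /andP[s0 s1].
  have sm : 0 <= s + m%:R by rewrite addr_ge0// ltW.
  rewrite ger0_norm ?divr_ge0 ?exprn_ge0//.
  rewrite ler_pdivrMr ?ltr0n ?fact_gt0// (@le_trans _ _ (m.+1%:R ^+ r))//.
    by rewrite lerXn2r ?nnegrE// -natr1 [leRHS]addrC lerD2r.
  by rewrite ler_peMr ?exprn_ge0// ler1n fact_gt0.
move=> e e0; pose B := `|K| * m.+1%:R ^+ r.+1 + 1.
have B0 : 0 < B by rewrite ltr_wpDl// mulr_ge0// exprn_ge0.
near=> D => s /andP[s0 s1].
have D0 : 0 < D by near: D; exact: nbhs_right_gt.
have D1 : D <= m.+1%:R^-1 by near: D; apply: nbhs_right_le; rewrite invr_gt0.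
have De : D <= e / B by near: D; apply: nbhs_right_le; rewrite divr_gt0.
have sm : 0 < s + m%:R by rewrite ltr_wpDr.
have sm1 : s + m%:R <= m.+1%:R by rewrite -natr1 [leRHS]addrC lerD2r.
set t := D * (s + m%:R).
have t0 : 0 < t by rewrite mulr_gt0.
have tm : t <= D * m.+1%:R by rewrite ler_wpM2l// ltW.
have t1 : `|t| <= 1.
  rewrite gtr0_norm// (le_trans tm)// -ler_pdivlMr// div1r//.
rewrite (carma_kernelE _ _ a_zeroes) t0.
have := hK t t1; rewrite gtr0_norm// => hG.
have -> : complex.Re (entire_kernel bC lam t) - D ^+ r * ((s + m%:R) ^+ r / r`!%:R) =
    complex.Re (entire_kernel bC lam t - exp_fps R r * t%:C ^+ r).
  rewrite raddfB/=; congr (_ - _).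
  have -> : exp_fps R r * t%:C ^+ r = (r`!%:R^-1 * t ^+ r)%:C.
    have eV : (r`!%:R : R[i])^-1 = (r`!%:R^-1)%:C by rewrite fmorphV/= rmorph_nat.
    by rewrite /exp_fps eV -rmorphXn -rmorphM.
  by rewrite /t exprMn /= [in RHS]mulrCA [r`!%:R^-1 * _]mulrC.
apply: le_trans (Re_le_cnorm _) _; apply: le_trans hG _.
have K1 : K * t ^+ r.+1 <= `|K| * (D * m.+1%:R) ^+ r.+1.
  apply: (@le_trans _ _ (`|K| * t ^+ r.+1)).
    by rewrite ler_wpM2r ?ler_norm// exprn_ge0// ltW.
  by rewrite ler_wpM2l// lerXn2r ?nnegrE ?(ltW t0)// (le_trans (ltW t0)).
apply: le_trans K1 _.
have eD : `|K| * (D * m.+1%:R) ^+ r.+1 = D * (`|K| * m.+1%:R ^+ r.+1) * D ^+ r.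
  by rewrite exprMn (exprS D); ring.
rewrite eD.
rewrite ler_wpM2r ?exprn_ge0 ?(ltW D0)//.
rewrite (@le_trans _ _ (D * B))// ?ler_wpM2l ?(ltW D0)// ?lerDl//.
by rewrite -ler_pdivlMr.
Unshelve. all: by end_near.
Qed.

(** Only the terms with [k <= h] have a positive argument. *)
Lemma uapprox_arma_kernel h : (h < p)%N ->
  uapprox r (fun D s => arma_kernel D (D * (s + h%:R))) (fun s => (spline R p r h).[s]).
Proof.
move=> hp.
apply: (@near_uapprox _ _ (fun D s => \sum_(k < h.+1) ar_coef D k * carma_kernel a b lam (D * (s + (h - k)%:R)))).
  near=> D => s /andP[s0 s1].
  have D0 : 0 < D by near: D; exact: nbhs_right_gt.
  pose F k := ar_coef D k * carma_kernel a b lam (D * (s + (h - k)%:R)).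
  have hp1 : (h.+1 <= p.+1)%N by rewrite ltnS ltnW.
  apply: (etrans (big_ord_widen p.+1 F hp1)).
  rewrite big_mkcond /F; apply: eq_bigr => k _; case: ifPn => [kh|].
    congr (_ * carma_kernel _ _ _ _); rewrite natrB//; ring.
  rewrite -leqNgt => hk; rewrite (carma_kernelE _ _ a_zeroes) ifF ?mulr0//.
  apply/negbTE; rewrite -leNgt subr_le0 mulrC ler_wpM2r ?(ltW D0)//.
  by rewrite (@le_trans _ _ h.+1%:R) ?ler_nat// -natr1 [leRHS]addrC lerD2r.
have -> : (fun s => (spline R p r h).[s]) =
    fun s => \sum_(k < h.+1) ((-1) ^+ k * 'C(p, k)%:R) * ((s + (h - k)%:R) ^+ r / r`!%:R).
  apply/funext => s; rewrite horner_sum; apply: eq_bigr => k _.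
  by rewrite hornerZ horner_exp hornerD hornerX hornerC -!mulrA [r`!%:R^-1 * _]mulrC.
apply: uapprox_sum => k; have := uapproxM (uapprox_cst (@cvg_ar_coef k)) (uapprox_carma_kernel (h - k)).
by rewrite add0n.
Unshelve. all: by end_near.
Qed.

Lemma uapprox_arma_kernel_int (i : int) :
  uapprox r (fun D s => arma_kernel D (D * (s + i%:~R))) (fun s => (spline_int p r i).[s]).
Proof.
have vanish : (forall D s, 0 < D -> 0 < s <= 1 -> arma_kernel D (D * (s + i%:~R)) = 0) ->
    uapprox r (fun D s => arma_kernel D (D * (s + i%:~R))) (fun s => (0 : {poly R}).[s]).
  move=> h; apply: (@near_uapprox _ _ (fun _ _ => 0)).
    near=> D => s s01; rewrite h//; near: D; exact: nbhs_right_gt.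
  have -> : (fun s => (0 : {poly R}).[s]) = fun=> 0 by apply/funext => s; rewrite horner0.
  exact: uapprox0.
case: i vanish => n vanish /=.
  case: ifPn => [np|]; first exact: uapprox_arma_kernel.
  rewrite -leqNgt => pn; apply: vanish => D s D0 /andP[s0 s1].
  apply: arma_kernel_large => //; rewrite mulrC ltr_pM2l//.
  by rewrite (@le_lt_trans _ _ n%:R) ?ler_nat// ltrDr.
apply: vanish => D s D0 /andP[s0 s1]; apply: arma_kernel_nonpos => //.
apply: mulr_ge0_le0; first exact: ltW.
by rewrite NegzE rmorphN/= subr_le0 (le_trans s1)// ler1n.
Unshelve. all: by end_near.
Qed.

Definition arma_cov (D : R) (j : int) : R :=
  ip lebesgue_measure (fun u => arma_kernel D (j%:~R * D - u)) (fun u => arma_kernel D (- u)).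

Hypothesis sq_arma_kernel : forall D x, 0 < D ->
  sq_integrable lebesgue_measure (fun u => arma_kernel D (x - u)).

Let integrand (D : R) (j : int) (u : R) := arma_kernel D (j%:~R * D - u) * arma_kernel D (- u).

Let integrable_integrand D j : 0 < D ->
  lebesgue_measure.-integrable setT (EFin \o integrand D j).
Proof.
move=> D0; have s0 : sq_integrable lebesgue_measure (fun u => arma_kernel D (- u)).
  have e : (fun u => arma_kernel D (- u)) = fun u => arma_kernel D (0 - u).
    by apply/funext => u; rewrite sub0r.
  by rewrite e; exact: sq_arma_kernel.
exact: (sq_integrable_mul (sq_arma_kernel (j%:~R * D) D0) s0).
Qed.

(** The support of the kernel is cut into the cells [[k D, (k + 1) D]], on each of which the
kernel is governed by one polynomial piece of the spline. *)
Lemma arma_cov_split D j : 0 < D -> arma_cov D j =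
  \sum_(h < p) \int[lebesgue_measure]_(u in `[- (h%:R * D) - D, - (h%:R * D)[) integrand D j u.
Proof.
move=> D0; have intT := integrable_integrand j D0.
have part n : \int[lebesgue_measure]_(u in `[- (n%:R * D), 0[) integrand D j u =
    \sum_(h < n) \int[lebesgue_measure]_(u in `[- (h%:R * D) - D, - (h%:R * D)[) integrand D j u.
  elim: n => [|n IH].
    by rewrite big_ord0 mul0r oppr0 set_itvco0 Rintegral_set0.
  rewrite big_ord_recr/= -IH addrC.
  have -> : `[- (n.+1%:R * D), 0[%classic =
      `[- (n%:R * D) - D, - (n%:R * D)[%classic `|` `[- (n%:R * D), 0[%classic :> set R.
    have -> : - (n.+1%:R * D) = - (n%:R * D) - D by rewrite -natr1; ring.
    rewrite -itv_bndbnd_setU// bnd_simp; last by rewrite oppr_le0 mulr_ge0// ltW.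
    by rewrite gerBl ltW.
  apply: Rintegral_setU => //.
    by apply: (integrableS _ _ _ intT) => //; exact: measurableU.
  apply/disj_setPS => u [] /=; rewrite !in_itv/= => /andP[_ u1] /andP[u2 _].
  by have := lt_le_trans u1 u2; rewrite ltxx.
rewrite -part /arma_cov /ip [RHS]Rintegral_mkcond; apply: eq_Rintegral => u _.
rewrite patchE; case: ifPn => // /negP uA; rewrite -/(integrand D j u) /integrand.
have [u0|u0] := leP 0 u.
  by rewrite (@arma_kernel_nonpos D (- u)) ?oppr_le0// mulr0.
rewrite (@arma_kernel_large D (- u)) ?mulr0//.
rewrite ltNge; apply/negP => h; apply: uA; rewrite inE/= in_itv/= u0 andbT.
by rewrite lerNl.
Qed.

Lemma cvg_arma_cov (j : int) :
  arma_cov D j / D ^+ (r + r).+1 @[D --> (0 : R)^'+] --> spline_cov p r j.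
Proof.
have piece (h : 'I_p) :
    (\int[lebesgue_measure]_(u in `[- (h%:R * D) - D, - (h%:R * D)[) integrand D j u)
      / D ^+ (r + r).+1 @[D --> (0 : R)^'+] --> pint (spline_int p r (h%:Z + j) * spline R p r h).
  have [_ ap] := uapproxM (uapprox_arma_kernel_int (h%:Z + j)) (uapprox_arma_kernel (ltn_ord h)).
  apply/cvgrPdist_le => e e0; near=> D.
  have D0 : 0 < D by near: D; exact: nbhs_right_gt.
  have Dr : 0 < D ^+ (r + r) by rewrite exprn_gt0.
  have apD : forall s, 0 < s <= 1 ->
    `|arma_kernel D (D * (s + (h%:Z + j)%:~R)) * arma_kernel D (D * (s + h%:R)) -
      D ^+ (r + r) * ((spline_int p r (h%:Z + j)).[s] * (spline R p r h).[s])| <= e * D ^+ (r + r).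
    by near: D; exact: ap.
  have := @itv_integral_approx _ (integrand D j)
    (D ^+ (r + r) *: (spline_int p r (h%:Z + j) * spline R p r h)) (- (h%:R * D)) D (e * D ^+ (r + r)) D0.
  have iJ : lebesgue_measure.-integrable `[- (h%:R * D) - D, - (h%:R * D)[ (EFin \o integrand D j).
    by apply: (integrableS _ _ _ (integrable_integrand j D0)).
  rewrite pintZ => /(_ iJ) H.
  have {}H := H _; set I := Rintegral _ _ _ in H *; set G := pint _ in H *.
  have -> : G - I / D ^+ (r + r).+1 = - ((I - D * (D ^+ (r + r) * G)) / D ^+ (r + r).+1).
    by rewrite exprS; field; rewrite !lt0r_neq0.
  rewrite normrN normrM normfV (gtr0_norm (exprn_gt0 _ D0)) ler_pdivrMr ?exprn_gt0//.
  have -> : e * D ^+ (r + r).+1 = e * D ^+ (r + r) * D by rewrite exprSr mulrA.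
  apply: H => s s01.
  rewrite /integrand hornerZ hornerM.
  have -> : j%:~R * D - (- (h%:R * D) - D * s) = D * (s + (h%:Z + j)%:~R) by rewrite intrD; ring.
  have -> : - (- (h%:R * D) - D * s) = D * (s + h%:R) by ring.
  exact: apD.
have e : \forall D \near (0 : R)^'+, \sum_(h < p)
    (\int[lebesgue_measure]_(u in `[- (h%:R * D) - D, - (h%:R * D)[) integrand D j u) / D ^+ (r + r).+1
    = arma_cov D j / D ^+ (r + r).+1.
  near=> D; rewrite arma_cov_split ?mulr_suml//; near: D; exact: nbhs_right_gt.
apply: cvg_trans; first exact: near_eq_cvg e.
by apply: cvg_big => [|h _]; [exact: add_continuous|exact: piece].
Unshelve. all: by end_near.
Qed.

End ArmaKernel.

(** * Autocovariances of a moving average *)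

Lemma ip_bilinear {d : measure_display} {T : measurableType d} {R : realType}
    {mu : {measure set T -> \bar R}} (I : finType) (c : I -> R) (F G : I -> T -> R) :
  (forall i, sq_integrable mu (F i)) -> (forall i, sq_integrable mu (G i)) ->
  ip mu (fun x => \sum_i c i * F i x) (fun x => \sum_i c i * G i x) =
  \sum_i \sum_k c i * c k * ip mu (F i) (G k).
Proof.
move=> sF sG; have sZF i := sq_integrableZ (c i) (sF i); have sZG i := sq_integrableZ (c i) (sG i).
have sSG : sq_integrable mu (fun x => \sum_i c i * G i x) by exact: sq_integrable_sum.
rewrite ip_suml//; apply: eq_bigr => i _; rewrite ip_sumr//; apply: eq_bigr => k _.
by rewrite ipZl// ipZr// mulrA.
Qed.

Section MovingAverage.
Context {d : measure_display} {T : measurableType d} {R : realType}.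
Variable P : probability T R.

Lemma expectation_ip (X : T -> R) : sq_integrable P X ->
  'E_P[X]%E = (ip P X (fun=> 1))%:E.
Proof.
move=> sX; have sX1 := sq_integrable_mul sX (@sq_integrable_cst _ _ _ P 1).
rewrite unlock /ip /Rintegral fineK; last exact: integrable_fin_num.
by congr integral; apply/funext => w; rewrite mulr1.
Qed.

(** The covariance is an inner product because the variables are centred. *)
Lemma autocov_ip (W : int -> T -> R) (h : int) :
  (forall n, sq_integrable P (W n)) -> (forall n, ip P (W n) (fun=> 1) = 0) ->
  autocov P W h = ip P (W h) (W 0).
Proof.
move=> sW W0; rewrite /autocov covariance.unlock (expectation_ip (sW h)) (expectation_ip (sW 0)) !W0/= unlock.
congr (fine (integral _ _ _)); apply/funext => w; congr EFin.
have -> : ((W h \- cst 0) * (W 0 \- cst 0)) w = (W h w - 0) * (W 0 w - 0) by [].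
by rewrite !subr0.
Qed.

Variables (theta : {poly R}) (Z : int -> {RV P >-> R}).
Hypothesis Z_noise : white_noise Z.
Local Notation W := (backshift theta (fun m => Z m : T -> R)).

Lemma sq_integrable_noise n : sq_integrable P (Z n).
Proof. exact/Lfun2_sq_integrable/(noise_L2 Z_noise). Qed.

Lemma sq_integrable_backshift n : sq_integrable P (W n).
Proof.
have := @sq_integrable_sum _ _ _ P _ (index_enum 'I_(size theta))
  (fun (k : 'I_(size theta)) w => theta`_k * Z (n - k%:Z) w).
by apply => k; apply: sq_integrableZ; exact: sq_integrable_noise.
Qed.

Lemma autocov_backshift h : autocov P W h = ip P (W h) (W 0).
Proof.
apply: autocov_ip => [n|n]; first exact: sq_integrable_backshift.
have s1 := @sq_integrable_cst _ _ _ P 1.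
rewrite (ip_suml (index_enum 'I_(size theta))
  (F := fun (k : 'I_(size theta)) w => theta`_k * Z (n - k%:Z) w)) //; last first.
  by move=> k; apply: sq_integrableZ; exact: sq_integrable_noise.
rewrite big1// => k _; have sZ := sq_integrable_noise (n - k%:Z).
rewrite ipZl//; have := expectation_ip sZ; rewrite (noise_mean Z_noise).
by case=> <-; rewrite mulr0.
Qed.

End MovingAverage.

(** * Autocovariances of the sampled process *)

Section SampledAutocovariance.
Context {d : measure_display} {T : measurableType d} {R : realType}.
Variable P : probability T R.
Variables (L : R -> {RV P >-> R}) (sigma : R) (a b : {poly R}) (lam : seq R[i]).
Variable (Y : R -> {RV P >-> R}).
Hypothesis L_levy : levy_process L.
Hypothesis L2 : forall t, (L t : T -> R) \in Lfun P 2%:E.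
Hypothesis L_mean : ('E_P[L 1%R] = 0)%E.
Hypothesis L_var : ('E_P[fun w => (L 1%R w ^+ 2)%R] = (sigma ^+ 2)%:E)%E.
Hypothesis a_zeroes : map_poly (real_complex R) a = \prod_(l <- lam) ('X - l%:P).
Hypothesis Y_carma : carma_process P (fun t => L t : T -> R) a b lam (fun t => Y t : T -> R).
Local Notation p := (size lam).
Local Notation g := (carma_kernel a b lam).

Lemma sq_integrable_carma_kernel t : sq_integrable lebesgue_measure (fun u => g (t - u)).
Proof. by have [] := levy_integral_sq_integrable L2 (Y_carma t). Qed.

Lemma sq_integrable_carma t : sq_integrable P (Y t).
Proof. by have [] := levy_integral_sq_integrable L2 (Y_carma t). Qed.

Let arma_kernelE D x : (fun u => arma_kernel a b lam D (x - u)) =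
  fun u => \sum_(k < p.+1) ar_coef lam D k * g ((x - k%:R * D) - u).
Proof.
by apply/funext => u; apply: eq_bigr => k _; congr (_ * g _); rewrite addrAC.
Qed.

Lemma sq_integrable_arma_kernel D x :
  sq_integrable lebesgue_measure (fun u => arma_kernel a b lam D (x - u)).
Proof.
rewrite arma_kernelE.
have := @sq_integrable_sum _ _ _ lebesgue_measure _ (index_enum 'I_p.+1)
  (fun (k : 'I_p.+1) u => ar_coef lam D k * g ((x - k%:R * D) - u)).
by apply => k; apply: sq_integrableZ; exact: sq_integrable_carma_kernel.
Qed.

Variables (theta : {poly R}) (Z : int -> {RV P >-> R}) (D : R).
Hypothesis Y_arma : arma_representation (fun t => Y t : T -> R) lam D theta Z.

Let V (n : int) w := \sum_(k < p.+1) ar_coef lam D k * Y (n%:~R * D - k%:R * D) w.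

Let sq_integrable_V n : sq_integrable P (V n).
Proof.
have := @sq_integrable_sum _ _ _ P _ (index_enum 'I_p.+1)
  (fun (k : 'I_p.+1) w => ar_coef lam D k * Y (n%:~R * D - k%:R * D) w).
by apply => k; apply: sq_integrableZ; exact: sq_integrable_carma.
Qed.

(** The filtered process is real although the equation is complex: its real part only involves
the real parts of the coefficients. *)
Let ae_V n : {ae P, forall w, backshift theta (fun m => Z m : T -> R) n w = V n w}.
Proof.
apply: filterS (Y_arma.2 n) => w /(congr1 (@complex.Re R)) /= <-.
pose F (k : nat) := (ar_poly lam D)`_k * (sampled (fun t => Y t : T -> R) D (n - k%:Z) w)%:C.
rewrite /backshift [X in complex.Re X](big_ord_widen p.+1 F (size_ar_poly lam D)).
rewrite big_mkcond raddf_sum/=; apply: eq_bigr => k _; rewrite /F /sampled.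
have -> : (n - k%:Z)%:~R * D = n%:~R * D - k%:R * D by rewrite intrB; ring.
rewrite /ar_coef; case: ifPn => [_|]; last by rewrite -leqNgt => ks; rewrite nth_default// mul0r.
by case: (_`_k) => x y /=; rewrite mulr0 subr0.
Qed.

Lemma autocov_sampled j :
  autocov P (backshift theta (fun m => Z m : T -> R)) j = sigma ^+ 2 * arma_cov a b lam D j.
Proof.
have Zn := Y_arma.1.
rewrite autocov_backshift// (eq_ip_ae (sq_integrable_backshift theta Zn j).1 (sq_integrable_V j).1
  (sq_integrable_backshift theta Zn 0).1 (sq_integrable_V 0).1 (ae_V j) (ae_V 0)).
pose KV (n : int) (u : R) := \sum_(k < p.+1) ar_coef lam D k * g ((n%:~R * D - k%:R * D) - u).
have sKV n : sq_integrable lebesgue_measure (KV n).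
  by rewrite /KV -arma_kernelE; exact: sq_integrable_arma_kernel.
have -> : arma_cov a b lam D j = ip lebesgue_measure (KV j) (KV 0).
  have e1 (u : R) : arma_kernel a b lam D (j%:~R * D - u) = KV j u.
    exact: (congr1 (fun f => f u) (arma_kernelE D (j%:~R * D))).
  have e2 (u : R) : arma_kernel a b lam D (- u) = KV 0 u.
    rewrite -[- u]add0r -(mul0r D).
    exact: (congr1 (fun f => f u) (arma_kernelE D (0%:~R * D))).
  apply: eq_Rintegral => u _.
  exact: (f_equal2 (fun x y => x * y) (e1 u) (e2 u)).
have eY : ip P (V j) (V 0) = _ := ip_bilinear (fun k : 'I_p.+1 => ar_coef lam D k)
  (fun k : 'I_p.+1 => sq_integrable_carma (j%:~R * D - k%:R * D))
  (fun k : 'I_p.+1 => sq_integrable_carma (0%:~R * D - k%:R * D)).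
have eK : ip lebesgue_measure (KV j) (KV 0) = _ := ip_bilinear (fun k : 'I_p.+1 => ar_coef lam D k)
  (fun k : 'I_p.+1 => sq_integrable_carma_kernel (j%:~R * D - k%:R * D))
  (fun k : 'I_p.+1 => sq_integrable_carma_kernel (0%:~R * D - k%:R * D)).
rewrite eY eK mulr_sumr; apply: eq_bigr => k _; rewrite mulr_sumr; apply: eq_bigr => l _.
by rewrite (levy_isometry L_levy L2 L_mean L_var (Y_carma _) (Y_carma _)) mulrCA.
Qed.

End SampledAutocovariance.

(** * The spectral density of the moving average *)

Section SpectralDensity.
Context {d : measure_display} {T : measurableType d} {R : realType}.
Variable P : probability T R.
Variables (L : R -> {RV P >-> R}) (sigma : R) (a b : {poly R}) (lam : seq R[i]).
Variables (q r : nat) (Y : R -> {RV P >-> R}).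
Variables (theta : R -> {poly R}) (Z : R -> int -> {RV P >-> R}).
Hypothesis L_levy : levy_process L.
Hypothesis L2 : forall t, (L t : T -> R) \in Lfun P 2%:E.
Hypothesis L_mean : ('E_P[L 1%R] = 0)%E.
Hypothesis L_var : ('E_P[fun w => (L 1%R w ^+ 2)%R] = (sigma ^+ 2)%:E)%E.
Hypothesis sigma_gt0 : 0 < sigma.
Hypothesis a_zeroes : map_poly (real_complex R) a = \prod_(l <- lam) ('X - l%:P).
Hypothesis size_lam : size lam = (r + q).+1.
Hypothesis b_size : (size b <= q.+1)%N.
Hypothesis b_q : b`_q = 1.
Hypothesis Y_carma : carma_process P (fun t => L t : T -> R) a b lam (fun t => Y t : T -> R).
Hypothesis Y_arma : forall D : R, 0 < D ->
  arma_representation (fun t => Y t : T -> R) lam D (theta D) (Z D).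
Local Notation p := (size lam).

Let sqK D x (_ : 0 < D) := sq_integrable_arma_kernel L2 Y_carma D x.

Lemma arma_cov_large D (j : int) : 0 < D -> (p <= `|j|)%N -> arma_cov a b lam D j = 0.
Proof.
move=> D0 pj; have vanish (u : R) :
    arma_kernel a b lam D (j%:~R * D - u) * arma_kernel a b lam D (- u) = 0.
  have [u0|u0] := leP 0 u.
    by rewrite (@arma_kernel_nonpos _ _ b _ a_zeroes D (- u)) ?oppr_le0// mulr0.
  have [pu|pu] := ltP (p%:R * D) (- u).
    by rewrite (@arma_kernel_large _ _ b _ a_zeroes D (- u)) ?mulr0.
  have [j0|j0] := leP 0 j.
    rewrite (@arma_kernel_large _ _ b _ a_zeroes D (j%:~R * D - u)) ?mul0r//.
    have pj' : p%:R <= j%:~R :> R by rewrite -[p%:R]/(p%:Z%:~R) ler_int; lia.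
    by have := ler_wpM2r (ltW D0) pj'; lra.
  rewrite (@arma_kernel_nonpos _ _ b _ a_zeroes D (j%:~R * D - u)) ?mul0r//.
  have pj' : p%:R <= - j%:~R :> R by rewrite -[p%:R]/(p%:Z%:~R) -rmorphN/= ler_int; lia.
  by have := ler_wpM2r (ltW D0) pj'; rewrite mulNr; lra.
rewrite /arma_cov /ip (@eq_Rintegral _ _ _ _ setT (cst 0)); last by move=> u _; exact: vanish.
by rewrite /Rintegral integral0.
Qed.

Lemma f_MA_finite D omega : 0 < D ->
  f_MA (theta D) (Z D) omega = (sigma ^+ 2 / (2 * pi))%:C *
    \sum_(0 <= k < p.*2.+1) (arma_cov a b lam D (k%:Z - p%:Z))%:C * phase omega ^ (k%:Z - p%:Z).
Proof.
move=> D0; have autocovE := autocov_sampled L_levy L2 L_mean L_var Y_carma (Y_arma D0).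
rewrite /f_MA (@spectral_density_finite _ _ p); last first.
  by move=> j pj; rewrite autocovE arma_cov_large// mulr0.
have -> : (sigma ^+ 2 / (2 * pi))%:C = ((2 * pi)^-1)%:C * (sigma ^+ 2)%:C :> R[i].
  by rewrite -rmorphM mulrC.
rewrite -mulrA; congr (_ * _); rewrite mulr_sumr; apply: eq_bigr => k _.
by rewrite autocovE rmorphM mulrA.
Qed.

(** Only the lags less than [p] in modulus contribute, so the limit may be taken in each of
the autocovariances. *)
Lemma cvg_f_MA omega :
  cvgC (0 : R)^'+ (fun D => f_MA (theta D) (Z D) omega / (D ^+ (r + r).+1)%:C)
    ((sigma ^+ 2 / (2 * pi))%:C * spline_spectrum p r (phase omega)).
Proof.
apply: (@near_cvgC _ _ _ _ (fun D => (sigma ^+ 2 / (2 * pi))%:C *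
    \sum_(0 <= k < p.*2.+1) (arma_cov a b lam D (k%:Z - p%:Z) / D ^+ (r + r).+1)%:C * phase omega ^ (k%:Z - p%:Z))).
  near=> D; have D0 : 0 < D by near: D; exact: nbhs_right_gt.
  rewrite f_MA_finite// -mulrA; congr (_ * _); rewrite mulr_suml; apply: eq_bigr => k _.
  by rewrite mulrAC rmorphM/= fmorphV.
rewrite -spline_spectrum_cov ?phase_neq0//.
apply: cvgC_M; first exact: cvgC_cst.
apply: cvgC_sum => k _; apply: cvgC_M; last exact: cvgC_cst.
apply/cvgC_real; exact: (cvg_arma_cov a_zeroes size_lam b_size b_q sqK).
Unshelve. all: by end_near.
Qed.

Lemma f_MA_equiv omega (F : R) :
  (F%:C = spline_spectrum p r (phase omega)) -> F != 0 ->
  asymp_equiv (fun D => f_MA (theta D) (Z D) omega)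
    (fun D => (sigma ^+ 2 / (2 * pi) * D ^+ (r + r).+1 * F)%:C).
Proof.
move=> FE F0; apply/cvg_cnorm.
have s0 : sigma ^+ 2 / (2 * pi) != 0.
  by rewrite mulf_neq0 ?invr_neq0 ?expf_neq0 ?gt_eqF// mulr_gt0// pi_gt0.
have c0 : (sigma ^+ 2 / (2 * pi) * F)%:C != 0 :> R[i].
  by rewrite (fmorph_eq0 (real_complex R)) mulf_neq0.
pose proof (cvg_f_MA omega) as h; rewrite -FE -rmorphM/= in h.
have hc : cvgC (0 : R)^'+ (fun=> (sigma ^+ 2 / (2 * pi) * F)%:C^-1) (sigma ^+ 2 / (2 * pi) * F)%:C^-1.
  exact: cvgC_cst.
pose proof (cvgC_M h hc) as h2.
rewrite mulfV// in h2; apply: near_cvgC h2.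
near=> D; have D0 : 0 < D by near: D; exact: nbhs_right_gt.
rewrite -mulrA -invfM -rmorphM/=; congr (_ / _%:C); ring.
Unshelve. all: by end_near.
Qed.

End SpectralDensity.

(** * The spectrum of the spline near the zero frequency *)

Section SplineSpectrumReal.
Context {R : realType}.

Lemma Re_spline_spectrum p r (omega : R) :
  complex.Re (spline_spectrum p r (phase omega)) =
  \sum_(0 <= k < p.*2.+1) spline_cov p r (k%:Z - p%:Z) * cos ((k%:Z - p%:Z)%:~R * omega).
Proof.
rewrite -spline_spectrum_cov ?phase_neq0// raddf_sum; apply: eq_bigr => k _.
by rewrite -cexp_phase /cexp/= expR0 !mul1r mul0r subr0 cosN.
Qed.

Lemma phase0 : phase (0 : R) = 1.
Proof. by rewrite /phase cos0 sin0 oppr0. Qed.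

Lemma spline_spectrum1_real p r : (complex.Re (spline_spectrum p r (1 : R[i])))%:C = spline_spectrum p r 1.
Proof.
rewrite -[X in complex.Re (spline_spectrum _ _ X)]phase0 Re_spline_spectrum -spline_spectrum_cov ?oner_eq0//.
rewrite rmorph_sum; apply: eq_bigr => k _.
by rewrite exp1rz mulr0 cos0 mulr1 mulr1.
Qed.

(** The real part is a trigonometric polynomial in [omega]. *)
Lemma cvg_Re_spline_spectrum p r :
  complex.Re (spline_spectrum p r (phase omega)) @[omega --> (0 : R)^'] -->
  complex.Re (spline_spectrum p r (1 : R[i])).
Proof.
pose F (omega : R) := \sum_(0 <= k < p.*2.+1) spline_cov p r (k%:Z - p%:Z) * cos ((k%:Z - p%:Z)%:~R * omega).
have e omega : complex.Re (spline_spectrum p r (phase omega)) = F omega := Re_spline_spectrum p r omega.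
have e1 : F 0 = complex.Re (spline_spectrum p r (1 : R[i])) by rewrite -e phase0.
suff h : F omega @[omega --> (0 : R)^'] --> F 0.
  have eF : (fun omega => complex.Re (spline_spectrum p r (phase omega))) = F by exact/funext.
  exact: (eq_ind_r (fun f : R -> R => f omega @[omega --> (0 : R)^'] --> _)
    (eq_ind _ (fun l => F omega @[omega --> (0 : R)^'] --> l) h _ e1) eF).
apply: cvg_big => [|k _]; first exact: add_continuous.
apply: cvgM; first exact: cvg_cst.
apply: continuous_cvg; first exact: continuous_cos.
by apply: cvgM; [exact: cvg_cst|exact: nbhs_dnbhs].
Qed.

Lemma cos_neq1 (omega : R) : - pi <= omega <= pi -> omega != 0 -> cos omega != 1.
Proof.
move=> /andP[h1 h2] o0; apply: contra_neq o0; rewrite -cos0 => h.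
have c : cos `|omega| = cos 0.
  by have [ge0|lt0] := leP 0 omega; [rewrite ger0_norm|rewrite ltr0_norm// cosN].
have /eqP : `|omega| = 0.
  by apply: cos_inj c; rewrite in_itv/= ?lexx ?pi_ge0// normr_ge0 ler_norml h1.
by rewrite normr_eq0 => /eqP.
Qed.

End SplineSpectrumReal.

Theorem theorem3p1 (d : measure_display) (T : measurableType d) (R : realType)
    (P : probability T R)
    (L : R -> {RV P >-> R}) (sigma : R)
    (p q : nat) (a b : {poly R}) (lam : seq R[i])
    (Y : R -> {RV P >-> R})
    (theta : R -> {poly R}) (Z : R -> int -> {RV P >-> R})
    (L_levy : levy_process L)
    (L_second_order : forall t, (L t : T -> R) \in Lfun P 2%:E)
    (L_mean : ('E_P[L 1%R] = 0)%E)
    (L_var : ('E_P[fun w => (L 1%R w ^+ 2)%R] = (sigma ^+ 2)%:E)%E)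
    (sigma_gt0 : 0 < sigma)
    (lt_qp : (q < p)%N)
    (a_monic : a \is monic) (a_size : size a = p.+1)
    (b_q : b`_q = 1) (b_gtq : forall j : nat, (q < j)%N -> b`_j = 0)
    (a_zeroes : map_poly (real_complex R) a = \prod_(l <- lam) ('X - l%:P))
    (no_common_zero : forall z : R[i],
      ~ (root (map_poly (real_complex R) a) z /\
         root (map_poly (real_complex R) b) z))
    (a_stable : forall z : R[i],
      root (map_poly (real_complex R) a) z -> complex.Re z < 0)
    (Y_carma : carma_process P (fun t => L t : T -> R) a b lam
                 (fun t => Y t : T -> R))
    (theta_size : forall D : R, 0 < D -> (size (theta D) <= p)%N)
    (Y_arma : forall D : R, 0 < D ->
      arma_representation (fun t => Y t : T -> R) lam D (theta D) (Z D)) :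
  [/\ (* the expansion defining c_k *)
      forall omega : R, - pi <= omega <= pi -> omega != 0 ->
        \forall x \near (0 : R),
          \sum_(0 <= k < n) c_coef k omega * x ^+ (2 * k + 1) @[n --> \oo]
            --> sinh x / (cosh x - cos omega),
      forall omega : R, - pi <= omega <= pi -> omega != 0 ->
        asymp_equiv
          (fun D => f_MA (theta D) (Z D) omega)
          (fun D => (sigma ^+ 2 / (2 * pi) * (-1) ^+ (p - q - 1) *
                     D ^+ (2 * (p - q) - 1) * c_coef (p - q - 1) omega *
                     2 ^+ (p - 1) * (1 - cos omega) ^+ p)%:C),
      (* omega = 0, where c_k is singular: for q = 0 the right-hand side
         extends continuously to a nonzero value; for 0 < q it extends by 0 *)
      q = 0%N ->
        exists kappa : R,
          c_coef (p - q - 1) omega * 2 ^+ (p - 1) * (1 - cos omega) ^+ p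
            @[omega --> (0 : R)^'] --> kappa /\
          asymp_equiv
            (fun D => f_MA (theta D) (Z D) 0)
            (fun D => (sigma ^+ 2 / (2 * pi) * (-1) ^+ (p - q - 1) *
                       D ^+ (2 * (p - q) - 1) * kappa)%:C)
    & forall omega : R, - pi <= omega <= pi -> omega != 0 ->
        [/\ c_coef 0 omega = 1 / (1 - cos omega),
            c_coef 1 omega = - ((2 + cos omega) / (6 * (1 - cos omega) ^+ 2))
          & c_coef 2 omega = (33 + 26 * cos omega + cos (2 * omega)) /
                             (240 * (1 - cos omega) ^+ 3)] ].
Proof.
have size_lamE : size lam = p.
  by apply: succn_inj; rewrite -a_size -(size_map_poly (real_complex R)) a_zeroes size_prod_XsubC.
have size_b : (size b <= q.+1)%N by apply/leq_sizeP => j; exact: b_gtq.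
have p0 : (0 < p)%N by exact: leq_ltn_trans lt_qp.
have -> : (2 * (p - q) - 1 = ((p - q - 1) + (p - q - 1)).+1)%N by lia.
have rp : (p - q - 1 < p)%N by lia.
have rq : p = ((p - q - 1) + q).+1 by lia.
have q0r : q = 0%N -> (p - q - 1)%N = p.-1 by lia.
set r := (p - q - 1)%N in rp rq q0r *; rewrite (subn1 p).
have size_rq : size lam = (r + q).+1 by rewrite size_lamE.
have equiv omega := f_MA_equiv L_levy L_second_order L_mean L_var sigma_gt0 a_zeroes
  size_rq size_b b_q Y_carma Y_arma (omega := omega).
rewrite size_lamE in equiv.
split.
- by move=> omega opi o0; apply: c_coef_series; exact: cos_neq1.
- move=> omega opi o0; have c1 := cos_neq1 opi o0.
  have E := spline_spectrumE p0 rp c1.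
  have N : spline_spectrum p r (phase omega) != 0.
    apply: spline_spectrum_neq0 => //; [exact: phase_neq0|exact: conj_phase|].
    by move=> /(congr1 (@complex.Re R)) /= h; rewrite h eqxx in c1.
  rewrite -/(phase omega) in E.
  have := equiv omega _ (esym E); rewrite E (fmorph_eq0 (real_complex R)) in N => /(_ N).
  by congr asymp_equiv; apply/funext => D; congr (_%:C); ring.
- move=> q0; have N : spline_spectrum p r (1 : R[i]) != 0.
    by apply: spline_spectrum_neq0; rewrite ?oner_eq0 ?invr1 ?rmorph1// => _; exact: q0r.
  have F := spline_spectrum1_real (R := R) p r; have F1 := F.
  rewrite -{1}F (fmorph_eq0 (real_complex R)) in N.
  rewrite -[X in _ = spline_spectrum _ _ X]phase0 in F1; have := equiv 0 _ F1; move=> /(_ N) asymp.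
  exists ((-1) ^+ r * complex.Re (spline_spectrum p r (1 : R[i]))); split.
    have : (-1) ^+ r * complex.Re (spline_spectrum p r (phase omega)) @[omega --> (0 : R)^'] -->
        (-1) ^+ r * complex.Re (spline_spectrum p r (1 : R[i])).
      by apply: cvgM; [exact: cvg_cst|exact: cvg_Re_spline_spectrum].
    apply: cvg_trans; apply: near_eq_cvg.
    near=> omega; have o0 : omega != 0 by near: omega; exact: nbhs_dnbhs_neq.
    have opi : - pi <= omega <= pi.
      rewrite -ler_norml; near: omega; apply: dnbhs0_le; exact: pi_gt0.
    rewrite (spline_spectrumE p0 rp (cos_neq1 opi o0)) /=.
    by rewrite !mulrA -exprMn mulrN1 opprK expr1n mul1r.
  move: asymp; congr asymp_equiv; apply/funext => D; congr (_%:C).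
  have s1 : (-1) ^+ r * (-1) ^+ r = 1 :> R by rewrite -exprMn mulrN1 opprK expr1n.
  rewrite [RHS](_ : _ = sigma ^+ 2 / (2 * pi) * D ^+ (r + r).+1 *
    complex.Re (spline_spectrum p r (1 : R[i])) * ((-1) ^+ r * (-1) ^+ r)); last by ring.
  by rewrite s1 mulr1.
- by move=> omega opi o0; apply: c_coef_values; exact: cos_neq1.
Unshelve. all: by end_near.
Qed.
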